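(* Let $A$ be a truncated bi-Koszul algebra determined by $\varDelta_d$ with $d\ge4$, with $A_\infty$-Ext-algebra $E=E(A)=(E;m_2,m_d,m_{d+1})$. Then both $(E;m_2,m_d)$ and $(E;m_2,m_{d+1})$ are single $A_\infty$-algebras, generated by $E^1$, $E^2$ and $E^3$.
   Context: Fix a field $\mathbb F$. All graded algebras $A=\mathbb F\oplus A_1\oplus A_2\oplus\cdots$ are locally finite, connected and generated in degree 1; $\mathbb F$ also denotes the trivial graded left module $A/A_{\ge 1}$. Put $E(A)=\bigoplus_{p,j}E^p_j(A)$ with $E^p_j(A)=\underline{\mathrm{Ext}}^p_A(\mathbb F,\mathbb F)_{-j}$, where $\underline{\mathrm{Ext}}$ is the derived functor of $\underline{\mathrm{Hom}}_A(M,N)=\bigoplus_n\mathrm{Hom}_{Gr(A)}(M,N[n])$ (degree-zero graded maps, $N[n]_j=N_{n+j}$); $p$ is the cohomological degree and $j$ the lower grading; $E^p(A)=\bigoplus_j E^p_j(A)$. For $d\ge2$ let $\varDelta_d(3k)=(2dk,2dk)$, $\varDelta_d(3k+1)=(2dk+1,2dk+1)$, $\varDelta_d(3k+2)=(2dk+d,2dk+d+1)$ for $k\ge 0$. $A$ is a bi-Koszul algebra determined by $\varDelta_d$ if the trivial module $\mathbb F$ has a minimal graded free resolution $P$ in which $P_n$ is generated in degrees $\varDelta_d(n)$ (the pair viewed as a set) for all $n\ge0$. An $A_\infty$-algebra is a $\mathbb Z$-graded vector space $E$ with linear maps $m_n:E^{\otimes n}\to E$ of degree $2-n$ ($n\ge1$)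 such that for all $n\ge1$, $\sum(-1)^{i+jt}m_{i+1+j}(1^{\otimes i}\otimes m_t\otimes 1^{\otimes j})=0$, the sum over $n=i+t+j$, $i,j\ge0$, $t\ge1$. All $A_\infty$-algebras are strictly unital ($1\in E$ is a two-sided unit for $m_2$, and $m_n(x_1,\dots,x_n)=0$ for $n\ne2$ if some $x_i=1$). Writing $(E;m_a,m_b,\dots)$ means that all multiplications not listed are zero. An $A_\infty$-Ext-algebra structure on $E(A)$ is one obtained by the minimality theorem (Kadeishvili) from the differential graded algebra $\mathrm{End}_A(P)$, $P$ a free resolution of ${}_A\mathbb F$: thus $m_1=0$, $m_2$ is the Yoneda product, every $m_n$ preserves the lower grading, and $E(A)$ is quasi-isomorphic to $\mathrm{End}_A(P)$. Notation: $E^{[r]}=\bigoplus_{k\ge0}E^{3k+r}$ for $r=0,1,2$; $E^{[2]}_{(d)}=\bigoplus_k E^{3k+2}_{2dk+d}$, $E^{[2]}_{(d+1)}=\bigoplus_kE^{3k+2}_{2dk+d+1}$, so $E^{[2]}=E^{[2]}_{(d)}\oplus E^{[2]}_{(d+1)}$. Truncated: a bi-Koszul algebra $A$ determined by $\varDelta_d$ is truncated if its $A_\infty$-Ext-algebra $E$ only has the non-trivial multiplications $m_2,m_d,m_{d+1}$, and these vanish on tensor products of the pieces $E^{[0]}$, $E^{[1]}$, $E^{[2]}_{(d)}$, $E^{[2]}_{(d+1)}$ except possibly on the following (all permutations of factors included), with values in the indicated piece: $m_2$: $E^{[0]}E^{[0]}\to E^{[0]}$; $E^{[0]}E^{[1]}$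 and $E^{[2]}_{(d)}E^{[2]}_{(d+1)}\to E^{[1]}$; $E^{[0]}E^{[2]}\to E^{[2]}$. $m_d$: ($d-1$ factors $E^{[1]}$, one factor $E^{[2]}_{(d+1)}$) $\to E^{[0]}$; ($d$ factors $E^{[1]}$) $\to E^{[2]}$. $m_{d+1}$: ($d$ factors $E^{[1]}$, one factor $E^{[2]}_{(d)}$) $\to E^{[0]}$; ($d+1$ factors $E^{[1]}$) $\to E^{[2]}$. Single: an $A_\infty$-algebra with $m_1=0$ and only one non-trivial higher multiplication $m_p$ ($p\ge3$), i.e. $m_n=0$ for $n\notin\{2,p\}$ (a $(2,p)$-algebra). Generated by $E^1,E^2,E^3$: for every $p>3$, $E^p=\sum m_l(E^{i_1}\otimes\cdots\otimes E^{i_l})$, the sum over $l\ge1$ and $i_1,\dots,i_l\ge1$ with $i_1+\cdots+i_l+2-l=p$, using the multiplications of the $A_\infty$-algebra in question. *)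

(* Defs.v *)
From HB Require Import structures.
From mathcomp Require Import all_boot all_order all_algebra.

Set Implicit Arguments.
Unset Strict Implicit.
Unset Printing Implicit Defensive.

Import GRing.Theory.
Local Open Scope ring_scope.

(* Finite sums of elements of U.  Whenever it is used below, U is a union of
   subspaces or is closed under scalars, so this is the subspace spanned by U. *)
Definition addspan (V : zmodType) (U : V -> Prop) (x : V) : Prop :=
  exists s : seq V, (forall y, y \in s -> U y) /\ x = \sum_(y <- s) y.

(* Internal direct sum decomposition V = (+)_i G i into additive subgroups. *)
Record is_grading (I : eqType) (V : zmodType) (G : I -> V -> Prop) : Prop := {
  grading0 : forall i, G i 0;
  gradingB : forall i x y, G i x -> G i y -> G i (x - y);
  grading_sum : forall x, addspan (fun y => exists i, G i y) x;
  grading_direct : forall (s : seq I) (c : I -> V), uniq s ->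
    (forall i, G i (c i)) -> \sum_(i <- s) c i = 0 ->
    forall i, i \in s -> c i = 0 }.

(* A list of pairs (degree, element) all of whose elements are homogeneous of
   the recorded degree. *)
Definition homog (I : eqType) (V : zmodType) (G : I -> V -> Prop)
    (s : seq (I * V)) : Prop :=
  forall z, z \in s -> G z.1 z.2.

Definition total_degree (I : zmodType) (V : Type) (s : seq (I * V)) : I :=
  \sum_(z <- s) z.1.

(* ** Graded algebras *)

Record graded_algebra (F : fieldType) (A : algType F) (Ag : nat -> A -> Prop)
    : Prop := {
  galg_grading : is_grading Ag;
  galg_scale : forall i (c : F) a, Ag i a -> Ag i (c *: a);
  galg_mul : forall i j a b, Ag i a -> Ag j b -> Ag (i + j)%N (a * b);
  galg_one : Ag 0%N 1;
  galg_connected : forall a, Ag 0%N a -> exists c : F, a = c%:A;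
  galg_locally_finite : forall i, exists s : seq A, forall a, Ag i a ->
    exists c : A -> F, a = \sum_(b <- s) c b *: b;
  galg_degree1 : forall a : A, addspan (fun b => exists (c : F) (w : seq A),
    (forall x, x \in w -> Ag 1%N x) /\ b = c *: \prod_(x <- w) x) a }.

(* ** Graded free resolutions of the trivial module

   A complex P of graded left A-modules is given by its total module, bigraded
   by (homological degree, internal degree); P_n is the sum of the pieces
   (n, k), and the pieces with n < 0 vanish. *)

Section Resolutions.
Variables (F : fieldType) (A : algType F) (Ag : nat -> A -> Prop).
Variables (P : lmodType A) (Pg : int * int -> P -> Prop).

Definition graded_module : Prop :=
  is_grading Pg /\
  forall k a n l u, Ag k a -> Pg (n, l) u -> Pg (n, k%:Z + l) (a *: u).

Definition graded_free : Prop :=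
  exists B : P -> Prop,
    [/\ forall b, B b -> exists nk, Pg nk b,
        forall u, addspan (fun v => exists (a : A) (b : P),
                              B b /\ v = a *: b) u
      & forall (s : seq P) (a : P -> A), uniq s -> (forall b, b \in s -> B b) ->
          \sum_(b <- s) a b *: b = 0 -> forall b, b \in s -> a b = 0].

(* g lowers the bidegree (homological, internal) by pj.  For pj = (p, j) these
   are the elements of cohomological degree p and lower degree j of End_A(P),
   consistently with E^p_j = Ext^p(F, F)_{-j}. *)
Definition End_degree (pj : int * int) (g : P -> P) : Prop :=
  forall nk u, Pg nk u -> Pg (nk - pj) (g u).

(* Left A-linear maps from P to the trivial module F = A / A_{>=1}. *)
Definition linear_to_trivial (phi : P -> F) : Prop :=
  [/\ forall u v, phi (u + v) = phi u + phi v,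
      forall (c : F) u, phi (c%:A *: u) = c * phi u
    & forall k a u, (0 < k)%N -> Ag k a -> phi (a *: u) = 0].

(* Elements of Hom_A(P, F) of cohomological degree p and lower degree j. *)
Definition Hom_trivial_degree (pj : int * int) (phi : P -> F) : Prop :=
  linear_to_trivial phi /\
  forall nk u, Pg nk u -> nk <> pj -> phi u = 0.

Record free_resolution (dP : {linear P -> P}) (eta : P -> F) : Prop := {
  res_module : graded_module;
  res_free : graded_free;
  res_pos : forall n k u, n < 0 -> Pg (n, k) u -> u = 0;
  res_d_degree : End_degree (1, 0) dP;
  res_d_d : forall u, dP (dP u) = 0;
  res_eta : Hom_trivial_degree (0, 0) eta;
  res_eta_d : forall u, eta (dP u) = 0;
  res_eta_surj : exists u, eta u = 1;
  res_exact : forall n k u, n <> 0 -> Pg (n, k) u -> dP u = 0 ->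
    exists v, u = dP v;
  res_exact0 : forall k u, Pg (0, k) u -> eta u = 0 -> exists v, u = dP v }.

Definition minimal (dP : P -> P) : Prop :=
  forall u, addspan (fun v => exists k a w,
    [/\ (0 < k)%N, Ag k a & v = a *: w]) (dP u).

Definition generated_in_degrees (n : nat) (D : pred int) : Prop :=
  forall k u, Pg (n%:Z, k) u ->
    addspan (fun v => exists (a : A) l w,
      [/\ D l, Pg (n%:Z, l) w & v = a *: w]) u.

End Resolutions.

Definition Delta (d n : nat) : nat * nat :=
  let k := (n %/ 3)%N in
  match (n %% 3)%N with
  | 0 => (2 * d * k, 2 * d * k)
  | 1 => (2 * d * k + 1, 2 * d * k + 1)
  | _ => (2 * d * k + d, 2 * d * k + d + 1)
  end%N.

Definition bi_Koszul (F : fieldType) (A : algType F) (Ag : nat -> A -> Prop)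
    (d : nat) : Prop :=
  exists (P : lmodType A) (Pg : int * int -> P -> Prop)
         (dP : {linear P -> P}) (eta : P -> F),
    [/\ free_resolution Ag Pg dP eta,
        minimal Ag dP
      & forall n, generated_in_degrees Pg n
          (fun l => (l == (Delta d n).1%:Z) || (l == (Delta d n).2%:Z))].

(* ** A-infinity algebras

   The operations m_n : E^{(x) n} -> E, n >= 1, are packed in one function m on
   lists: m_n is the restriction of m to lists of length n.  The value of m on
   the empty list is irrelevant. *)

Definition sgn (e : int) : int := (-1) ^+ `|e|%N.

Definition multilinear (F : fieldType) (V : lmodType F) (m : seq V -> V) :=
  forall s1 s2 (c : F) x y,
    m (s1 ++ (c *: x + y) :: s2) = c *: m (s1 ++ x :: s2) + m (s1 ++ y :: s2).

(* sum over n = i + t + j of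
     (-1)^(i + j t) g_(i+1+j) (1^{(x) i} (x) m_t (x) 1^{(x) j}) (s),
   n = size s; the second sign is the Koszul sign from moving m_t, of degree
   2 - t, past the first i arguments. *)
Definition insertion_sum (V W : zmodType) (m : seq V -> V) (g : seq V -> W)
    (s : seq (int * V)) : W :=
  let n := size s in
  let xs := unzip2 s in
  \sum_(i < n.+1) \sum_(t < n.+1 | (0 < t)%N && (i + t <= n)%N)
    g (take i xs ++ m (take t (drop i xs)) :: drop (i + t) xs)
    *~ (sgn (i + (n - (i + t)) * t)%N
        * sgn ((2 - t%:Z) * total_degree (take i s))).

Record Ainf_algebra (F : fieldType) (V : lmodType F) (G : int -> V -> Prop)
    (m : seq V -> V) (one : V) : Prop := {
  Ainf_grading : is_grading G;
  Ainf_scale : forall i (c : F) x, G i x -> G i (c *: x);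
  Ainf_multilinear : multilinear m;
  Ainf_degree : forall s, s <> [::] -> homog G s ->
    G (total_degree s + (2 - (size s)%:Z)) (m (unzip2 s));
  Ainf_relation : forall s, s <> [::] -> homog G s -> insertion_sum m m s = 0;
  Ainf_one_degree : G 0 one;
  Ainf_mul1 : forall x, m [:: one; x] = x;
  Ainf_mulr1 : forall x, m [:: x; one] = x;
  Ainf_strict_unit : forall s, size s <> 2%N -> one \in s -> m s = 0 }.

Definition restrict_ops (V : zmodType) (ns : seq nat) (m : seq V -> V)
    (s : seq V) : V :=
  if size s \in ns then m s else 0.

Definition single_Ainf (F : fieldType) (V : lmodType F) (p : nat)
    (G : int -> V -> Prop) (m : seq V -> V) (one : V) : Prop :=
  [/\ (3 <= p)%N, Ainf_algebra G m one
    & forall s, s <> [::] -> size s \notin [:: 2%N; p] -> m s = 0].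

Definition generated_by_123 (V : zmodType) (G : int -> V -> Prop)
    (m : seq V -> V) : Prop :=
  forall p : int, 3 < p -> forall x, G p x <->
    addspan (fun y => exists s : seq (int * V),
      [/\ s <> [::], homog G s, forall z, z \in s -> 1 <= z.1,
          total_degree s + (2 - (size s)%:Z) = p & y = m (unzip2 s)]) x.

(* ** The A-infinity-Ext-algebra

   Bigraded spaces E are indexed by (p, j): E (p, j) is E^p_j. *)

Definition cohom (V : zmodType) (E : int * int -> V -> Prop) (p : int)
    : V -> Prop :=
  addspan (fun y => exists j, E (p, j) y).

Section AinfExt.
Variables (F : fieldType) (A : algType F) (Ag : nat -> A -> Prop).
Variables (P : lmodType A) (Pg : int * int -> P -> Prop).
Variables (dP : {linear P -> P}) (eta : P -> F).
Variables (V : lmodType F) (E : int * int -> V -> Prop).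

(* iota x is a cocycle of Hom_A(P, F) representing x, and this identifies
   E^p_j with H^p(Hom_A(P, F))_{-j} = Ext^p_A(F, F)_{-j}. *)
Record is_Ext (iota : V -> P -> F) : Prop := {
  Ext_linear : forall (c : F) x y u,
    iota (c *: x + y) u = c * iota x u + iota y u;
  Ext_cocycle : forall pj x, E pj x ->
    Hom_trivial_degree Ag Pg pj (iota x) /\ forall u, iota x (dP u) = 0;
  Ext_inj : forall pj x psi, E pj x ->
    Hom_trivial_degree Ag Pg (pj - (1, 0)) psi ->
    (forall u, iota x u = psi (dP u)) -> x = 0;
  Ext_surj : forall pj phi, Hom_trivial_degree Ag Pg pj phi ->
    (forall u, phi (dP u) = 0) ->
    exists x psi, [/\ E pj x, Hom_trivial_degree Ag Pg (pj - (1, 0)) psi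
                    & forall u, phi u = iota x u + psi (dP u)] }.

(* The differential of End_A(P) on an element g of cohomological degree p. *)
Definition End_diff (p : int) (g : P -> P) (u : P) : P :=
  dP (g u) - g (dP u) *~ sgn p.

(* A-infinity-morphisms f from (E, m) to the differential graded algebra
   End_A(P) (product: composition) that preserve the lower grading.
   f_n has degree 1 - n, and in f_relation, for n = size s,
     sum (-1)^(i + j t) f_(i+1+j) (1^i (x) m_t (x) 1^j)
       = End_diff f_n
         + sum_(0 < a < n) (-1)^(a - 1) f_a (x) f_(n-a) (composed),
   with the Koszul sign of moving f_(n-a) past the first a arguments. *)
Record Ainf_morphism_to_End (m : seq V -> V) (f : seq V -> {linear P -> P})
    : Prop := {
  f_multilinear : forall s1 s2 (c : F) x y u,
    f (s1 ++ (c *: x + y) :: s2) u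
    = c%:A *: f (s1 ++ x :: s2) u + f (s1 ++ y :: s2) u;
  f_degree : forall s, s <> [::] -> homog E s ->
    End_degree Pg (total_degree s + (1 - (size s)%:Z, 0)) (f (unzip2 s));
  f_relation : forall s u, s <> [::] -> homog (cohom E) s ->
    let n := size s in
    let xs := unzip2 s in
    insertion_sum m (fun ys => f ys u) s
    = End_diff (total_degree s + (1 - n%:Z)) (f xs) u
      + \sum_(1 <= a < n)
          f (take a xs) (f (drop a xs) u)
          *~ (sgn (a%:Z - 1)
              * sgn ((1 - (n - a)%N%:Z) * total_degree (take a s))) }.

(* f_1 induces an isomorphism from E (with m_1 = 0) to H(End_A(P)); that f_1
   takes values in cocycles is the case n = 1 of f_relation. *)
Definition quasi_iso_to_End (f : seq V -> {linear P -> P}) : Prop :=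
  (forall p j x (h : {linear P -> P}), E (p, j) x ->
     End_degree Pg (p - 1, j) h ->
     (forall u, f [:: x] u = End_diff (p - 1) h u) -> x = 0) /\
  (forall p j (g : {linear P -> P}), End_degree Pg (p, j) g ->
     (forall u, End_diff p g u = 0) ->
     exists x (h : {linear P -> P}),
       [/\ E (p, j) x, End_degree Pg (p - 1, j) h
         & forall u, g u = f [:: x] u + End_diff (p - 1) h u]).

End AinfExt.

(* (E; m) is the A-infinity-Ext-algebra of A: a minimal model of End_A(P) on
   E = Ext_A(F, F), the class x being represented by the endomorphism f_1 x.
   That m_2 is the Yoneda product is the case n = 2 of f_relation. *)
Record Ainf_Ext_algebra (F : fieldType) (A : algType F) (Ag : nat -> A -> Prop)
    (V : lmodType F) (E : int * int -> V -> Prop) (m : seq V -> V) (one : V)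
    : Prop := {
  AE_bigrading : is_grading E;
  AE_scale : forall pj (c : F) x, E pj x -> E pj (c *: x);
  AE_Ainf : Ainf_algebra (cohom E) m one;
  AE_lower_grading : forall s, s <> [::] -> homog E s ->
    E (total_degree s + (2 - (size s)%:Z, 0)) (m (unzip2 s));
  AE_m1 : forall x, m [:: x] = 0;
  AE_model : exists (P : lmodType A) (Pg : int * int -> P -> Prop)
      (dP : {linear P -> P}) (eta : P -> F) (f : seq V -> {linear P -> P}),
    [/\ free_resolution Ag Pg dP eta,
        Ainf_morphism_to_End Pg dP E m f,
        quasi_iso_to_End Pg dP E f
      & is_Ext Ag Pg dP E (fun x u => eta (f [:: x] u))] }.

(* ** Truncated bi-Koszul algebras *)

(* Labels of the pieces E^[0], E^[1], E^[2]_(d), E^[2]_(d+1). *)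
Inductive piece := E0 | E1 | E2d | E2d1.

Lemma piece_comparable : comparable piece.
Proof. by move=> x y; rewrite /decidable; decide equality. Qed.

HB.instance Definition _ :=
  hasDecEq.Build piece (compareP piece_comparable).

(* E^[r], the sum of the E^{3k+r}. *)
Definition cohom_mod3 (V : zmodType) (E : int * int -> V -> Prop) (r : nat)
    : V -> Prop :=
  addspan (fun y => exists (k : nat) (j : int), E ((3 * k + r)%N%:Z, j) y).

Definition piece_space (V : zmodType) (E : int * int -> V -> Prop) (d : nat)
    (q : piece) : V -> Prop :=
  match q with
  | E0 => cohom_mod3 E 0
  | E1 => cohom_mod3 E 1
  | E2d => addspan (fun y => exists k : nat,
             E ((3 * k + 2)%N%:Z, (2 * d * k + d)%N%:Z) y)
  | E2d1 => addspan (fun y => exists k : nat,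
             E ((3 * k + 2)%N%:Z, (2 * d * k + d + 1)%N%:Z) y)
  end.

(* The possibly nonzero products: arguments up to permutation, and the r such
   that the values lie in E^[r]. *)
Definition truncated_table (d : nat) : seq (seq piece * nat) :=
  [:: ([:: E0; E0], 0);
      ([:: E0; E1], 1);
      ([:: E2d; E2d1], 1);
      ([:: E0; E2d], 2);
      ([:: E0; E2d1], 2);
      (E2d1 :: nseq d.-1 E1, 0);
      (nseq d E1, 2);
      (E2d :: nseq d E1, 0);
      (nseq d.+1 E1, 2)]%N.

Definition truncated_ops (V : zmodType) (E : int * int -> V -> Prop) (d : nat)
    (m : seq V -> V) : Prop :=
  (forall s, s <> [::] -> size s \notin [:: 2; d; d.+1]%N -> m s = 0) /\
  (forall s : seq (piece * V), s <> [::] -> homog (piece_space E d) s ->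
     (forall w r, (w, r) \in truncated_table d -> perm_eq (unzip1 s) w ->
        cohom_mod3 E r (m (unzip2 s))) /\
     ((forall w r, (w, r) \in truncated_table d -> ~~ perm_eq (unzip1 s) w) ->
        m (unzip2 s) = 0)).

(* A is a truncated bi-Koszul algebra determined by Delta_d, with
   A-infinity-Ext-algebra (E; m). *)
Record truncated_bi_Koszul (F : fieldType) (A : algType F)
    (Ag : nat -> A -> Prop) (d : nat) (V : lmodType F)
    (E : int * int -> V -> Prop) (m : seq V -> V) (one : V) : Prop := {
  trunc_bi_Koszul : bi_Koszul Ag d;
  trunc_Ext : Ainf_Ext_algebra Ag E m one;
  trunc_ops : truncated_ops E d m }.

(* Main.v *)
(* The three arities 2, d, d+1 can only meet in Stasheff relations of sizes 3,
   d+1, d+2, 2d-1, 2d, 2d+1, which are distinct when d >= 4; so each of m_d and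
   m_(d+1) satisfies the relations with m_2 alone.

   For the generation, the key fact is that E^p is spanned by the elements
   m_n(e_1, ..., e_(n-1), z) with e_i in E^1_1 and z in E^(p-1).  Let (a_i) be a
   basis of A_1 and (e_i) the dual elements of E^1_1.  Obstruction theory,
   degree by degree, shows that sum_i e_i (x) a_i is a Maurer-Cartan element of
   E (x) A, and gives a map from E twisted by A to the A-linear maps P -> A.
   A cocycle phi on a minimal resolution Q is psi d for an F-linear psi; as
   Q is generated in bounded degrees, psi is a finite combination
   sum_t c_t(Omega_(z_t)) of values of that map, and comparing phi with psi d
   writes the class of phi as a combination of such m_n(e_1, ..., z).

   By the truncation table this reads E^(3k+1) = E^1 E^(3k), while in
   m_n(e_1, ..., e_(n-1), z), n in {d, d+1}, the Stasheff relation moves a factor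
   of degree 3k out of z; hence E^(3k+r) = E^r E^(3k) for r = 1, 2, 3 and k >= 1,
   with m_2 only. *)

Require Import Defs.
From HB Require Import structures.
From mathcomp Require Import all_boot all_order all_algebra.
From mathcomp Require Import boolp classical_sets.
From mathcomp Require Import zify ring.

Set Implicit Arguments.
Unset Strict Implicit.
Unset Printing Implicit Defensive.

Import Order.TTheory GRing.Theory Num.Theory.
Local Open Scope ring_scope.

(** * Spans and gradings *)

(** The model of [E] lives on an arbitrary free resolution P, while the degree bounds are known on
    the minimal resolution Q. A single comparison map from Q to P bridges the two: minimality makes
    the differential of Hom_A(Q, F) zero, so a class is zero as soon as its representative vanishes
    after pulling back to Q, and equations in [E] can be tested on elements of Q.

    A may be infinite dimensional, and the full twisting map would need a limit over all internal
    degrees. None is taken: a class of lower degree J only involves A in degrees at most J, so a map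
    satisfying the twisted equation up to a stage K >= J suffices, and elements of E (x) A become
    finite lists of words. The Maurer-Cartan equation keeps the relations short: it cancels every
    insertion of an operation among the letters alone and leaves those that swallow the last
    argument z.

    Raising the stage from N to N + 1 meets an obstruction in E^2_(N+1), which is the next part of
    the Maurer-Cartan equation, and a second one in E^1_(N+1), which is zero for N > 0 because Q_1
    is generated in degree 1. *)

Section Addspan.
Variable V : zmodType.
Implicit Types (U K : V -> Prop) (x y : V).

Lemma addspan_in U x : U x -> addspan U x.
Proof.
move=> Ux; exists [:: x]; split; last by rewrite big_seq1.
by move=> y; rewrite inE => /eqP->.
Qed.

Lemma addspan0 U : addspan U 0.
Proof. by exists [::]; rewrite big_nil. Qed.

Lemma addspanD U x y : addspan U x -> addspan U y -> addspan U (x + y).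
Proof.
move=> [s [sU ->]] [t [tU ->]]; exists (s ++ t); split; last by rewrite big_cat.
by move=> z; rewrite mem_cat => /orP[/sU|/tU].
Qed.

Lemma addspan_ind U K : K 0 -> (forall x y, K x -> K y -> K (x + y)) ->
  (forall x, U x -> K x) -> forall x, addspan U x -> K x.
Proof.
move=> K0 KD UK x [s [sU ->]].
by rewrite big_seq; elim/big_ind: _ => // y /sU /UK.
Qed.

Lemma addspan_sum U (T : eqType) (r : seq T) (P : pred T) (h : T -> V) :
  (forall i, i \in r -> P i -> addspan U (h i)) ->
  addspan U (\sum_(i <- r | P i) h i).
Proof.
move=> hU; rewrite big_seq_cond.
elim/big_ind: _ => [|x y|i /andP[ir Pi]]; [exact: addspan0|exact: addspanD|].
exact: hU.
Qed.

End Addspan.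

Lemma addspan_hom (V W : zmodType) (U : V -> Prop) (U' : W -> Prop)
    (h : V -> W) : h 0 = 0 -> {morph h : x y / x + y} ->
  (forall x, U x -> addspan U' (h x)) ->
  forall x, addspan U x -> addspan U' (h x).
Proof.
move=> h0 hD UU'; apply: addspan_ind => [|x y Kx Ky|//].
  by rewrite h0; apply: addspan0.
by rewrite hD; apply: addspanD.
Qed.

Lemma addspan_sub (V : zmodType) (U U' : V -> Prop) :
  (forall x, U x -> addspan U' x) -> forall x, addspan U x -> addspan U' x.
Proof. exact: addspan_hom. Qed.

Lemma big_fibers (V : zmodType) (T K : eqType) (key : T -> K) (l : seq T)
    (h : T -> V) :
  \sum_(z <- l) h z
  = \sum_(k <- undup (map key l)) \sum_(z <- l | key z == k) h z.
Proof.
under [RHS]eq_bigr do rewrite big_mkcond.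
rewrite exchange_big /= [LHS]big_seq [RHS]big_seq; apply: eq_bigr => z zl.
rewrite -big_mkcond (eq_bigl (pred1 (key z))) => [|k]; last by rewrite eq_sym.
by rewrite -big_filter filter_pred1_uniq ?undup_uniq ?mem_undup ?map_f ?big_seq1.
Qed.

Lemma morph_add0 (V W : zmodType) (h : V -> W) :
  {morph h : x y / x + y} -> h 0 = 0.
Proof. by move=> hD; apply: (addrI (h 0)); rewrite -hD !addr0. Qed.

Lemma morph_sum (V W : zmodType) (h : V -> W) (T : Type) (r : seq T)
    (P : pred T) (g : T -> V) : {morph h : x y / x + y} ->
  h (\sum_(i <- r | P i) g i) = \sum_(i <- r | P i) h (g i).
Proof. by move=> hD; apply: big_morph => //; apply: morph_add0. Qed.

Lemma morph_opp (V W : zmodType) (h : V -> W) x :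
  {morph h : x y / x + y} -> h (- x) = - h x.
Proof.
by move=> hD; apply: (addIr (h x)); rewrite -hD !addNr morph_add0.
Qed.

Lemma morph_mulrz (V W : zmodType) (h : V -> W) x m :
  {morph h : x y / x + y} -> h (x *~ m) = h x *~ m.
Proof.
move=> hD; have hM n : h (x *+ n) = h x *+ n.
  by elim: n => [|n IH]; rewrite ?mulr0n ?(morph_add0 hD) // !mulrS hD IH.
by case: m => n; rewrite ?NegzE ?mulrNz ?(morph_opp _ hD) -!pmulrn hM.
Qed.

Section Grading.
Variables (I : eqType) (V : zmodType) (G : I -> V -> Prop).
Hypothesis hG : is_grading G.

Lemma gradingN i x : G i x -> G i (- x).
Proof. by rewrite -sub0r; apply: gradingB => //; apply: grading0. Qed.

Lemma gradingD i x y : G i x -> G i y -> G i (x + y).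
Proof. by move=> Gx Gy; rewrite -[y]opprK; apply: gradingB => //; apply: gradingN. Qed.

Lemma gradingMz i x m : G i x -> G i (x *~ m).
Proof.
move=> Gx; have GM n : G i (x *+ n).
  by elim: n => [|n IH]; rewrite ?mulr0n ?mulrS; [exact: grading0|exact: gradingD].
by case: m => n; rewrite ?NegzE ?mulrNz -pmulrn //; apply: gradingN.
Qed.

Lemma graded_sum (T : eqType) (r : seq T) (P : pred T) (h : T -> V) i :
  (forall k, k \in r -> P k -> G i (h k)) -> G i (\sum_(k <- r | P k) h k).
Proof.
move=> hU; rewrite big_seq_cond.
elim/big_ind: _ => [|x y|k /andP[kr Pk]]; [exact: grading0|exact: gradingD|].
exact: hU.
Qed.

Lemma homog_comp_eq0 (l : seq (I * V)) :
  homog G l -> \sum_(z <- l) z.2 = 0 ->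
  forall i, \sum_(z <- l | z.1 == i) z.2 = 0.
Proof.
move=> hl; rewrite (big_fibers fst) => /(grading_direct hG).
set s := undup _ => H i.
have [si|nsi] := boolP (i \in s).
  apply: H (si) => [|k]; first exact: undup_uniq.
  by apply: graded_sum => z zl /eqP<-; apply: hl.
rewrite big_seq_cond big1 // => z /andP[zl /eqP zi].
by rewrite mem_undup -zi map_f in nsi.
Qed.

Lemma homog_comp_unique (l l' : seq (I * V)) :
  homog G l -> homog G l' -> \sum_(z <- l) z.2 = \sum_(z <- l') z.2 ->
  forall i, \sum_(z <- l | z.1 == i) z.2 = \sum_(z <- l' | z.1 == i) z.2.
Proof.
move=> hl hl' e i; apply/eqP; rewrite -GRing.subr_eq0; apply/eqP.
have := @homog_comp_eq0 (l ++ map (fun z => (z.1, - z.2)) l') _ _ i.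
rewrite !big_cat !big_map /= !sumrN e subrr; apply=> //.
move=> z; rewrite mem_cat => /orP[/hl //|/mapP[y /hl' Gy ->]].
exact: gradingN.
Qed.

Lemma homog_decomp x : exists l, homog G l /\ x = \sum_(z <- l) z.2.
Proof.
elim/addspan_ind: x / (grading_sum hG x) => [|x y [l [hl ->]] [l' [hl' ->]]|x [i Gx]].
- by exists [::]; rewrite big_nil.
- exists (l ++ l'); rewrite big_cat; split=> // z.
  by rewrite mem_cat => /orP[/hl|/hl'].
- exists [:: (i, x)]; rewrite big_seq1; split=> // z.
  by rewrite inE => /eqP->.
Qed.

(** The decomposition is picked by choice; [homog_comp_unique] makes the component independent of
    it. *)
Definition gproj (i : I) (x : V) : V :=
  \sum_(z <- sval (cid (homog_decomp x)) | z.1 == i) z.2.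

Lemma gproj_homog l i : homog G l ->
  gproj i (\sum_(z <- l) z.2) = \sum_(z <- l | z.1 == i) z.2.
Proof.
by move=> hl; rewrite /gproj; case: cid => l' [hl' e] /=; apply: homog_comp_unique.
Qed.

Lemma gproj_in i x : G i (gproj i x).
Proof.
rewrite /gproj; case: cid => l [hl _] /=.
by apply: graded_sum => z /hl Gz /eqP<-.
Qed.

Lemma gprojD i : {morph gproj i : x y / x + y}.
Proof.
move=> x y; have [l [hl ->]] := homog_decomp x.
have [l' [hl' ->]] := homog_decomp y.
rewrite -big_cat !gproj_homog // ?big_cat // => z.
by rewrite mem_cat => /orP[/hl|/hl'].
Qed.

Lemma gproj_id i j x : G i x -> gproj j x = if i == j then x else 0.
Proof.
move=> Gx; have := @gproj_homog [:: (i, x)] j.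
rewrite !big_cons !big_nil /= !addr0; apply=> z.
by rewrite inE => /eqP->.
Qed.

Lemma gproj_sum x : exists2 s, uniq s & x = \sum_(i <- s) gproj i x.
Proof.
have [l [hl ->]] := homog_decomp x; exists (undup (map fst l)).
  exact: undup_uniq.
by rewrite {1}(big_fibers fst); apply: eq_bigr => i _; rewrite gproj_homog.
Qed.

(** The standard way below to reduce an identity of additive maps to homogeneous elements, where
    degree arguments apply. *)
Lemma graded_ext (W : zmodType) (h h' : V -> W) :
  {morph h : x y / x + y} -> {morph h' : x y / x + y} ->
  (forall i x, G i x -> h x = h' x) -> h =1 h'.
Proof.
move=> hD hD' hh x; have [s _ ->] := gproj_sum x.
rewrite !morph_sum //; apply: eq_bigr => i _.
by apply: (hh i); apply: gproj_in.
Qed.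

Lemma gproj_morph i (h : V -> V) : {morph h : x y / x + y} ->
  (forall k x, G k x -> G k (h x)) -> forall x, gproj i (h x) = h (gproj i x).
Proof.
move=> hD hG'; apply: graded_ext => [x y|x y|k x Gx].
- by rewrite hD gprojD.
- by rewrite gprojD hD.
- rewrite (gproj_id _ (hG' _ _ Gx)) (gproj_id _ Gx).
  by case: eqP => // _; rewrite (morph_add0 hD).
Qed.

Lemma grading_disjoint i j x : G i x -> G j x -> i != j -> x = 0.
Proof.
move=> Gi Gj ij; have := gproj_id i Gj; rewrite (gproj_id i Gi) eqxx.
by rewrite eq_sym (negbTE ij).
Qed.

End Grading.

(** The map is read off a chosen decomposition of each element; [zero] shows that two decompositions
    give the same value. *)
Lemma free_ext (A : nzRingType) (P Q : lmodType A) (B : P -> Prop)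
    (h : P -> Q) :
  (forall u, addspan (fun v => exists (a : A) (b : P), B b /\ v = a *: b) u) ->
  (forall (s : seq P) (a : P -> A), uniq s -> (forall b, b \in s -> B b) ->
     \sum_(b <- s) a b *: b = 0 -> forall b, b \in s -> a b = 0) ->
  exists s : {linear P -> Q}, forall b, B b -> s b = h b.
Proof.
move=> span indep.
have decomp u : exists l : seq (A * P),
    (forall z, z \in l -> B z.2) /\ u = \sum_(z <- l) z.1 *: z.2.
  elim/addspan_ind: u / (span u) => [|x y [l [hl ->]] [l' [hl' ->]]|_ [a [b [Bb ->]]]].
  - by exists [::]; rewrite big_nil.
  - exists (l ++ l'); rewrite big_cat; split=> // z.
    by rewrite mem_cat => /orP[/hl|/hl'].
  - exists [:: (a, b)]; rewrite big_seq1; split=> // z.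
    by rewrite inE => /eqP->.
have zero (l : seq (A * P)) : (forall z, z \in l -> B z.2) ->
    \sum_(z <- l) z.1 *: z.2 = 0 -> \sum_(z <- l) z.1 *: h z.2 = 0.
  (* Independence speaks of duplicate-free lists only, so the coefficients of equal basis elements
     are collected. *)
  move=> hl; rewrite (big_fibers snd) => l0; rewrite (big_fibers snd).
  have eqB (R : lmodType A) (k : P -> R) b : \sum_(z <- l | z.2 == b) z.1 *: k z.2 =
      (\sum_(z <- l | z.2 == b) z.1) *: k b.
    by rewrite scaler_suml; apply: eq_bigr => z /eqP->.
  rewrite big_seq big1 // => b bs; rewrite eqB.
  rewrite (indep _ (fun b => \sum_(z <- l | z.2 == b) z.1) _ _ _ b bs) ?scale0r //.
  - exact: undup_uniq.
  - by move=> c; rewrite mem_undup => /mapP[z /hl Bz ->].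
  - by rewrite -[RHS]l0; apply: eq_bigr => c _; rewrite (eqB _ id).
pose s u := \sum_(z <- sval (cid (decomp u))) z.1 *: h z.2.
have sE (l : seq (A * P)) : (forall z, z \in l -> B z.2) ->
    s (\sum_(z <- l) z.1 *: z.2) = \sum_(z <- l) z.1 *: h z.2.
  move=> hl; rewrite /s; case: cid => l' [hl' e] /=.
  apply/eqP; rewrite -GRing.subr_eq0; apply/eqP.
  have := zero (l' ++ map (fun z => (- z.1, z.2)) l).
  rewrite !big_cat !big_map /=.
  have neg (R : lmodType A) (k : P -> R) :
      \sum_(z <- l) - z.1 *: k z.2 = - \sum_(z <- l) z.1 *: k z.2.
    by rewrite -sumrN; apply: eq_bigr => z _; rewrite scaleNr.
  rewrite (neg _ id) neg e subrr; apply=> // z.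
  by rewrite mem_cat => /orP[/hl'//|/mapP[y /hl By ->]].
have slin : linear s.
  move=> a u v; have [l [hl ->]] := decomp u; have [l' [hl' ->]] := decomp v.
  have := sE (map (fun z => (a * z.1, z.2)) l ++ l').
  rewrite !big_cat !big_map /= !sE // !scaler_sumr.
  have mul (R : lmodType A) (k : P -> R) :
      \sum_(z <- l) (a * z.1) *: k z.2 = \sum_(z <- l) a *: (z.1 *: k z.2).
    by apply: eq_bigr => z _; rewrite scalerA.
  rewrite (mul _ id) mul; apply=> z; rewrite mem_cat => /orP[/mapP[y /hl By ->]|/hl' //].
  exact: By.
pose S : {linear P -> Q} := HB.pack s (GRing.isLinear.Build A P Q *:%R s slin).
exists S => b Bb /=; have := sE [:: (1, b)].
rewrite !big_seq1 /= !scale1r; apply=> z.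
by rewrite inE => /eqP->.
Qed.

(** * Functionals on vector spaces *)

(** A maximal subspace X containing N and avoiding u is a hyperplane: every v is congruent modulo X
    to exactly one multiple of u, and that coefficient is the value of the functional. *)
Lemma separating_functional (F : fieldType) (V : lmodType F) (N : V -> Prop)
    (u : V) : N 0 -> (forall (c : F) x y, N x -> N y -> N (c *: x + y)) ->
  ~ N u -> exists lam : {scalar V}, lam u = 1 /\ forall x, N x -> lam x = 0.
Proof.
move=> N0 Nlin Nu.
(* Containing N is required of nonempty X only, so that the empty set, union of the empty chain, is
   admissible for Zorn's lemma. A maximal X is nonempty because N itself is admissible. *)
pose ok (X : set V) := [/\ forall x y, X x -> N y -> X y,
  forall (c : F) x y, X x -> X y -> X (c *: x + y) & ~ X u].
have [FF FFok tot|X [[XN Xlin Xu] Xmax]] := @Zorn_bigcup V ok.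
  split=> [x y [Y FY Yx] Ny|c x y [Y FY Yx] [Z FZ Zy]|[Y FY Yu]].
  - by exists Y => //; have [h _ _] := FFok _ FY; apply: h Yx Ny.
  - have [YZ|ZY] := tot _ _ FY FZ.
      by exists Z => //; have [_ h _] := FFok _ FZ; apply: h => //; apply: YZ.
    by exists Y => //; have [_ h _] := FFok _ FY; apply: h => //; apply: ZY.
  - by have [_ _] := FFok _ FY; apply.
have X0 : X 0.
  have [//|nX0] := pselect (X 0); exfalso.
  have nX x : ~ X x by move=> Xx; apply: nX0; apply: XN Xx N0.
  apply: (Xmax (fun x => N x)) => //.
    rewrite properEneq; split; last by move=> x /nX.
    by apply/eqP => e; apply: nX0; rewrite e.
have NX x : N x -> X x by apply: XN X0.
(* If v is outside X, maximality forces u into X + Fv, and its coefficient on v is nonzero since u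
   is not in X. *)
have dec v : exists c : F, X (v - c *: u).
  have [Xv|nXv] := pselect (X v); first by exists 0; rewrite scale0r subr0.
  have [[a [c [Xa uE]]]|nu] := pselect (exists a c, X a /\ u = a + c *: v).
    have c0 : c != 0.
      by apply/eqP => c0; apply: Xu; rewrite uE c0 scale0r addr0.
    exists c^-1; rewrite uE scalerDr scalerA mulVf // scale1r.
    rewrite opprD addrCA subrr addr0 -scaleNr -[_ *: _]addr0.
    exact: Xlin.
  exfalso; apply: (Xmax (fun x => exists a c, X a /\ x = a + c *: v)).
    rewrite properEneq; split.
      apply/eqP => e; apply: nXv; rewrite e; exists 0, 1.
      by rewrite add0r scale1r.
    by move=> x Xx; exists x, 0; rewrite scale0r addr0.
  split=> // [x y _ Ny|k x y [a [c [Xa ->]]] [b [e [Xb ->]]]].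
    by exists y, 0; rewrite scale0r addr0; split => //; apply: NX.
  exists (k *: a + b), (k * c + e); split; first exact: Xlin.
  by rewrite scalerDr scalerDl scalerA addrACA.
pose lam v := sval (cid (dec v)).
have lamP v c : X (v - c *: u) -> lam v = c.
  rewrite /lam; case: cid => e /= Xe Xc; apply: contrapT => /eqP ec; apply: Xu.
  have : X ((c - e)^-1 *: ((-1) *: (v - c *: u) + (v - e *: u)) + 0).
    by apply: (Xlin) => //; apply: (Xlin).
  rewrite addr0 scaleN1r opprB addrA subrK -scalerBl.
  by rewrite scalerA mulVf ?scale1r // subr_eq0 eq_sym.
have lamin v : X (v - lam v *: u) by rewrite /lam; case: cid.
have lamlin : scalar lam.
  move=> c x y; apply: lamP.
  have -> : c *: x + y - (c * lam x + lam y) *: u =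
      c *: (x - lam x *: u) + (y - lam y *: u).
    by rewrite scalerBr scalerA scalerDl opprD addrACA.
  exact: Xlin.
pose L : {scalar V} := HB.pack lam (GRing.isLinear.Build F V F *%R lam lamlin).
exists L; split=> [|x Nx] /=; apply: lamP; first by rewrite scale1r subrr.
by rewrite scale0r subr0; apply: NX.
Qed.

(** If phi(u1) = 1, then D(u1) is outside D(ker phi). A functional separating the two agrees with
    phi through D, since u - phi(u) u1 lies in ker phi. *)
Lemma functional_factor (F : fieldType) (V W : lmodType F)
    (D : {linear V -> W}) (phi : {scalar V}) :
  (forall u, D u = 0 -> phi u = 0) ->
  exists psi : {scalar W}, forall u, phi u = psi (D u).
Proof.
move=> ker; have [[u pu]|n0] := pselect (exists u, phi u <> 0); last first.
  exists \0 => u; apply: contrapT => pu; apply: n0; exists u => e.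
  by apply: pu; rewrite e.
have [u1 pu1] : exists u1, phi u1 = 1.
  by exists ((phi u)^-1 *: u); rewrite linearZ /= mulVf //; apply/eqP.
have [| | |lam [lam1 lam0]] :=
    @separating_functional F W (fun w => exists2 v, phi v = 0 & w = D v) (D u1).
- by exists 0; rewrite linear0.
- move=> c _ _ [x px ->] [y py ->]; exists (c *: x + y).
    by rewrite linearP px py mulr0 addr0.
  by rewrite linearP.
- move=> [v pv e]; have: phi (u1 - v) = 0 by apply: ker; rewrite linearB e subrr.
  by rewrite linearB /= pu1 pv subr0 => /eqP; rewrite oner_eq0.
exists lam => v.
have: lam (D (v - phi v *: u1)) = 0.
  apply: lam0; exists (v - phi v *: u1) => //.
  by rewrite linearB linearZ /= pu1 mulr1 subrr.
rewrite !linearB !linearZ /= lam1 mulr1 => /eqP.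
by rewrite subr_eq0 => /eqP.
Qed.

(** Induction on the spanning list: the part of G lying in the span of the tail has codimension at
    most one in G. A missing vector g is added to the basis, and its coordinate is a functional
    separating g from the span of the tail. *)
Lemma finite_coordinates (F : fieldType) (V : lmodType F) (s : seq V)
    (G : V -> Prop) : G 0 ->
  (forall (c : F) x y, G x -> G y -> G (c *: x + y)) ->
  (forall x, G x -> exists c : V -> F, x = \sum_(b <- s) c b *: b) ->
  exists (n : nat) (b : 'I_n -> V) (c : 'I_n -> {scalar V}),
    (forall i, G (b i)) /\ forall x, G x -> x = \sum_i c i x *: b i.
Proof.
pose fix spanl (s : seq V) (x : V) {struct s} : Prop :=
  if s is b :: s' then exists c : F, spanl s' (x - c *: b) else x = 0.
have spanlP t : forall c : V -> F, spanl t (\sum_(b <- t) c b *: b).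
  elim: t => [|b t IH] c /=; first by rewrite big_nil.
  by exists (c b); rewrite big_cons addrAC subrr add0r.
have spanlL t : forall (c : F) x y, spanl t x -> spanl t y -> spanl t (c *: x + y).
  elim: t => [|b t IH] c x y /=; first by move=> -> ->; rewrite scaler0 addr0.
  move=> [k hk] [l hl]; exists (c * k + l).
  have -> : c *: x + y - (c * k + l) *: b = c *: (x - k *: b) + (y - l *: b).
    by rewrite scalerBr scalerA scalerDl opprD addrACA.
  exact: IH.
have spanl0 t : spanl t 0.
  by elim: t => //= b t IH; exists 0; rewrite scale0r subr0.
move=> G0 Glin Gs.
have {Gs} Gs x : G x -> spanl s x by move=> /Gs[c ->]; apply: spanlP.
elim: s G G0 Glin Gs => [|b s IH] G G0 Glin Gs.
  exists 0%N, (fun=> 0), (fun=> \0); split=> // x /Gs /= ->.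
  by rewrite big_ord0.
have [] := IH (fun x => G x /\ spanl s x).
- by split.
- by move=> c x y [Gx sx] [Gy sy]; split; [exact: Glin|exact: spanlL].
- by move=> x [].
move=> n [e [c [Ge ce]]].
have [[g [Gg ng]]|all] := pselect (exists g, G g /\ ~ spanl s g); last first.
  exists n, e, c; split=> [i|x Gx]; first by case: (Ge i).
  apply: ce; split=> //; apply: contrapT => nx; apply: all.
  by exists x.
have [k0 sk0] := Gs _ Gg.
have k0n : k0 != 0 by apply/eqP => e0; apply: ng; move: sk0; rewrite e0 scale0r subr0.
have dec x : G x -> exists l, spanl s (x - l *: g).
  move=> /Gs[k sk]; exists (k / k0).
  have -> : x - (k / k0) *: g = (- (k / k0)) *: (g - k0 *: b) + (x - k *: b).
    by rewrite scalerBr !scaleNr opprK scalerA divfK // addrACA subrr addr0 addrC.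
  exact: spanlL.
have [lam [lam1 lam0]] := separating_functional (spanl0 s) (spanlL s) ng.
have lamx x : G x -> spanl s (x - lam x *: g).
  move=> /dec[l sl]; suff -> : lam x = l by [].
  have := lam0 _ sl; rewrite linearB linearZ /= lam1 mulr1 => /eqP.
  by rewrite subr_eq0 => /eqP.
have cl i : scalar (fun x => c i (x - lam x *: g)).
  move=> k x y /=.
  have -> : k *: x + y - lam (k *: x + y) *: g =
      k *: (x - lam x *: g) + (y - lam y *: g).
    by rewrite linearP /= scalerBr scalerA scalerDl opprD addrACA.
  by rewrite linearP.
pose c' i : {scalar V} := HB.pack (fun x => c i (x - lam x *: g))
   (GRing.isLinear.Build F V F *%R (fun x => c i (x - lam x *: g)) (cl i)).
exists n.+1, (fun i => if unlift ord0 i is Some j then e j else g),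
  (fun i => if unlift ord0 i is Some j then c' j else lam).
split=> [i|x Gx]; first by case: unliftP => // j _; case: (Ge j).
rewrite big_ord_recl unlift_none /=.
under eq_bigr do rewrite liftK /=.
rewrite -ce; first by rewrite addrC subrK.
split; last exact: lamx.
by rewrite addrC -scaleNr; apply: Glin.
Qed.

(* Q seen as a vector space over F. *)
Definition restr_scal (F : fieldType) (A : algType F) (Q : lmodType A) : Type := Q.

Section RestrScal.
Variables (F : fieldType) (A : algType F) (Q : lmodType A).
HB.instance Definition _ := GRing.Zmodule.on (restr_scal Q).

Definition rscale (c : F) (u : restr_scal Q) : restr_scal Q := (c%:A : A) *: (u : Q).

Fact rscaleA a b v : rscale a (rscale b v) = rscale (a * b) v.
Proof. by rewrite /rscale scalerA -scalerAl mul1r scalerA. Qed.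
Fact rscale1 : left_id 1 rscale.
Proof. by move=> v; rewrite /rscale !scale1r. Qed.
Fact rscaleDr : right_distributive rscale +%R.
Proof. by move=> a u v; rewrite /rscale scalerDr. Qed.
Fact rscaleDl v : {morph rscale^~ v : a b / a + b}.
Proof. by move=> a b; rewrite /rscale !scalerDl. Qed.

HB.instance Definition _ := GRing.Zmodule_isLmodule.Build F (restr_scal Q)
  rscaleA rscale1 rscaleDr rscaleDl.

Lemma rscaleE (c : F) (u : Q) : c *: (u : restr_scal Q) = (c%:A : A) *: u :> Q.
Proof. by []. Qed.
End RestrScal.

(** * Graded modules and free resolutions *)

Lemma pairB (n k p j : int) : (n, k) - (p, j) = (n - p, k - j) :> (int * int)%type.
Proof. by []. Qed.

Lemma pairD (n k p j : int) : (n, k) + (p, j) = (n + p, k + j) :> (int * int)%type.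
Proof. by []. Qed.

(* The grading of A, extended by zero to negative degrees. *)
Definition intgr (A : zmodType) (Ag : nat -> A -> Prop) (l : int) (a : A) : Prop :=
  if l is Posz n then Ag n a else a = 0.

Section GradedAlgebra.
Variables (F : fieldType) (A : algType F) (Ag : nat -> A -> Prop).
Hypothesis hA : graded_algebra Ag.
Let gA := galg_grading hA.
Local Notation Az := (intgr Ag).

Lemma intgr0 l : Az l 0.
Proof. by case: l => n //=; apply: (grading0 gA). Qed.

Lemma intgrB l a b : Az l a -> Az l b -> Az l (a - b).
Proof.
case: l => n /=; first exact: (gradingB gA).
by move=> -> ->; rewrite subrr.
Qed.

Lemma intgrD l a b : Az l a -> Az l b -> Az l (a + b).
Proof.
case: l => n /=; first exact: (gradingD gA).
by move=> -> ->; rewrite addr0.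
Qed.

Lemma intgr_sum l (T : eqType) (r : seq T) (P : pred T) (h : T -> A) :
  (forall i, i \in r -> P i -> Az l (h i)) -> Az l (\sum_(i <- r | P i) h i).
Proof.
move=> hU; rewrite big_seq_cond.
elim/big_ind: _ => [|x y|k /andP[kr Pk]]; [exact: intgr0|exact: intgrD|].
exact: hU.
Qed.

Lemma intgrM i j a b : Az i a -> Az j b -> Az (i + j) (a * b).
Proof.
case: i => i /= ha; last by rewrite ha mul0r => _; apply: intgr0.
case: j => j /= hb; last by rewrite hb mulr0; apply: intgr0.
exact: (galg_mul hA).
Qed.

Lemma intgr_lt0 l a : (l < 0)%R -> Az l a -> a = 0.
Proof. by case: l. Qed.

Lemma Ag0_alg (c : F) : Ag 0%N c%:A.
Proof. by apply: (galg_scale hA); apply: (galg_one hA). Qed.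

(** The coordinates are precomposed with the projection to A_k, hence defined on all of A and zero
    in the other degrees. This turns degree bounds into vanishing of coordinates. *)
Lemma galg_coordinates k : exists n (b : 'I_n -> A) (c : 'I_n -> {scalar A}),
  [/\ forall i, Ag k (b i), forall i j a, Ag j a -> j != k -> c i a = 0
    & forall a, Ag k a -> a = \sum_i c i a *: b i].
Proof.
have [s hs] := galg_locally_finite hA k.
have [|n [b [c [bk cE]]]] := finite_coordinates (grading0 gA k) _ hs.
  by move=> c x y kx ky; apply: (gradingD gA) => //; apply: (galg_scale hA).
have prl i : scalar (fun a => c i (gproj gA k a)).
  move=> e x y /=; rewrite gprojD -linearP /=; congr (c i (_ + _)).
  apply: (gproj_morph gA) => [u v|j u]; first by rewrite scalerDr.
  exact: (galg_scale hA).
pose c' i : {scalar A} := HB.pack (fun a => c i (gproj gA k a))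
   (GRing.isLinear.Build F A F *%R (fun a => c i (gproj gA k a)) (prl i)).
exists n, b, c'; split=> // [i j a ja jk|a ka] /=.
  by rewrite (gproj_id gA _ ja) (negbTE jk) linear0.
by rewrite (gproj_id gA _ ka) eqxx; apply: cE.
Qed.

End GradedAlgebra.

Definition Hom_degree (A : nzRingType) (P Q : lmodType A)
    (Pg : int * int -> P -> Prop) (Qg : int * int -> Q -> Prop)
    (pj : int * int) (g : P -> Q) : Prop :=
  forall nk u, Pg nk u -> Qg (nk - pj) (g u).

Section GradedModule.
Variables (F : fieldType) (A : algType F) (Ag : nat -> A -> Prop).
Hypothesis hA : graded_algebra Ag.
Let gA := galg_grading hA.
Variables (P : lmodType A) (Pg : int * int -> P -> Prop).
Hypothesis hP : graded_module Ag Pg.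
Let gP : is_grading Pg := hP.1.

Lemma gmod_scale nk (c : F) u : Pg nk u -> Pg nk (c%:A *: u).
Proof.
case: nk => n k Pu; rewrite -[k]add0r.
by apply: (hP.2 0%N) => //; apply: Ag0_alg.
Qed.

(** Projecting to the bidegree of u keeps, in each product, only the component of the coefficient
    that has the right degree. *)
Lemma gmod_homog_gen (R : P -> Prop) : (forall b, R b -> exists nk, Pg nk b) ->
  forall n k u, Pg (n, k) u ->
  addspan (fun v => exists (a : A) b, R b /\ v = a *: b) u ->
  addspan (fun v => exists i a l b, [/\ R b, Ag i a, Pg (n, l) b, i%:Z + l = k
                                      & v = a *: b]) u.
Proof.
move=> Rh n k u Pu; rewrite -{2}[u](_ : gproj gP (n, k) u = u); last first.
  by rewrite (gproj_id gP _ Pu) eqxx.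
move: u {Pu}; apply: addspan_hom; [exact: morph_add0 (gprojD gP _)|exact: gprojD|].
move=> _ [a [b [Rb ->]]].
have [[m l] Pb] := Rh _ Rb; have [s _ ->] := gproj_sum gA a.
rewrite scaler_suml morph_sum; last exact: gprojD.
apply: addspan_sum => i _ _.
rewrite (gproj_id gP _ (hP.2 _ _ _ _ _ (gproj_in gA i a) Pb)).
case: eqP => [[mn ilk]|_]; last exact: addspan0.
apply: addspan_in; exists i, (gproj gA i a), l, b; split=> //; first exact: gproj_in.
by rewrite -mn.
Qed.

(** By connectedness a is a scalar modulo positive degrees, and those are killed by phi. *)
Lemma triv_scale (phi : P -> F) : linear_to_trivial Ag phi ->
  forall u, phi u = 0 -> forall a, phi (a *: u) = 0.
Proof.
move=> [hD hZ h0] u pu a; have [s _ ->] := gproj_sum gA a.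
rewrite scaler_suml morph_sum // big1 // => i _.
have [->|i0] := eqVneq i 0%N; last by apply: h0 (gproj_in gA i a); rewrite lt0n.
have [c ->] := galg_connected hA (gproj_in gA 0%N a).
by rewrite hZ pu mulr0.
Qed.

Lemma triv_sub (phi psi : P -> F) : linear_to_trivial Ag phi ->
  linear_to_trivial Ag psi -> linear_to_trivial Ag (fun u => phi u - psi u).
Proof.
case=> pD pZ p0 [qD qZ q0]; split=> [v w|c v|k e v k0 ke].
- by rewrite pD qD opprD addrACA.
- by rewrite pZ qZ mulrBr.
- by rewrite (p0 k) // (q0 k) // subrr.
Qed.

Lemma triv_ext (phi psi : P -> F) : linear_to_trivial Ag phi ->
  linear_to_trivial Ag psi -> forall R : P -> Prop,
  (forall u, addspan (fun v => exists (a : A) b, R b /\ v = a *: b) u) ->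
  (forall b, R b -> phi b = psi b) -> phi =1 psi.
Proof.
move=> hphi hpsi R hR hb u.
have [[phD _ _] [psD _ _]] := (hphi, hpsi).
elim/addspan_ind: u / (hR u) => [|x y ex ey|_ [a [b [Rb ->]]]].
- by rewrite (morph_add0 phD) (morph_add0 psD).
- by rewrite phD psD ex ey.
apply/eqP; rewrite -GRing.subr_eq0; apply/eqP.
by apply: (triv_scale (triv_sub hphi hpsi)); rewrite hb // subrr.
Qed.

End GradedModule.

Section Resolution.
Variables (F : fieldType) (A : algType F) (Ag : nat -> A -> Prop).
Hypothesis hA : graded_algebra Ag.
Let gA := galg_grading hA.

Section Free.
Variables (P : lmodType A) (Pg : int * int -> P -> Prop).
Hypothesis hP : graded_module Ag Pg.
Let gP : is_grading Pg := hP.1.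
Variable B : P -> Prop.
Hypotheses (Bhom : forall b, B b -> exists nk, Pg nk b)
  (Bspan : forall u, addspan (fun v => exists (a : A) b, B b /\ v = a *: b) u)
  (Bindep : forall (s : seq P) (a : P -> A), uniq s -> (forall b, b \in s -> B b) ->
      \sum_(b <- s) a b *: b = 0 -> forall b, b \in s -> a b = 0).

Lemma basis_neq0 b : B b -> b <> 0.
Proof.
move=> Bb b0; have := @Bindep [:: b] (fun=> 1) isT _ _ b (mem_head _ _).
rewrite big_seq1 b0 scaler0 => H; suff: (1 : A) = 0 by apply/eqP/oner_neq0.
by apply: H => // x; rewrite inE => /eqP->; rewrite -b0.
Qed.

Lemma basis_degree_unique b nk nk' : B b -> Pg nk b -> Pg nk' b -> nk = nk'.
Proof.
move=> Bb h h'; apply/eqP; apply: contraT => ne.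
by case: (basis_neq0 Bb); apply: (grading_disjoint gP h h').
Qed.

Lemma free_homog n k u : Pg (n, k) u ->
  addspan (fun v => exists i a l b, [/\ B b, Ag i a, Pg (n, l) b, i%:Z + l = k
                                      & v = a *: b]) u.
Proof. move=> Pu; exact: (@gmod_homog_gen _ _ _ hA _ _ hP B Bhom _ _ _ Pu (Bspan u)). Qed.

Lemma free_Hom_degree (Q : lmodType A) (Qg : int * int -> Q -> Prop) pj
    (g : {linear P -> Q}) : graded_module Ag Qg ->
  (forall b nk, B b -> Pg nk b -> Qg (nk - pj) (g b)) -> Hom_degree Pg Qg pj g.
Proof.
move=> hQ hb [n k] u /free_homog Hu.
elim/addspan_ind: u / Hu => [|x y|_ [i [a [l [b [Bb ia Pb ilk ->]]]]]].
- by rewrite linear0; apply: (grading0 hQ.1).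
- by rewrite linearD; apply: (gradingD hQ.1).
- rewrite linearZ /= -ilk; have := hb _ _ Bb Pb; case: pj {hb} => p j /= Qb.
  have -> : (n, i%:Z + l) - (p, j) = (n - p, i%:Z + (l - j)) by rewrite pairB addrA.
  exact: hQ.2.
Qed.

End Free.

Section Exactness.
Variables (Q : lmodType A) (Qg : int * int -> Q -> Prop).
Variables (dQ : {linear Q -> Q}) (etaQ : Q -> F).
Hypothesis rQ : free_resolution Ag Qg dQ etaQ.
Let gQ : is_grading Qg := (res_module rQ).1.

Lemma res_d_in n k u : Qg (n, k) u -> Qg (n - 1, k) (dQ u).
Proof. by move=> /(res_d_degree rQ); rewrite pairB subr0. Qed.

Lemma res_eta_triv : linear_to_trivial Ag etaQ.
Proof. by case: (res_eta rQ). Qed.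

Lemma res_eta0 nk u : Qg nk u -> nk <> (0, 0) -> etaQ u = 0.
Proof. by case: (res_eta rQ) => _; apply. Qed.

Lemma res_d_gproj n k u : dQ (gproj gQ (n, k) u) = gproj gQ (n - 1, k) (dQ u).
Proof.
move: u; apply: (graded_ext gQ) => [x y|x y|[m l] x Qx].
- by rewrite gprojD linearD.
- by rewrite linearD gprojD.
- rewrite (gproj_id gQ _ Qx) (gproj_id gQ _ (res_d_in Qx)).
  rewrite /eq_op /= (inj_eq (addIr _)).
  by case: ifP => // _; rewrite linear0.
Qed.

Lemma res_exact_homog n k y : Qg (n, k) y -> dQ y = 0 -> (n = 0 -> etaQ y = 0) ->
  exists v, Qg (n + 1, k) v /\ y = dQ v.
Proof.
move=> Qy dy ey; have [v yE] : exists v, y = dQ v.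
  have [n0|n0] := eqVneq n 0; last by apply: (res_exact rQ) Qy dy; apply/eqP.
  by move: Qy; rewrite n0 => Qy; apply: (res_exact0 rQ) Qy (ey n0).
exists (gproj gQ (n + 1, k) v); split; first exact: gproj_in.
by rewrite res_d_gproj addrK -yE (gproj_id gQ _ Qy) eqxx.
Qed.

End Exactness.

(** * Solving dQ s = g + sg * s dP degree by degree *)

Section Lifting.
Variables (P : lmodType A) (Pg : int * int -> P -> Prop).
Variables (dP : {linear P -> P}) (etaP : P -> F).
Hypothesis rP : free_resolution Ag Pg dP etaP.
Variables (Q : lmodType A) (Qg : int * int -> Q -> Prop).
Variables (dQ : {linear Q -> Q}) (etaQ : Q -> F).
Hypothesis rQ : free_resolution Ag Qg dQ etaQ.

(* With sg = 1 and c = 0 this extends chain maps, with sg = -1 and c = 1 it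
   constructs homotopies. *)
Lemma res_lift (c sg : int) (g : {linear P -> Q}) :
  Hom_degree Pg Qg (1 - c, 0) g ->
  (forall u, dQ (g u) = - (g (dP u) *~ sg)) ->
  (forall u, etaQ (g u) = 0) ->
  exists s : {linear P -> Q},
    [/\ Hom_degree Pg Qg (- c, 0) s,
        forall u, dQ (s u) = g u + s (dP u) *~ sg
      & forall u, etaQ (s u) = 0].
Proof.
move=> gdeg dg eg; have [B [Bhom Bspan Bindep]] := res_free rP.
have hP := res_module rP; have hQ := res_module rQ.
have [etD etZ et0] := res_eta_triv rQ.
have Bn b n k : B b -> Pg (n, k) b -> exists m, n = Posz m.
  move=> Bb; case: n => m Pb; first by exists m.
  by case: (basis_neq0 Bindep Bb); apply: (res_pos rP) Pb.
pose agree (N : nat) (s s' : P -> Q) :=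
  forall (n : int) k u, n < N%:Z -> Pg (n, k) u -> s' u = s u.
pose inv (N : nat) (s : P -> Q) := [/\ Hom_degree Pg Qg (- c, 0) s,
  forall (n : int) k u, n < N%:Z -> Pg (n, k) u -> dQ (s u) = g u + s (dP u) *~ sg
  & forall u, etaQ (s u) = 0].
have agreeB N (s s' : {linear P -> Q}) :
    (forall (n : int) k b, n < N%:Z -> B b -> Pg (n, k) b -> s' b = s b) -> agree N s s'.
  move=> hb n k u nN Pu.
  move: Pu => /(free_homog hP Bhom Bspan) Hu; elim/addspan_ind: u / Hu => [|x y ex ey|].
  - by rewrite !linear0.
  - by rewrite !linearD ex ey.
  - by move=> _ [i [a [l [b [Bb ia Pb ilk ->]]]]]; rewrite !linearZ /= (hb n l).
have eta_basis (s : {linear P -> Q}) : (forall b, B b -> etaQ (s b) = 0) ->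
    forall u, etaQ (s u) = 0.
  move=> hb u; elim/addspan_ind: u / (Bspan u) => [|x y ex ey|_ [a [b [Bb ->]]]].
  - by rewrite linear0 (morph_add0 etD).
  - by rewrite linearD etD ex ey addr0.
  - by rewrite linearZ /=; apply: (triv_scale hA (res_eta_triv rQ)); apply: hb.
have eq_basis N (s : {linear P -> Q}) :
    (forall (n : int) k b, n < N%:Z -> B b -> Pg (n, k) b ->
        dQ (s b) = g b + s (dP b) *~ sg) ->
    forall (n : int) k u, n < N%:Z -> Pg (n, k) u -> dQ (s u) = g u + s (dP u) *~ sg.
  move=> hb n k u nN Pu.
  move: Pu => /(free_homog hP Bhom Bspan) Hu; elim/addspan_ind: u / Hu => [|x y ex ey|].
  - by rewrite !linear0 mul0rz addr0.
  - by rewrite !linearD /= ex ey mulrzDl addrACA.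
  - move=> _ [i [a [l [b [Bb ia Pb ilk ->]]]]].
    by rewrite !linearZ /= (hb n l) // scalerDr -scalerMzr.
have step N (s : {linear P -> Q}) : inv N s ->
    exists s' : {linear P -> Q}, inv N.+1 s' /\ agree N s s'.
  move=> [sdeg sd se].
  (* Only the values on basis elements of homological degree N are new; all others are kept, so that
     the stages agree below N. *)
  have /choice[h hE] : forall b, exists w,
      (forall k, B b -> Pg (N%:Z, k) b ->
        [/\ Qg (N%:Z + c, k) w, dQ w = g b + s (dP b) *~ sg & etaQ w = 0]) /\
      ((forall k, ~ Pg (N%:Z, k) b) -> w = s b).
    move=> b; have [[k [Bb Pb]]|none] := pselect (exists k, B b /\ Pg (N%:Z, k) b).
      set y := g b + _.
      have Qy : Qg (N%:Z + c - 1, k) y.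
        apply: (gradingD hQ.1).
          have := gdeg _ _ Pb; rewrite [X in Qg X](_ : _ = (N%:Z + c - 1, k)) //.
          by rewrite pairB subr0; congr (_, _); lia.
        have := sdeg _ _ (res_d_in rP Pb).
        rewrite [X in Qg X](_ : _ = (N%:Z + c - 1, k)); last first.
          by rewrite pairB subr0; congr (_, _); lia.
        exact: (gradingMz hQ.1).
      have dy : dQ y = 0.
        rewrite /y linearD raddfMz /= (sd (N%:Z - 1) k) ?(res_d_d rP) //.
        - by rewrite linear0 mul0rz addr0 dg addNr.
        - by lia.
        - exact: (res_d_in rP).
      have ey : etaQ y = 0.
        by rewrite /y etD eg add0r (morph_mulrz _ _ etD) se mul0rz.
      (* For N + c = 0 the target [y] has degree -1, hence is zero, and 0 is a lift on which [etaQ]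
         vanishes. Otherwise [etaQ] vanishes on the lift for degree reasons. *)
      have [Nc0|Nc0] := eqVneq (N%:Z + c) 0.
        exists 0; split=> [k' _ Pb'|/(_ k) //]; split.
        - exact: (grading0 hQ.1).
        - by rewrite linear0 (res_pos rQ _ Qy) // Nc0.
        - exact: (morph_add0 etD).
      have [|v [Qv yE]] := res_exact_homog rQ Qy dy; first by [].
      exists v; split=> [k' _ Pb'|/(_ k) //].
      have [<-] := basis_degree_unique hP Bindep Bb Pb Pb'.
      rewrite subrK in Qv; split=> //.
      by apply: (res_eta0 rQ Qv) => -[/eqP]; rewrite (negbTE Nc0).
    exists (s b); split=> // k Bb Pb; case: none.
    by exists k.
  have [s' s'E] := free_ext h Bspan Bindep.
  have ag : agree N s s'.
    apply: agreeB => n k b nN Bb Pb; rewrite s'E //; apply: (hE b).2 => k' Pb'.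
    have [e _] := basis_degree_unique hP Bindep Bb Pb Pb'.
    by rewrite e ltxx in nN.
  have dich b n k : B b -> Pg (n, k) b -> n = N%:Z \/ s' b = s b.
    move=> Bb Pb; have [->|nN] := eqVneq n N%:Z; first by left.
    right; rewrite s'E //; apply: (hE b).2 => k' Pb'.
    have [e _] := basis_degree_unique hP Bindep Bb Pb Pb'.
    by rewrite e eqxx in nN.
  exists s'; split=> //; split.
  - apply: (free_Hom_degree hP Bhom Bspan hQ) => b [n k] Bb Pb.
    have [nN|->] := dich b n k Bb Pb; last exact: sdeg.
    move: Pb; rewrite nN => Pb; rewrite s'E //.
    have [Qw _ _] := (hE b).1 k Bb Pb.
    rewrite [X in Qg X](_ : _ = (N%:Z + c, k)) //.
    by rewrite pairB subr0 opprK.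
  - apply: (eq_basis N.+1) => n k b nN Bb Pb.
    have ddag : s' (dP b) = s (dP b).
      by apply: (ag (n - 1) k); [lia|exact: (res_d_in rP)].
    rewrite ddag; have [e|e] := dich b n k Bb Pb.
      by move: Pb; rewrite e => Pb; rewrite s'E //; have [] := (hE b).1 k Bb Pb.
    have [nN'|nN'] := boolP (n < N%:Z); first by rewrite e; apply: (sd n k).
    have nE : n = N%:Z by lia.
    by move: Pb; rewrite nE => Pb; rewrite s'E //; have [] := (hE b).1 k Bb Pb.
  - apply: eta_basis => b Bb; have [[n k] Pb] := Bhom _ Bb.
    have [nN|->] := dich b n k Bb Pb; last exact: se.
    by move: Pb; rewrite nN => Pb; rewrite s'E //; have [] := (hE b).1 k Bb Pb.
pose zero : {linear P -> Q} := \0.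
have inv0 : inv 0%N zero.
  split=> [nk u _|n k u n0 Pu|u] /=.
  - exact: (grading0 hQ.1).
  - by rewrite (res_pos rP n0 Pu) linear0 mul0rz addr0 linear0.
  - exact: (morph_add0 etD).
(* Stage number and map are packed together with the invariant, so that one function on a fixed type
   can be iterated. *)
pose T := {Ns : nat * {linear P -> Q} | inv Ns.1 Ns.2}.
have /choice[nxt nxtP] : forall Ns : T, exists Ns' : T,
    (sval Ns').1 = (sval Ns).1.+1 /\ agree (sval Ns).1 (sval Ns).2 (sval Ns').2.
  move=> [[N s] /= iN]; have [s' [is' ag]] := step _ _ iN.
  by exists (exist _ (N.+1, s') is').
pose S N : T := iter N nxt (exist (fun Ns : nat * {linear P -> Q} => inv Ns.1 Ns.2)
                              (0%N, zero) inv0).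
have S1 N : (sval (S N)).1 = N.
  by elim: N => //= N IH; rewrite (nxtP _).1 IH.
have SI N : inv N (sval (S N)).2 by have := svalP (S N); rewrite S1.
have Sag M N : agree N (sval (S N)).2 (sval (S (M + N)%N)).2.
  elim: M => [|M IH] n k u nN Pu //=.
  rewrite ((nxtP _).2 n k) // ?(IH n k) // S1.
  by apply: lt_le_trans nN _; rewrite lez_nat leq_addl.
(* A basis element of homological degree n keeps its value from stage n + 1 on, so the limit is read
   off there. *)
have /choice[h hE] : forall b, exists w, forall (n : nat) k, B b -> Pg (n%:Z, k) b ->
    w = (sval (S n.+1)).2 b.
  move=> b; have [[n [k [Bb Pb]]]|none] :=
      pselect (exists (n : nat) k, B b /\ Pg (n%:Z, k) b).
    exists ((sval (S n.+1)).2 b) => n' k' _ Pb'.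
    by have [-> _] := basis_degree_unique hP Bindep Bb Pb Pb'.
  by exists 0 => n k Bb Pb; case: none; exists n, k.
have [s sE] := free_ext h Bspan Bindep.
have ag N : agree N (sval (S N)).2 s.
  apply: agreeB => n k b nN Bb Pb; rewrite sE //.
  have [m nm] := Bn _ _ _ Bb Pb; rewrite nm in nN Pb.
  have mN : (m < N)%N by lia.
  have mm : (m%:Z < m.+1%:Z) by lia.
  by rewrite (hE b m k) // -(subnK mN) (Sag _ m.+1 _ _ _ mm Pb).
have lt1 n : (n%:Z < n.+1%:Z) by lia.
exists s; split.
- move=> [n k] u Pu; case: n Pu => n Pu; last first.
    by rewrite (res_pos rP _ Pu) // linear0; apply: (grading0 hQ.1).
  rewrite (ag n.+1 n%:Z k _ (lt1 n) Pu) //; have [h1 _ _] := SI n.+1.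
  exact: h1.
- suff: (fun u => dQ (s u)) =1 (fun u => g u + s (dP u) *~ sg) by [].
  apply: (graded_ext hP.1) => [x y|x y|[n k] u Pu].
  + by rewrite !linearD.
  + by rewrite !linearD /= mulrzDl addrACA.
  case: n Pu => n Pu; last first.
    by rewrite (res_pos rP _ Pu) // !linear0 mul0rz addr0.
  rewrite (ag n.+1 n%:Z k _ (lt1 n) Pu) (ag n.+1 (n%:Z - 1) k); last first.
  + exact: (res_d_in rP).
  + by lia.
  by have [_ h2 _] := SI n.+1; apply: (h2 n%:Z k _ (lt1 n)).
- apply: eta_basis => b Bb; have [[n k] Pb] := Bhom _ Bb.
  have [m nm] := Bn _ _ _ Bb Pb; rewrite nm in Pb.
  by rewrite (ag m.+1 m%:Z k _ (lt1 m) Pb); have [_ _ h3] := SI m.+1; apply: h3.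
Qed.

End Lifting.
End Resolution.

(** * Comparison of resolutions, and Ext read off a minimal one *)

Section Comparison.
Variables (F : fieldType) (A : algType F) (Ag : nat -> A -> Prop).
Hypothesis hA : graded_algebra Ag.

Lemma triv_comp (P Q : lmodType A) (phi : Q -> F) (g : {linear P -> Q}) :
  linear_to_trivial Ag phi -> linear_to_trivial Ag (phi \o g).
Proof.
case=> hD hZ h0; split=> [u v|c u|k a u k0 ka] /=.
- by rewrite linearD hD.
- by rewrite linearZ hZ.
- by rewrite linearZ /=; apply: h0 k0 ka.
Qed.

Lemma triv_degree_comp (P Q : lmodType A) (Pg : int * int -> P -> Prop)
    (Qg : int * int -> Q -> Prop) (phi : Q -> F) (g : {linear P -> Q}) pj qk :
  Hom_degree Pg Qg qk g -> Hom_trivial_degree Ag Qg pj phi ->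
  Hom_trivial_degree Ag Pg (pj + qk) (phi \o g).
Proof.
move=> gdeg [tphi h]; split; first exact: triv_comp.
move=> nk u Pu ne /=; apply: h (gdeg _ _ Pu) _ => e.
by apply: ne; rewrite -e subrK.
Qed.

Lemma minimal_triv (Q : lmodType A) (dQ : Q -> Q) (phi : Q -> F) :
  minimal Ag dQ -> linear_to_trivial Ag phi -> forall u, phi (dQ u) = 0.
Proof.
move=> mQ [hD _ h0] u.
elim/addspan_ind: _ / (mQ u) => [|x y ex ey|_ [k [a [w [k0 ka ->]]]]].
- exact: (morph_add0 hD).
- by rewrite hD ex ey addr0.
- exact: h0 k0 ka.
Qed.

Lemma res_comparison (P : lmodType A) (Pg : int * int -> P -> Prop)
    (dP : {linear P -> P}) (etaP : P -> F) (Q : lmodType A)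
    (Qg : int * int -> Q -> Prop) (dQ : {linear Q -> Q}) (etaQ : Q -> F) :
  free_resolution Ag Pg dP etaP -> free_resolution Ag Qg dQ etaQ ->
  exists i : {linear Q -> P}, [/\ Hom_degree Qg Pg (0, 0) i,
    forall u, dP (i u) = i (dQ u) & forall u, etaP (i u) = etaQ u].
Proof.
move=> rP rQ; have hP := res_module rP; have hQ := res_module rQ.
have [B [Bhom Bspan Bindep]] := res_free rQ.
have tP := res_eta_triv rP; have tQ := res_eta_triv rQ.
have [etD etZ _] := tP.
have [u0 [Pu0 eu0]] : exists u0, Pg (0, 0) u0 /\ etaP u0 = 1.
  have [u eu] := res_eta_surj rP.
  exists (gproj hP.1 (0, 0) u); split; first exact: gproj_in.
  rewrite -eu; suff: etaP \o gproj hP.1 (0, 0) =1 etaP by move=> /(_ u).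
  apply: (graded_ext hP.1) => [x y|x y|nk x Px] /=.
  - by rewrite gprojD etD.
  - exact: etD.
  - rewrite (gproj_id hP.1 _ Px); case: eqP => // ne.
    by rewrite (morph_add0 etD) (res_eta0 rP Px).
have du0 : dP u0 = 0 by apply: (res_pos rP _ (res_d_in rP Pu0)).
(* [s0] is compatible with the augmentations but not a chain map: dP s0 = 0, while s0 dQ may be
   nonzero. A map [s] with dP s = s0 dQ + s dQ repairs this, since s0 + s then commutes with the
   differentials. *)
have [s0 s0E] := free_ext (fun b => (etaQ b)%:A *: u0) Bspan Bindep.
have es0 : etaP \o s0 =1 etaQ.
  apply: (triv_ext hA (triv_comp _ tP) tQ Bspan) => b Bb /=.
  by rewrite s0E // etZ eu0 mulr1.
have ds0 u : dP (s0 u) = 0.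
  elim/addspan_ind: u / (Bspan u) => [|x y ex ey|_ [a [b [Bb ->]]]].
  - by rewrite !linear0.
  - by rewrite !linearD ex ey addr0.
  - by rewrite !linearZ /= s0E // linearZ /= du0 !scaler0.
have s0deg : Hom_degree Qg Pg (0, 0) s0.
  apply: (free_Hom_degree hA hQ Bhom Bspan hP) => b nk Bb Qb.
  rewrite s0E // subr0; have [->|/eqP ne] := eqVneq nk (0, 0).
    exact: (gmod_scale hA hP).
  rewrite (res_eta0 rQ Qb ne) scale0r scale0r.
  exact: (grading0 hP.1).
have [| | |s [sdeg sd se]] := @res_lift _ _ _ hA _ _ _ _ rQ _ _ _ _ rP 0 1 (s0 \o dQ).
- move=> nk u Qu /=; rewrite subr0 -[nk - _]subr0.
  by apply: s0deg; apply: (res_d_degree rQ).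
- by move=> u /=; rewrite ds0 (res_d_d rQ) linear0 mul0rz oppr0.
- move=> u /=; have /= -> := es0 (dQ u); exact: (res_eta_d rQ).
exists (s0 \+ s); split=> [nk u Qu|u|u] /=.
- by apply: (gradingD hP.1); [apply: s0deg|rewrite -[(0, 0)](_ : (- 0, 0) = _) ?oppr0 //; apply: sdeg].
- by rewrite linearD /= ds0 sd add0r mulr1z.
- by rewrite etD se addr0; apply: es0.
Qed.

(** [res_lift] applied to 1 - f with the negative sign, which solves dP h = (1 - f) - h dP. *)
Lemma res_homotopy (P : lmodType A) (Pg : int * int -> P -> Prop)
    (dP : {linear P -> P}) (etaP : P -> F) (f : {linear P -> P}) :
  free_resolution Ag Pg dP etaP -> Hom_degree Pg Pg (0, 0) f ->
  (forall u, dP (f u) = f (dP u)) -> (forall u, etaP (f u) = etaP u) ->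
  exists h : {linear P -> P}, Hom_degree Pg Pg (-1, 0) h /\
    forall u, u = f u + dP (h u) + h (dP u).
Proof.
move=> rP fdeg fd fe; have hP := res_module rP.
have [etD _ _] := res_eta_triv rP.
have [| | |h [hdeg hd _]] := @res_lift _ _ _ hA _ _ _ _ rP _ _ _ _ rP 1 (-1) (idfun \- f).
- move=> nk u Pu /=; rewrite subrr subr0.
  by apply: (gradingB hP.1) => //; have := fdeg _ _ Pu; rewrite subr0.
- by move=> u /=; rewrite mulrN1z opprK linearB /= fd.
- by move=> u /=; rewrite etD (morph_opp _ etD) fe subrr.
exists h; split=> // u.
by rewrite hd /= mulrN1z -addrA subrK addrC subrK.
Qed.

Section ExtRestriction.
Variables (P : lmodType A) (Pg : int * int -> P -> Prop).
Variables (dP : {linear P -> P}) (etaP : P -> F).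
Hypothesis rP : free_resolution Ag Pg dP etaP.
Variables (Q : lmodType A) (Qg : int * int -> Q -> Prop).
Variables (dQ : {linear Q -> Q}) (etaQ : Q -> F).
Hypotheses (rQ : free_resolution Ag Qg dQ etaQ) (mQ : minimal Ag dQ).
Variables (V : lmodType F) (E : int * int -> V -> Prop) (iota : V -> P -> F).
Hypothesis hE : is_Ext Ag Pg dP E iota.

(* Since Q is minimal, Hom_A(Q, F) has zero differential, so that Ext is
   identified with Hom_A(Q, F) itself. *)
Lemma Ext_minimal : exists i : {linear Q -> P},
  [/\ Hom_degree Qg Pg (0, 0) i,
      forall u, dP (i u) = i (dQ u),
      forall pj x, E pj x -> (forall u, iota x (i u) = 0) -> x = 0
    & forall pj psi, Hom_trivial_degree Ag Qg pj psi ->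
        exists x, E pj x /\ forall u, psi u = iota x (i u)].
Proof.
have [i [ideg id ie]] := res_comparison rP rQ.
have [p [pdeg pd pe]] := res_comparison rQ rP.
exists i; split=> // [pj x Ex ix0|pj psi hpsi].
  (* Since i p is homotopic to the identity of P, a cocycle that vanishes on the image of i is the
     coboundary of its composite with h. *)
  have [| | |h [hdeg hh]] := @res_homotopy _ _ _ _ (i \o p) rP.
  - by move=> nk u Pu /=; rewrite -[nk - _]subr0; apply: ideg; apply: pdeg.
  - by move=> u /=; rewrite id pd.
  - by move=> u /=; rewrite ie pe.
  have [tx dx] := Ext_cocycle hE Ex; have [[xD _ _] _] := tx.
  apply: (Ext_inj hE Ex (psi := iota x \o h)) => [|u /=].
    by have := triv_degree_comp hdeg tx; rewrite (_ : (-1, 0) = - (1, 0)).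
  by rewrite {1}(hh u) !xD /= ix0 dx !add0r.
have tpsi := hpsi.1; have [psD _ _] := tpsi.
(* On Q both homotopy terms are killed by maps to the trivial module, by minimality; thus psi p
   restricts along i to psi itself. *)
have [| | |h [hdeg hh]] := @res_homotopy _ _ _ _ (p \o i) rQ.
- by move=> nk u Qu /=; rewrite -[nk - _]subr0; apply: pdeg; apply: ideg.
- by move=> u /=; rewrite pd id.
- by move=> u /=; rewrite pe ie.
have [||x [theta [Ex [tth _] xE]]] := @Ext_surj _ _ _ _ _ _ _ _ _ hE pj (psi \o p).
- by have := triv_degree_comp pdeg hpsi; rewrite addr0.
- by move=> u /=; rewrite -pd (minimal_triv mQ).
exists x; split=> // u.
have /= th0 := minimal_triv mQ (triv_comp i tth) u.
have /= := xE (i u); rewrite id th0 addr0 => <-.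
rewrite {1}(hh u) !psD (minimal_triv mQ tpsi) addr0 /=.
by have /= -> := minimal_triv mQ (triv_comp h tpsi) u; rewrite addr0.
Qed.

End ExtRestriction.
End Comparison.

(** * The A-infinity relations on words in E^1_1 *)

Lemma sgn_nat (n : nat) : sgn n%:Z = (-1) ^+ n.
Proof. by []. Qed.

Lemma sgnE x : sgn x = (-1) ^ x.
Proof.
case: x => n; first by [].
by rewrite NegzE /sgn abszN -exprnN -exprVn invrN1.
Qed.

Lemma sgnD x y : sgn (x + y) = sgn x * sgn y.
Proof. by rewrite !sgnE exprzDr ?unitrN1. Qed.

Lemma sgn_sq x : sgn x * sgn x = 1.
Proof. by rewrite /sgn -exprMn_comm ?mulrNN ?mulr1 ?expr1n //; apply: mulrC. Qed.

Lemma sgnN x : sgn (- x) = sgn x.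
Proof. by rewrite /sgn abszN. Qed.

Lemma sgn_double x : sgn (x + x) = 1.
Proof. by rewrite sgnD sgn_sq. Qed.

(* Normalizing f_n by gs n, and f_n(_, z) by ss n, turns the signs of f_relation
   on arguments of degree 1 into the signs of a product of cochains. *)
Definition gs (n : nat) : int := (-1) ^+ 'C(n.+1, 2).
Definition ss (n : nat) : int := (-1) ^+ 'C(n, 2).

Lemma gsD a b : gs (a + b) = gs a * gs b * sgn (a * b)%N.
Proof.
rewrite sgn_nat /gs -!exprD; congr (_ ^+ _).
elim: b => [|b IH]; first by rewrite addn0 muln0 addn0 addn0.
have bin2S n : 'C(n.+1, 2) = ('C(n, 2) + n)%N by rewrite binS bin1.
by rewrite addnS [LHS]bin2S IH [in RHS](bin2S b.+1) mulnS; lia.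
Qed.

Lemma ss_gs n : ss n = sgn n * gs n.
Proof.
by rewrite /gs binS bin1 exprD sgn_nat mulrCA -exprMn_comm ?mulrNN ?mulr1 ?expr1n ?mulr1 //; apply: mulrC.
Qed.

Lemma gs_sq n : gs n * gs n = 1.
Proof. by rewrite /gs -(sgn_nat 'C(n.+1, 2)) sgn_sq. Qed.

(* Words in the letters e_i, paired with the product of the corresponding a_i;
   sums over [words L n] are the n-th powers of sum_i e_i (x) a_i. *)
Section Words.
Variables (V : eqType) (A : nzRingType).

Fixpoint words (L : seq (V * A)) (n : nat) : seq (seq V * A) :=
  if n is n'.+1 then [seq (x.1 :: p.1, x.2 * p.2) | x <- L, p <- words L n']
  else [:: ([::], 1)].

Lemma big_words_cat (X : nmodType) L a b (h : seq V * A -> X) :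
  \sum_(p <- words L (a + b)) h p
  = \sum_(p <- words L a) \sum_(q <- words L b) h (p.1 ++ q.1, p.2 * q.2).
Proof.
elim: a h => [|a IH] h.
  rewrite add0n big_seq1 /=; apply: eq_bigr => q _.
  by rewrite mul1r -surjective_pairing.
rewrite addSn /= !big_allpairs_dep; apply: eq_bigr => x _; rewrite IH.
by apply: eq_bigr => p _; apply: eq_bigr => q _; rewrite /= mulrA.
Qed.

Lemma words_ind L (K : nat -> seq V * A -> Prop) : K 0%N ([::], 1) ->
  (forall n x p, x \in L -> K n p -> K n.+1 (x.1 :: p.1, x.2 * p.2)) ->
  forall n p, p \in words L n -> K n p.
Proof.
move=> K0 KS; elim=> [|n IH] p /=; first by rewrite inE => /eqP->.
by move=> /allpairsP[[x q] /= [xL qw ->]]; apply: KS => //; apply: IH.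
Qed.

End Words.

Arguments words : simpl never.

Lemma triangle_sum (X : nmodType) (N : nat) (h : nat -> nat -> X) :
  \sum_(n < N) \sum_(i < n.+1) h i (n - i)%N
  = \sum_(i < N) \sum_(l < N | (i + l < N)%N) h i l.
Proof.
pose r := \sum_(n < N) \sum_(i < N | (i <= n)%N) h i (n - i)%N.
transitivity r.
  apply: eq_bigr => n _; rewrite (big_ord_widen_cond N xpredT (fun i => h i (n - i)%N)) //=.
rewrite /r (exchange_big_dep xpredT) //=; apply: eq_bigr => i _.
rewrite -(big_mkord (fun n => (i <= n)%N) (fun n => h i (n - i)%N)).
rewrite -(big_mkord (fun l => (i + l < N)%N) (h i)).
have iN := ltn_ord i.
rewrite (@big_cat_nat _ _ _ i) //=; last exact: ltnW.
rewrite big_nat_cond big1 ?add0r; last first.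
  by move=> n /andP[/andP[_ ni]]; rewrite leqNgt ni.
rewrite [RHS](@big_cat_nat _ _ _ (N - i)%N) //= ?leq_subr //.
rewrite [X in _ = _ + X]big_nat_cond [X in _ = _ + X]big1 ?addr0; last first.
  by move=> n /andP[/andP[ni _]] h1; exfalso; lia.
rewrite -{1}[i : nat]add0n big_addn big_nat_cond [RHS]big_nat_cond.
apply: eq_big => [l|l _]; last by rewrite addnK.
by apply/idP/idP => /andP[/andP[h1 h2] h3]; apply/andP; split; lia.
Qed.

Section Relations.
Variables (F : fieldType) (A : algType F) (Ag : nat -> A -> Prop).
Hypothesis hA : graded_algebra Ag.
Variables (V : lmodType F) (E1 : V -> Prop) (m : seq V -> V) (L : seq (V * A)).
Hypothesis hL : forall x, x \in L -> E1 x.1 /\ Ag 1%N x.2.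

Lemma words_good n p : p \in words L n ->
  [/\ size p.1 = n, forall e, e \in p.1 -> E1 e & Ag n p.2].
Proof.
move: n p; apply: words_ind => [|n x p /hL[Ex Ax] [sp ep ap]]; split=> //=.
- exact: galg_one hA.
- by rewrite sp.
- by move=> e; rewrite inE => /orP[/eqP->//|/ep].
- exact: (galg_mul hA Ax ap).
Qed.

(* The part in E (x) A_t of the Maurer-Cartan equation for sum_i e_i (x) a_i,
   paired with the functionals on A. *)
Definition word_MC (t : nat) : Prop :=
  forall c : {scalar A}, \sum_(p <- words L t) c p.2 *: m p.1 = 0.

(** Expanding the A-factor in a basis of A_t moves its coordinates inside H, where the equation
    tested against those coordinates applies. *)
Lemma word_MC_contract t (H : V -> A) c1 c2 : word_MC t ->
  (forall (c : F) x y, H (c *: x + y) = c *: H x + H y) ->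
  \sum_(r <- words L t) H (m r.1) * (c1 * (r.2 * c2)) = 0.
Proof.
move=> MCt Hlin; have [n [b [c [bt _ cE]]]] := galg_coordinates hA t.
have HD x y : H (x + y) = H x + H y by have := Hlin 1 x y; rewrite !scale1r.
have H0 := morph_add0 HD.
have HZ e x : H (e *: x) = e *: H x by have := Hlin e x 0; rewrite H0 !addr0.
transitivity (\sum_(r <- words L t) \sum_k
   (H (c k r.2 *: m r.1)) * (c1 * (b k * c2))).
  rewrite big_seq [RHS]big_seq; apply: eq_bigr => r /words_good[_ _ rt].
  rewrite {1}(cE _ rt) mulr_suml !mulr_sumr; apply: eq_bigr => k _.
  by rewrite HZ -!scalerAl -!scalerAr.
rewrite exchange_big big1 //= => k _.
by rewrite -mulr_suml -(morph_sum _ _ _ HD) MCt H0 mul0r.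
Qed.

Definition Fmultilinear (h : seq V -> A) := forall s1 s2 (c : F) x y,
  h (s1 ++ (c *: x + y) :: s2) = c *: h (s1 ++ x :: s2) + h (s1 ++ y :: s2).

Variables (h : seq V -> A) (hlin : Fmultilinear h).

(** A word splits into a prefix, a middle of length t and a suffix; with the outer parts fixed, the
    sum over the middle is a Maurer-Cartan sum. *)
Lemma word_MC_term zs i t j : word_MC t ->
  \sum_(p <- words L (i + t + j))
    h (take i p.1 ++ m (take t (drop i p.1)) :: drop (i + t) p.1 ++ zs) * p.2 = 0.
Proof.
move=> MCt; rewrite -addnA big_words_cat big_seq big1 // => p /words_good[sp _ _].
rewrite big_words_cat exchange_big big_seq big1 //= => q /words_good[sq _ _].
rewrite -[RHS](word_MC_contract (H := fun x => h (p.1 ++ x :: q.1 ++ zs)) p.2 q.2 MCt) //.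
rewrite big_seq [RHS]big_seq; apply: eq_bigr => r /words_good[sr _ _].
rewrite -sp take_size_cat // drop_size_cat // -sr take_size_cat //.
by rewrite drop_cat ltnNge leq_addr /= addKn drop_size_cat.
Qed.

Definition pos1 (w : seq V) : seq (int * V) := [seq (1%:Z, x) | x <- w].

Lemma unzip2_pos1 w : unzip2 (pos1 w) = w.
Proof. by rewrite /unzip2 -map_comp map_id. Qed.

Lemma total_degree_pos1 w : total_degree (pos1 w) = (size w)%:Z.
Proof.
elim: w => [|x w IH]; first by rewrite /total_degree big_nil.
by rewrite /total_degree big_cons -[X in _ + X]/(total_degree (pos1 w)) IH /= -PoszD.
Qed.

Lemma total_degree_cat (I : zmodType) (T : Type) (s t : seq (I * T)) :
  total_degree (s ++ t) = total_degree s + total_degree t.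
Proof. by rewrite /total_degree big_cat. Qed.

(** The Koszul sign depends on i alone: the arguments passed over are letters of degree 1. *)
Let sign (N i t : nat) : int :=
  sgn (i + (N - (i + t)) * t)%N * sgn ((2 - t%:Z) * i%:Z).

Let term zs i t (w : seq V) : A :=
  h (take i (w ++ zs) ++ m (take t (drop i (w ++ zs))) :: drop (i + t) (w ++ zs)).

Lemma insertion_words n (zs : seq (int * V)) : (size zs <= 1)%N ->
  let N := (n + size zs)%N in
  \sum_(p <- words L n) insertion_sum m h (pos1 p.1 ++ zs) * p.2
  = \sum_(i < N.+1) \sum_(t < N.+1 | (0 < t)%N && (i + t <= N)%N)
      (\sum_(p <- words L n) term (unzip2 zs) i t p.1 * p.2) *~ sign N i t.
Proof.
move=> zs1 N; transitivity (\sum_(p <- words L n)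
   \sum_(i < N.+1) \sum_(t < N.+1 | (0 < t)%N && (i + t <= N)%N)
      (term (unzip2 zs) i t p.1 * p.2) *~ sign N i t).
  rewrite big_seq [RHS]big_seq; apply: eq_bigr => p /words_good[sp _ _].
  rewrite /insertion_sum size_cat size_map sp -/N mulr_suml.
  apply: eq_bigr => i _; rewrite mulr_suml; apply: eq_bigr => t /andP[t0 itN].
  rewrite -mulrzl -mulrA mulrzl; congr (_ * _ *~ _).
    by rewrite /term /unzip2 map_cat -/(unzip2 (pos1 p.1)) unzip2_pos1.
  congr (sgn _ * sgn (_ * _)).
  have iw : (i <= size (pos1 p.1))%N by rewrite size_map sp; lia.
  by rewrite takel_cat // -map_take total_degree_pos1 size_takel // -(size_map (pair 1%:Z)).
rewrite exchange_big; apply: eq_bigr => i _; rewrite exchange_big.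
by apply: eq_bigr => t _; rewrite mulrz_suml.
Qed.

Lemma term_words0 zs n i t : word_MC t -> (i + t <= n)%N ->
  \sum_(p <- words L n) term zs i t p.1 * p.2 = 0.
Proof.
move=> MCt itn; rewrite -(subnKC itn) -[RHS](word_MC_term zs i (n - (i + t)) MCt).
rewrite big_seq [RHS]big_seq; apply: eq_bigr => p /words_good[sp _ _].
rewrite /term takel_cat; last by rewrite sp; lia.
rewrite drop_cat; case: ltnP => h1.
  rewrite takel_cat; last by rewrite size_drop sp; lia.
  rewrite drop_cat; case: ltnP => h2 //.
  rewrite (drop_oversize h2) (_ : (i + t - size p.1 = 0)%N) ?drop0 //.
  by rewrite sp; lia.
have it : (i + t <= i)%N by rewrite sp in h1; lia.
have -> : t = 0%N by lia.
rewrite !take0 addn0 [drop i p.1]drop_oversize // drop_cat ltnNge h1 /=.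
by rewrite (_ : (i - size p.1 = 0)%N) ?drop0 //; rewrite sp in h1 *; lia.
Qed.

(** Insertions into proper subwords cancel by the Maurer-Cartan equation in lower lengths; only the
    one into the whole word is left. That term is the obstruction in length n. *)
Lemma insertion_words_nil n : (0 < n)%N ->
  (forall t, (0 < t < n)%N -> word_MC t) ->
  \sum_(p <- words L n) insertion_sum m h (pos1 p.1) * p.2
  = \sum_(p <- words L n) h [:: m p.1] * p.2.
Proof.
move=> n0 MC; have /= := @insertion_words n [::] isT.
under eq_bigr do rewrite cats0; rewrite addn0 => ->.
rewrite big_ord_recl /= [X in _ + X]big1 ?addr0; last first.
  move=> i _; rewrite big1 // => t /andP[t0 itn].
  by rewrite term_words0 ?mul0rz //; apply: MC; rewrite /bump /= in itn; lia.
rewrite (bigD1 ord_max) /=; last by rewrite n0 add0n leqnn.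
rewrite [X in _ + X]big1 ?addr0; last first.
  move=> t /andP[/andP[t0 tn] ne]; rewrite term_words0 ?mul0rz //.
  by apply: MC; move: ne tn; rewrite -val_eqE /=; lia.
rewrite /sign add0n subnn mul0n mulr0 /= mulr1z.
rewrite big_seq [RHS]big_seq; apply: eq_bigr => p /words_good[sp _ _].
by rewrite /term take0 drop0 cats0 add0n take_oversize ?drop_oversize // sp.
Qed.

(** Insertions made of letters alone cancel, so the inserted block is a final segment ending in z.
    The sign that remains is the product of the two lengths. *)
Lemma insertion_words_tail n q z : (forall t, (0 < t <= n)%N -> word_MC t) ->
  \sum_(p <- words L n) insertion_sum m h (pos1 p.1 ++ [:: (q, z)]) * p.2
  = \sum_(i < n.+1) (\sum_(p <- words L i) \sum_(r <- words L (n - i))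
      h (p.1 ++ [:: m (r.1 ++ [:: z])]) * (p.2 * r.2)) *~ sgn (i * (n - i))%N.
Proof.
move=> MC; have /= -> := @insertion_words n [:: (q, z)] isT.
rewrite addn1 big_ord_recr /= [X in _ + X]big1 ?addr0; last first.
  by move=> t /andP[t0]; lia.
apply: eq_bigr => i _; have ni : (i <= n)%N by rewrite -ltnS.
have tn : ((n - i).+1 < n.+2)%N by lia.
rewrite (bigD1 (Ordinal tn)) /=; last by lia.
rewrite [X in _ + X]big1 ?addr0; last first.
  move=> t /andP[/andP[t0 tin] ne]; rewrite term_words0 ?mul0rz //.
    by apply: MC; rewrite t0; move: ne; rewrite -val_eqE /=; lia.
  by move: ne; rewrite -val_eqE /=; lia.
congr (_ *~ _).
  rewrite -{1}(subnKC ni) big_words_cat big_seq [RHS]big_seq.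
  apply: eq_bigr => p /words_good[sp _ _]; rewrite big_seq [RHS]big_seq.
  apply: eq_bigr => r /words_good[sr _ _] /=.
  rewrite /term -catA -sp take_size_cat // drop_size_cat // take_oversize; last first.
    by rewrite size_cat sr /= sp; lia.
  by rewrite drop_oversize // !size_cat sr /= sp; lia.
rewrite /sign (_ : (n.+1 - (i + (n - i).+1) = 0)%N) ?mul0n ?addn0; last by lia.
rewrite -sgnD; move: (nat_of_ord i) (n - i)%N => a l.
rewrite (_ : _ + _ = (a%:Z + a%:Z) + - (a * l)%N%:Z).
  by rewrite sgnD sgn_double mul1r sgnN.
by rewrite PoszM (intS l); ring.
Qed.

End Relations.

(** * The twisting morphism *)

(** When h is supported on i, l >= 1 with i + l <= N, its sum over diagonals may be taken over a
    box, which is the shape produced by applying the twisted equation inside a word. *)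
Lemma box_triangle_sum (X : nmodType) (N : nat) (h : nat -> nat -> X) :
  (forall i, h i 0%N = 0) -> (forall l, h 0%N l = 0) ->
  (forall i l, (N < i + l)%N -> h i l = 0) ->
  \sum_(n < N.+1) \sum_(i < n.+1) h i (n - i)%N
  = \sum_(i < N) \sum_(l < N) h i l.
Proof.
move=> hi0 h0l hN; rewrite triangle_sum big_ord_recr /= [X in _ + X]big1 ?addr0.
  apply: eq_bigr => i _; rewrite big_mkcond big_ord_recr /=.
  have last0 : (if (i + N < N.+1)%N then h i N else 0) = 0.
    case: ifP => // iN; case: i iN => i /= iN'; have [->//|i0] := eqVneq i 0%N.
    by move: i0; rewrite -lt0n; lia.
  rewrite last0 addr0; apply: eq_bigr => l _.
  by case: ifP => // /negbT; rewrite -leqNgt => /hN.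
move=> l h1; have [->//|l0] := eqVneq (l : nat) 0%N.
by move: l0; rewrite -lt0n; lia.
Qed.

Lemma sum_inner (X : nmodType) (n : nat) (h : nat -> X) : h 0%N = 0 -> h n = 0 ->
  \sum_(a < n.+1) h a = \sum_(1 <= a < n) h a.
Proof.
move=> h0 hn; rewrite -(big_mkord xpredT h) big_nat_recr //= hn addr0.
by case: n {hn} => [|n]; [rewrite !big_geq|rewrite big_ltn // h0 add0r].
Qed.

Lemma insertion_sum_morph (V W W' : zmodType) (m : seq V -> V) (g : seq V -> W)
    (k : W -> W') s : {morph k : x y / x + y} ->
  insertion_sum m (fun ys => k (g ys)) s = k (insertion_sum m g s).
Proof.
move=> kD; rewrite /insertion_sum morph_sum //; apply: eq_bigr => i _.
by rewrite morph_sum //; apply: eq_bigr => t _; rewrite morph_mulrz.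
Qed.

Lemma sgn1 : sgn 1 = -1.
Proof. by []. Qed.

Lemma sgn_product a b :
  sgn (a%:Z - 1) * sgn ((1 - b%:Z) * a%:Z) = - sgn (a * b)%N.
Proof.
rewrite -sgnD (_ : _ + _ = a%:Z + a%:Z + - (1 + (a * b)%N%:Z)).
  by rewrite sgnD sgn_double mul1r sgnN sgnD sgn1 mulN1r.
by rewrite PoszM; ring.
Qed.

Lemma sgn_product_tail a b :
  sgn (a%:Z - 1) * sgn ((1 - b.+1%:Z) * a%:Z) = - (sgn a * sgn (a * b)%N).
Proof.
rewrite -sgnD (_ : _ + _ = a%:Z + - (1 + (a * b)%N%:Z)).
  by rewrite sgnD sgnN sgnD sgn1 mulN1r mulrN.
by rewrite PoszM (intS b); ring.
Qed.

Lemma sgn_gsD a b : sgn (a * b)%N * gs (a + b) = gs b * gs a.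
Proof. by rewrite gsD mulrCA sgn_sq mulr1 mulrC. Qed.

Lemma ssD (a b : nat) : ss (a + b) = ss a * ss b * sgn (a * b)%N.
Proof.
by rewrite !ss_gs gsD PoszD sgnD; ring.
Qed.

Lemma ss_sgn (a b : nat) : sgn a * sgn (a * b)%N * ss (a + b) = ss b * gs a.
Proof.
rewrite ssD (ss_gs a); set t := sgn (a * b)%N.
transitivity ((sgn a * sgn a) * (t * t) * (ss b * gs a)); first by ring.
by rewrite !sgn_sq !mul1r.
Qed.

Section Twisting.
Variables (F : fieldType) (A : algType F) (Ag : nat -> A -> Prop).
Hypothesis hA : graded_algebra Ag.
Variables (P : lmodType A) (Pg : int * int -> P -> Prop).
Variables (dP : {linear P -> P}) (eta : P -> F).
Hypothesis rP : free_resolution Ag Pg dP eta.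
Let hP := res_module rP.
Let gP : is_grading Pg := hP.1.

Definition Amorph (kap : P -> A) : Prop :=
  {morph kap : u v / u + v} /\ forall a u, kap (a *: u) = a * kap u.

Lemma AmorphZ kap : Amorph kap -> forall (c : F) u, kap (c%:A *: u) = c *: kap u.
Proof. by move=> [_ h] c u; rewrite h mulr_algl. Qed.

Lemma Amorph_sub kap kap' : Amorph kap -> Amorph kap' ->
  Amorph (fun u => kap u - kap' u).
Proof.
by move=> [D Z] [D' Z']; split=> [u v|a u]; rewrite ?D ?D' ?Z ?Z' ?mulrBr // opprD addrACA.
Qed.

Lemma Amorph_sum (T : Type) (r : seq T) (kap : T -> P -> A) :
  (forall t, Amorph (kap t)) -> Amorph (fun u => \sum_(t <- r) kap t u).
Proof.
move=> h; split=> [u v|a u].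
  by rewrite -big_split; apply: eq_bigr => t _; apply: (h t).1.
by rewrite mulr_sumr; apply: eq_bigr => t _; apply: (h t).2.
Qed.

Lemma Amorph_mulr kap b : Amorph kap -> Amorph (fun u => kap u * b).
Proof. by move=> [D Z]; split=> [u v|a u]; rewrite ?D ?Z ?mulrDl ?mulrA. Qed.

Lemma Amorph_comp kap (g : {linear P -> P}) : Amorph kap -> Amorph (kap \o g).
Proof. by move=> [D Z]; split=> [u v|a u] /=; rewrite ?linearD ?linearZ ?D ?Z. Qed.

(** Freeness of P lets phi be lifted along A -> F: basis elements go to the scalars phi(b). In
    internal degree j only scalar coefficients meet basis elements of degree j, so the lift is phi
    there. *)
Lemma lift_functional phi p j : Hom_trivial_degree Ag Pg (p, j) phi ->
  exists kap, [/\ Amorph kap, forall n l u, n <> p -> Pg (n, l) u -> kap u = 0,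
    forall l u, Pg (p, l) u -> intgr Ag (l - j) (kap u)
    & forall u, Pg (p, j) u -> kap u = (phi u)%:A].
Proof.
move=> [tphi dphi]; have [B [Bhom Bspan Bindep]] := res_free rP.
have [phD phZ ph0] := tphi.
have [s sE] := free_ext (Q := A^o) (fun b => (phi b)%:A) Bspan Bindep.
have sZ a u : s (a *: u) = a * s u by rewrite linearZ.
exists s; split=> [|n l u np|l u|u].
- by split=> [u v|a u]; rewrite ?linearD.
- move=> /(free_homog hA hP Bhom Bspan) Hu.
  elim/addspan_ind: u / Hu => [|x y ex ey|_ [i [a [k [b [Bb _ Pb _ ->]]]]]].
  + exact: linear0.
  + by rewrite linearD ex ey addr0.
  + by rewrite sZ sE // (dphi _ _ Pb) ?scale0r ?mulr0 // => -[].
- move=> /(free_homog hA hP Bhom Bspan) Hu.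
  elim/addspan_ind: u / Hu => [|x y ex ey|_ [i [a [k [b [Bb ia Pb <- ->]]]]]].
  + by rewrite linear0; apply: intgr0.
  + by rewrite linearD; apply: intgrD.
  + rewrite sZ sE //; have [kj|/eqP kj] := eqVneq k j.
      rewrite kj addrK -[i%:Z]addr0.
      by apply: (intgrM hA (i := i%:Z) (j := 0)) => //; apply: (Ag0_alg hA).
    by rewrite (dphi _ _ Pb) ?scale0r ?mulr0; [apply: intgr0|case].
- move=> /(free_homog hA hP Bhom Bspan) Hu.
  elim/addspan_ind: u / Hu => [|x y ex ey|_ [i [a [k [b [Bb ia Pb ik ->]]]]]].
  + by rewrite linear0 (morph_add0 phD) scale0r.
  + by rewrite linearD ex ey phD scalerDl.
  + rewrite sZ sE //; have [kj|/eqP kj] := eqVneq k j.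
      have i0 : i = 0%N by lia.
      rewrite i0 in ia; have [c ->] := galg_connected hA ia.
      by rewrite phZ mulr_algl scalerA.
    have pb0 : phi b = 0 by apply: (dphi _ _ Pb) => -[].
    by rewrite pb0 (triv_scale hA tphi pb0) !scale0r mulr0.
Qed.

Variables (V : lmodType F) (E : int * int -> V -> Prop).
Hypothesis (gE : is_grading E) (sE : forall pj (c : F) x, E pj x -> E pj (c *: x)).
Variables (m : seq V -> V) (f : seq V -> {linear P -> P}).
Hypotheses (mlin : multilinear m)
  (mdeg : forall s, s <> [::] -> homog E s ->
     E (total_degree s + (2 - (size s)%:Z, 0)) (m (unzip2 s)))
  (m1 : forall x, m [:: x] = 0)
  (hf : Ainf_morphism_to_End Pg dP E m f)
  (hE : is_Ext Ag Pg dP E (fun x u => eta (f [:: x] u)))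
  (E1 : forall j x, j <> 1 -> E (1, j) x -> x = 0).

Definition pos11 (w : seq V) : seq ((int * int) * V) := [seq ((1, 1), x) | x <- w].

Lemma pos11_homog w : (forall e, e \in w -> E (1, 1) e) -> homog E (pos11 w).
Proof. by move=> hw z /mapP[e /hw Ee ->]. Qed.

Lemma unzip2_pos11 w : unzip2 (pos11 w) = w.
Proof. by rewrite /unzip2 -map_comp map_id. Qed.

Lemma total_degree_pos11 w : total_degree (pos11 w) = ((size w)%:Z, (size w)%:Z).
Proof.
elim: w => [|x w IH]; first by rewrite /total_degree big_nil.
by rewrite /total_degree big_cons -[X in _ + X]/(total_degree (pos11 w)) IH pairD /= intS.
Qed.

Lemma words_homog w q j z : (forall e, e \in w -> E (1, 1) e) -> E (q, j) z ->
  let s := pos11 w ++ [:: ((q, j), z)] in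
  [/\ s <> [::], homog E s, unzip2 s = w ++ [:: z], size s = (size w).+1
    & total_degree s = ((size w)%:Z + q, (size w)%:Z + j)].
Proof.
move=> hw Ez s; split.
- by rewrite /s; case: (pos11 w).
- move=> y; rewrite mem_cat => /orP[/pos11_homog|]; first exact.
  by rewrite inE => /eqP->.
- by rewrite /s /unzip2 map_cat -[map _ _]/(unzip2 _) unzip2_pos11.
- by rewrite /s size_cat size_map addn1.
- by rewrite /s total_degree_cat total_degree_pos11 /total_degree big_seq1.
Qed.

Lemma m_words_degree w : w <> [::] -> (forall e, e \in w -> E (1, 1) e) ->
  E (2, (size w)%:Z) (m w).
Proof.
move=> w0 hw; have := @mdeg (pos11 w) _ (pos11_homog hw).
rewrite unzip2_pos11 total_degree_pos11 size_map.
rewrite (_ : _ + (2 - _, 0) = (2, (size w)%:Z)); last first.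
  by rewrite pairD; congr (_, _); ring.
by apply; case: w w0 {hw}.
Qed.

Lemma m_tail_degree w q j z : (forall e, e \in w -> E (1, 1) e) -> E (q, j) z ->
  E (q + 1, (size w)%:Z + j) (m (w ++ [:: z])).
Proof.
move=> hw Ez; have [s0 sh su ss st] := words_homog hw Ez.
have := mdeg s0 sh; rewrite su ss st.
rewrite (_ : _ + (2 - _, 0) = (q + 1, (size w)%:Z + j)) //.
by rewrite pairD intS; congr (_, _); ring.
Qed.

Lemma f_words_degree w k l u : w <> [::] -> (forall e, e \in w -> E (1, 1) e) ->
  Pg (k, l) u -> Pg (k - 1, l - (size w)%:Z) (f w u).
Proof.
move=> w0 hw Pu; have := f_degree hf _ (pos11_homog hw) Pu.
rewrite unzip2_pos11 total_degree_pos11 size_map.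
rewrite (_ : _ + (1 - _, 0) = (1, (size w)%:Z)); last first.
  by rewrite pairD; congr (_, _); ring.
rewrite pairB.
by apply; case: w w0 {hw}.
Qed.

Lemma f_tail_degree w q j z k l u : (forall e, e \in w -> E (1, 1) e) ->
  E (q, j) z -> Pg (k, l) u -> Pg (k - q, l - (size w)%:Z - j) (f (w ++ [:: z]) u).
Proof.
move=> hw Ez Pu; have [s0 sh su ss st] := words_homog hw Ez.
have := f_degree hf s0 sh Pu; rewrite su ss st.
rewrite (_ : _ + (1 - _, 0) = (q, (size w)%:Z + j)); last first.
  by rewrite pairD intS; congr (_, _); ring.
by rewrite pairB opprD addrA.
Qed.

Lemma f_scale1 (c : F) x y u : f [:: c *: x + y] u = c%:A *: f [:: x] u + f [:: y] u.
Proof. exact: (f_multilinear hf [::] [::]). Qed.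

(** The empty word is set to 0 because nothing constrains f on the empty list, and the morphism
    relation has no such term. *)
Definition Gf (w : seq V) (u : P) : P :=
  if nilp w then 0 else f w u *~ gs (size w).

Lemma GfD w : {morph Gf w : u v / u + v}.
Proof. by move=> u v; rewrite /Gf; case: ifP => _; rewrite ?addr0 // linearD mulrzDl. Qed.

Lemma GfZ w a u : Gf w (a *: u) = a *: Gf w u.
Proof. by rewrite /Gf; case: ifP => _; rewrite ?scaler0 // linearZ /= scalerMzr. Qed.

Lemma Gf_degree w k l u : (forall e, e \in w -> E (1, 1) e) ->
  Pg (k, l) u -> Pg (k - 1, l - (size w)%:Z) (Gf w u).
Proof.
move=> hw Pu; rewrite /Gf; case: ifP => [_|w0]; first exact: (grading0 gP).
by apply: (gradingMz gP); apply: f_words_degree => // e; rewrite e in w0.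
Qed.

Lemma cohom1 pj j x : E (pj, j) x -> cohom E pj x.
Proof. by move=> Ex; apply: addspan_in; exists j. Qed.

Lemma rel_words w u : w <> [::] -> (forall e, e \in w -> E (1, 1) e) ->
  insertion_sum m (fun ys => f ys u) (pos1 w)
  = dP (f w u) + f w (dP u)
    - \sum_(1 <= a < size w) f (take a w) (f (drop a w) u) *~ sgn (a * (size w - a))%N.
Proof.
move=> w0 hw; have hom : homog (cohom E) (pos1 w).
  by move=> z /mapP[e /hw Ee ->]; apply: cohom1 Ee.
have := f_relation hf u _ hom; rewrite /= unzip2_pos1 size_map => ->; last first.
  by case: w w0 {hw hom}.
congr (_ + _).
  rewrite /End_diff total_degree_pos1 (_ : _ + (1 - _) = 1); last by ring.
  by rewrite -[sgn 1]/(-1 : int) mulrN1z opprK.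
rewrite -sumrN; rewrite big_nat [RHS]big_nat; apply: eq_bigr => a /andP[a0 aw].
rewrite -mulrNz; congr (_ *~ _); apply: oppr_inj.
rewrite opprK -map_take total_degree_pos1 size_takel; last exact: ltnW.
by rewrite sgn_product opprK.
Qed.

Lemma rel_tail w q j z u : (forall e, e \in w -> E (1, 1) e) -> E (q, j) z ->
  insertion_sum m (fun ys => f ys u) (pos1 w ++ [:: (q, z)])
  = dP (f (w ++ [:: z]) u) - f (w ++ [:: z]) (dP u) *~ sgn q
    - \sum_(1 <= a < (size w).+1)
        f (take a w) (f (drop a w ++ [:: z]) u) *~ (sgn a * sgn (a * (size w - a))%N).
Proof.
move=> hw Ez; have hom : homog (cohom E) (pos1 w ++ [:: (q, z)]).
  move=> y; rewrite mem_cat => /orP[/mapP[e /hw Ee ->]|]; first exact: cohom1 Ee.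
  by rewrite inE => /eqP->; apply: cohom1 Ez.
have ue : unzip2 (pos1 w ++ [:: (q, z)]) = w ++ [:: z].
  by rewrite /unzip2 map_cat -[map _ _]/(unzip2 _) unzip2_pos1.
have := f_relation hf u _ hom; rewrite /= ue size_cat size_map addn1 => ->; last first.
  by case: (pos1 w).
congr (_ + _).
  rewrite /End_diff total_degree_cat total_degree_pos1 /total_degree big_seq1 /=.
  by rewrite (_ : _ + (1 - _) = q) // intS; ring.
rewrite -sumrN; rewrite big_nat [RHS]big_nat; apply: eq_bigr => a /andP[a0 aw].
rewrite -mulrNz !takel_cat ?size_map // -map_take total_degree_pos1 size_takel //.
rewrite drop_cat; case: ltnP => h1; last first.
  have -> : a = size w by apply/eqP; rewrite eqn_leq -ltnS aw h1.
  rewrite subnn drop0 drop_size muln0 mulr1 subSnn subrr mul0r mulr1.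
  by congr (_ *~ _); rewrite sgnD sgnN sgn1 mulrN1.
congr (_ *~ _); rewrite subSn //.
by rewrite sgn_product_tail.
Qed.

Section Letters.
Variable L : seq (V * A).
Hypothesis hL : forall x, x \in L -> E (1, 1) x.1 /\ Ag 1%N x.2.
Local Notation MC := (word_MC m L).

Definition double_words (kap : P -> A) u a b : A :=
  \sum_(p <- words L a) \sum_(r <- words L b)
     kap (Gf p.1 (Gf r.1 u)) * (p.2 * r.2).

Lemma double_words0l kap u b : Amorph kap -> double_words kap u 0 b = 0.
Proof.
move=> [kD _]; rewrite /double_words big_seq1 big1 // => r _.
by rewrite /Gf /= (morph_add0 kD) mul0r.
Qed.

Lemma double_words0r kap u a : Amorph kap -> double_words kap u a 0 = 0.
Proof.
move=> [kD _]; rewrite /double_words big1 // => r _; rewrite big_seq1.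
by rewrite [Gf [::] u]/Gf /= (morph_add0 (GfD _)) (morph_add0 kD) mul0r.
Qed.

Lemma double_words_cat kap u n : Amorph kap ->
  \sum_(a < n.+1) double_words kap u a (n - a)
  = \sum_(p <- words L n) (\sum_(a < n.+1) kap (Gf (take a p.1) (Gf (drop a p.1) u))) * p.2.
Proof.
move=> hk; under [RHS]eq_bigr do rewrite mulr_suml.
rewrite [RHS]exchange_big; apply: eq_bigr => a _.
have an : (a <= n)%N by rewrite -ltnS.
have -> : words L n = words L (a + (n - a)) by rewrite subnKC.
rewrite big_words_cat /double_words big_seq [RHS]big_seq.
apply: eq_bigr => p /(words_good hA hL)[sp _ _]; apply: eq_bigr => r _ /=.
by rewrite -sp take_size_cat // drop_size_cat.
Qed.

Lemma kap_f_multilinear kap u : Amorph kap -> Fmultilinear (fun ys => kap (f ys u)).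
Proof.
by move=> hk s1 s2 c x y; rewrite (f_multilinear hf) hk.1 AmorphZ.
Qed.

(** The morphism relation for f on n letters, pushed through [kap] and summed over words. The last
    term is the possible failure of the Maurer-Cartan equation in length n. *)
Lemma kappa_rel kap n u : Amorph kap -> (0 < n)%N ->
  (forall t, (0 < t < n)%N -> MC t) ->
  \sum_(p <- words L n) kap (Gf p.1 (dP u)) * p.2
  = - (\sum_(p <- words L n) kap (dP (Gf p.1 u)) * p.2)
    + \sum_(a < n.+1) double_words kap u a (n - a)
    + (\sum_(p <- words L n) kap (f [:: m p.1] u) * p.2) *~ gs n.
Proof.
move=> hk n0 hMC; have [kD _] := hk.
rewrite -(insertion_words_nil hA hL (kap_f_multilinear u hk) n0 hMC).
rewrite double_words_cat // mulrz_suml -sumrN -!big_split big_seq [RHS]big_seq.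
apply: eq_bigr => p /(words_good hA hL)[sp wp _] /=.
rewrite -mulrzl -mulNr mulrA -!mulrDl mulrzl; congr (_ * _).
rewrite insertion_sum_morph // (rel_words _ _ wp); last by move=> w0; rewrite -sp w0 in n0.
have w0 : nilp p.1 = false by rewrite /nilp sp; case: (n) n0.
rewrite sp (sum_inner (h := fun a => kap (Gf (take a p.1) (Gf (drop a p.1) u)))); first last.
- by rewrite -sp drop_size [Gf [::] u]/Gf /= (morph_add0 (GfD _)) (morph_add0 kD).
- by rewrite take0 /Gf /= (morph_add0 kD).
rewrite [Gf p.1 u]/Gf [Gf p.1 (dP u)]/Gf w0 sp raddfMz /= !(morph_mulrz _ _ kD).
rewrite !kD (morph_opp _ kD) (morph_sum _ _ _ kD).
have -> : \sum_(1 <= a < n) kap (Gf (take a p.1) (Gf (drop a p.1) u)) =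
    (\sum_(1 <= a < n) kap (f (take a p.1) (f (drop a p.1) u) *~ sgn (a * (n - a))%N)) *~ gs n.
  rewrite mulrz_suml; rewrite big_nat [RHS]big_nat; apply: eq_bigr => a /andP[a0 an].
  have st : size (take a p.1) = a by rewrite size_takel // sp ltnW.
  have sd : size (drop a p.1) = (n - a)%N by rewrite size_drop sp.
  rewrite -(morph_mulrz _ _ kD) -mulrzA /Gf /nilp st sd subn_eq0 leqNgt an.
  rewrite (negbTE (lt0n_neq0 a0)) raddfMz /= -mulrzA; congr (kap (_ *~ _)).
  by rewrite -sgn_gsD subnKC // ltnW.
by rewrite !mulrzDl mulNrz addrACA addKr subrr addr0.
Qed.

Lemma kappa_rel_MC kap n u : Amorph kap -> (forall t, (0 < t <= n)%N -> MC t) ->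
  \sum_(p <- words L n) kap (Gf p.1 (dP u)) * p.2
  = - (\sum_(p <- words L n) kap (dP (Gf p.1 u)) * p.2)
    + \sum_(a < n.+1) double_words kap u a (n - a).
Proof.
move=> hk hMC; have [kD _] := hk; have [->|n0] := posnP n.
  rewrite big_ord1 double_words0l // addr0 !big_seq1 /Gf /= linear0.
  by rewrite (morph_add0 kD) mul0r oppr0.
rewrite kappa_rel // => [|t /andP[t0 tn]]; last by apply: hMC; rewrite t0 ltnW.
rewrite -[RHS]addr0; congr (_ + _); rewrite (_ : \sum_(_ <- _) _ = 0) ?mul0rz //.
under eq_bigr do rewrite -[X in _ * X]mulr1 -[X in _ * X]mul1r.
apply: (word_MC_contract hA hL (H := fun x => kap (f [:: x] u))).
  by apply: hMC; rewrite n0 leqnn.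
by move=> c x y; rewrite f_scale1 hk.1 AmorphZ.
Qed.

(* The last clause makes kap compatible, in internal degrees at most N, with
   the differential on E (x) A twisted by sum_i e_i (x) a_i. *)
Definition twisted (kap : P -> A) (N : nat) : Prop :=
  [/\ Amorph kap, forall n l u, n <> 0 -> Pg (n, l) u -> kap u = 0,
      forall l u, Pg (0, l) u -> intgr Ag l (kap u),
      forall u, Pg (0, 0) u -> kap u = (eta u)%:A
    & forall l u, l <= N%:Z -> Pg (1, l) u ->
        kap (dP u) = \sum_(n < N.+1) \sum_(p <- words L n) kap (Gf p.1 u) * p.2].

(* The defect Gam of kap in degree N + 1 has for boundary the representative of
   the Maurer-Cartan sum; the latter is thus zero in Ext, and then Gam is
   exact because E^1 is concentrated in lower degree 1. *)
Lemma twisted_step kap N : (0 < N)%N -> twisted kap N ->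
  (forall t, (0 < t <= N)%N -> MC t) ->
  MC N.+1 /\ exists kap', twisted kap' N.+1.
Proof.
move=> N0 [hk kn kdeg keta ktw] hMC; have [kD kZ] := hk; have k0 := morph_add0 kD.
have klt0 l u : l < 0 -> Pg (0, l) u -> kap u = 0.
  by move=> l0 /kdeg /(intgr_lt0 l0).
have [te _] := res_eta rP; have [etD etZ _] := te; have et0 := morph_add0 etD.
pose Gam u := kap (dP u) - \sum_(n < N.+1) \sum_(p <- words L n) kap (Gf p.1 u) * p.2.
have hGam : Amorph Gam.
  apply: Amorph_sub; first exact: Amorph_comp.
  apply: Amorph_sum => n; apply: Amorph_sum => p; apply: Amorph_mulr.
  by split=> [u v|a u]; rewrite ?GfD ?GfZ ?kD ?kZ.
have [GD GZ] := hGam.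
have Gam0 n l u : n <> 1 -> Pg (n, l) u -> Gam u = 0.
  move=> n1 Pu; have n10 : n - 1 <> 0 by lia.
  rewrite /Gam (kn _ _ _ n10 (res_d_in rP Pu)) big1 ?subr0 // => i _.
  rewrite big_seq big1 // => p /(words_good hA hL)[_ wp _].
  by rewrite (kn _ _ _ n10 (Gf_degree wp Pu)) mul0r.
have Gamdeg l u : Pg (1, l) u -> intgr Ag l (Gam u).
  move=> Pu; apply: intgrB => //; first exact: kdeg (res_d_in rP Pu).
  apply: intgr_sum => // i _ _; apply: intgr_sum => // p /(words_good hA hL)[sp wp ap] _.
  have := intgrM hA (kdeg _ _ (Gf_degree wp Pu)) (ap : intgr Ag i%:Z p.2).
  by rewrite sp subrK.
have [k [b [c [bA cdeg cE]]]] := galg_coordinates hA N.+1.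
pose gam i u := c i (Gam u).
(* [Gam] vanishes in degrees at most N, and multiplying by positive degrees of A pushes its values
   in higher degrees beyond A_(N+1). Hence its coordinates in A_(N+1) factor through the trivial
   module. *)
have hgam i : Hom_trivial_degree Ag Pg (1, N.+1%:Z) (gam i).
  split; first split.
  - by move=> u v; rewrite /gam GD linearD.
  - by move=> e u; rewrite /gam (AmorphZ hGam) linearZ.
  - move=> q a u q0 qa; rewrite /gam.
    rewrite GZ; suff: c i \o (fun u => a * Gam u) =1 fun=> 0 by move=> /(_ u).
    apply: (graded_ext gP) => [x y|x y|[n l] x Px] /=.
    + by rewrite GD mulrDr linearD.
    + by rewrite addr0.
    + have [n1|/eqP n1] := eqVneq n 1; last by rewrite (Gam0 _ _ _ n1 Px) mulr0 linear0.
      rewrite n1 in Px; have [lN|lN] := boolP (l <= N%:Z).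
        by rewrite /Gam (ktw _ _ lN Px) subrr mulr0 linear0.
      have := Gamdeg _ _ Px; case: l lN {Px} => [l|l] lN /= Gl; last by rewrite Gl mulr0 linear0.
      by apply: (cdeg _ (q + l)%N); [exact: (galg_mul hA)|lia].
  - move=> [n l] u Pu ne; rewrite /gam; have [n1|/eqP n1] := eqVneq n 1; last first.
      by rewrite (Gam0 _ _ _ n1 Pu) linear0.
    rewrite n1 in Pu ne; have := Gamdeg _ _ Pu.
    case: l ne {Pu} => [l|l] ne /= Gl; last by rewrite Gl linear0.
    by apply: (cdeg _ l) => //; apply/eqP => e; apply: ne; rewrite e.
(* A nonempty word lowers the internal degree to at most N, so the twisted equation of [kap] applies
   inside each term and yields double words. They cancel those of the relations of length at most N;
   the diagonal of length N + 1 remains and is rewritten by [kappa_rel]. *)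
have Gamd u : Pg (2, N.+1%:Z) u -> Gam (dP u) =
    \sum_(p <- words L N.+1) kap (Gf p.1 (dP u)) * p.2
    - (\sum_(p <- words L N.+1) kap (f [:: m p.1] u) * p.2) *~ gs N.+1.
  move=> Pu; rewrite /Gam (res_d_d rP) k0 sub0r.
  rewrite (eq_bigr (fun n : 'I_N.+1 =>
      - (\sum_(p <- words L n) kap (dP (Gf p.1 u)) * p.2)
      + \sum_(a < n.+1) double_words kap u a (n - a))); last first.
    move=> n _; apply: kappa_rel_MC => // t /andP[t0 tn]; apply: hMC.
    by rewrite t0 /= (leq_trans tn) // -ltnS.
  rewrite big_split /= opprD sumrN opprK.
  have -> : \sum_(n < N.+1) \sum_(p <- words L n) kap (dP (Gf p.1 u)) * p.2 =
     \sum_(a < N.+1) \sum_(n < N.+1) double_words kap u a n.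
    rewrite exchange_big; apply: eq_bigr => n _; rewrite /double_words.
    under [RHS]eq_bigr do rewrite exchange_big.
    rewrite [RHS]exchange_big big_seq [RHS]big_seq /=.
    apply: eq_bigr => r /(words_good hA hL)[sr wr _].
    have [n0|n0] := posnP n.
      have -> : r.1 = [::] by apply: size0nil; rewrite sr n0.
      rewrite [Gf [::] u]/Gf /= linear0 k0 mul0r big1 // => a _; rewrite big1 // => p _.
      by rewrite (morph_add0 (GfD _)) k0 mul0r.
    rewrite (ktw (N.+1%:Z - n%:Z)); first last.
    - by have := Gf_degree wr Pu; rewrite sr.
    - by lia.
    rewrite mulr_suml; apply: eq_bigr => a _; rewrite mulr_suml.
    by apply: eq_bigr => p _; rewrite mulrA.
  have dw0 i l : (N.+1 < i + l)%N -> double_words kap u i l = 0.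
    move=> il; rewrite /double_words big_seq big1 // => p /(words_good hA hL)[sp wp _].
    rewrite big_seq big1 // => r /(words_good hA hL)[sr wr _].
    have := Gf_degree wp (Gf_degree wr Pu); rewrite sp sr => /klt0 ->; first by rewrite mul0r.
    by lia.
  have := box_triangle_sum (h := double_words kap u) _ _ dw0.
  rewrite big_ord_recr /= => <-; last first.
  - by move=> l; apply: double_words0l.
  - by move=> l; apply: double_words0r.
  rewrite addrAC subrr add0r (kappa_rel _ hk) //.
  rewrite addrK [X in - X + _](_ : _ = 0) ?oppr0 ?add0r //.
  rewrite big_seq big1 // => p /(words_good hA hL)[sp wp _].
  have := Gf_degree wp Pu; rewrite sp subrr => Pp.
  by rewrite (keta _ (res_d_in rP Pp)) (res_eta_d rP) scale0r mul0r.
(* Coordinates of the missing term of length N + 1: on internal degree N + 1 such a word leads to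
   degree 0, where [kap] is just [eta]. *)
pose th (i : 'I_k) u := \sum_(p <- words L N.+1) c i p.2 * eta (Gf p.1 u).
have wn0 p : p \in words L N.+1 -> nilp p.1 = false.
  by move=> /(words_good hA hL)[sp _ _]; rewrite /nilp sp.
have hth i : Hom_trivial_degree Ag Pg (1, N.+1%:Z) (th i).
  split; first split.
  - move=> u v; rewrite /th -big_split; apply: eq_bigr => p _.
    by rewrite GfD etD mulrDr.
  - move=> e u; rewrite /th mulr_sumr; apply: eq_bigr => p _.
    by rewrite GfZ etZ mulrCA.
  - move=> q a u q0 qa; rewrite /th big1 // => p _.
    by rewrite GfZ; case: te => _ _ /(_ _ _ _ q0 qa) ->; rewrite mulr0.
  - move=> [n l] u Pu ne; rewrite /th big_seq big1 // => p /(words_good hA hL)[sp wp _].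
    rewrite (res_eta0 rP (Gf_degree wp Pu)) ?mulr0 // sp => -[n1 l1]; apply: ne.
    by congr (_, _); lia.
pose y i := \sum_(p <- words L N.+1) c i p.2 *: m p.1.
have Ey i : E (2, N.+1%:Z) (y i).
  apply: (graded_sum gE) => p pw _; apply: sE.
  have [sp wp _] := words_good hA hL pw; rewrite -sp; apply: m_words_degree => // e.
  by have := wn0 _ pw; rewrite e.
have iotaD u : {morph (fun x => eta (f [:: x] u)) : x y / x + y}.
  move=> x z; have := f_scale1 1 x z u; rewrite !scale1r => ->.
  exact: etD.
have iotaZ e x u : eta (f [:: e *: x] u) = e * eta (f [:: x] u).
  have := f_scale1 e x 0 u; rewrite addr0 => ->.
  by rewrite etD etZ (morph_add0 (iotaD u)) addr0.
have gamd i u : Pg (2, N.+1%:Z) u ->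
    gam i (dP u) = th i (dP u) - eta (f [:: y i] u) *~ gs N.+1.
  move=> Pu; rewrite /gam Gamd // linearB raddfMz /=; congr (_ - _ *~ _).
    rewrite linear_sum /th big_seq [RHS]big_seq; apply: eq_bigr => p pw.
    have [sp wp _] := words_good hA hL pw.
    have := Gf_degree wp (res_d_in rP Pu); rewrite sp !subrr => Pp.
    by rewrite (keta _ Pp) mulr_algl linearZ mulrC.
  rewrite linear_sum (morph_sum _ _ _ (iotaD u)) /= big_seq [RHS]big_seq.
  apply: eq_bigr => p pw; have [sp wp _] := words_good hA hL pw.
  have Em : E (2, N.+1%:Z) (m p.1).
    by rewrite -sp; apply: m_words_degree => // e; have := wn0 _ pw; rewrite e.
  have := @f_tail_degree [::] _ _ _ _ _ u _ Em Pu; rewrite /= subr0 !subrr => Pp.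
  by rewrite (keta _ (Pp _)) // mulr_algl linearZ iotaZ mulrC.
have psid i u : gam i (dP u) - th i (dP u) = - (eta (f [:: y i] u) *~ gs N.+1).
  have [_ gam_deg] := hgam i; have [_ th_deg] := hth i.
  move: u; suff: (fun u => gam i (dP u) - th i (dP u)) =1
     (fun u => - (eta (f [:: y i] u) *~ gs N.+1)) by [].
  have [[gD _ _] [tD _ _]] := ((hgam i).1, (hth i).1).
  apply: (graded_ext gP) => [u v|u v|[n l] u Pu].
  - by rewrite linearD gD tD opprD addrACA.
  - by rewrite linearD etD mulrzDl opprD.
  - have [e|/eqP ne] := eqVneq (n, l) (2, N.+1%:Z).
      by rewrite e in Pu; rewrite gamd // addrAC subrr add0r.
    have ne' : (n - 1, l) <> (1, N.+1%:Z).
      by move=> -[n1 l1]; apply: ne; rewrite l1; congr (_, _); lia.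
    rewrite (gam_deg _ _ (res_d_in rP Pu) ne') (th_deg _ _ (res_d_in rP Pu) ne') subr0.
    by have [[_ h] _] := Ext_cocycle hE (Ey i); rewrite (h _ _ Pu ne) mul0rz oppr0.
have hdif i (s : int) : Hom_trivial_degree Ag Pg (1, N.+1%:Z)
    (fun u => (gam i u - th i u) *~ s).
  have [[[gD gZ g0] gdeg] [[tD tZ t0] tdeg]] := (hgam i, hth i); split; first split.
  - by move=> u v; rewrite gD tD opprD addrACA mulrzDl.
  - by move=> e u; rewrite gZ tZ -mulrBr -mulrzAr.
  - by move=> q a u q0 qa; rewrite (g0 _ _ _ q0 qa) (t0 _ _ _ q0 qa) subrr mul0rz.
  - by move=> nk u Pu ne; rewrite (gdeg _ _ Pu ne) (tdeg _ _ Pu ne) subrr mul0rz.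
have y0 i : y i = 0.
  apply: (Ext_inj hE (Ey i) (psi := fun u => (gam i u - th i u) *~ - gs N.+1)).
    by rewrite pairB subr0; apply: hdif.
  by move=> u; rewrite psid mulrNz mulNrz opprK -mulrzA gs_sq mulr1z.
have MCN : MC N.+1.
  move=> e; transitivity (\sum_i e (b i) *: y i); last first.
    by rewrite big1 // => i _; rewrite y0 scaler0.
  under [RHS]eq_bigr do rewrite scaler_sumr.
  rewrite [RHS]exchange_big big_seq [RHS]big_seq.
  apply: eq_bigr => p /(words_good hA hL)[_ _ ap].
  rewrite {1}(cE _ ap) linear_sum scaler_suml; apply: eq_bigr => i _.
  by rewrite linearZ scalerA mulrC.
split=> //.
(* N > 0 matters here: the class of the cocycle has lower degree N + 1, which differs from 1. *)
have /choice[psi psiP] : forall i, exists psi, Hom_trivial_degree Ag Pg (0, N.+1%:Z) psi /\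
    forall u, gam i u - th i u = psi (dP u).
  move=> i; have [u|x [psi [Ex hpsi psiE]]] := Ext_surj hE (hdif i 1).
    by rewrite mulr1z psid y0 (morph_add0 (iotaD u)) mul0rz oppr0.
  exists psi; split; first by move: hpsi; rewrite pairB subr0.
  move=> u; have := psiE u; rewrite mulr1z (@E1 _ x _ Ex); last by lia.
  by rewrite (morph_add0 (iotaD u)) add0r.
have /choice[lft lftP] := fun i => lift_functional (psiP i).1.
(* The correction starts in internal degree N + 1. Thus the equations already obtained survive, and
   the word sums in degree N + 1 do not change, since nonempty words strictly lower the degree. *)
pose kap' u := kap u - \sum_i lft i u * b i.
have kap'E l u : l < N.+1%:Z -> Pg (0, l) u -> kap' u = kap u.
  move=> lN Pu; rewrite /kap' big1 ?subr0 // => i _.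
  have [_ _ h _] := lftP i; have lN0 : l - N.+1%:Z < 0 by lia.
  by rewrite (intgr_lt0 lN0 (h _ _ Pu)) mul0r.
exists kap'; split.
- apply: Amorph_sub => //; apply: Amorph_sum => i; apply: Amorph_mulr.
  by have [] := lftP i.
- move=> n l u n0 Pu; rewrite /kap' (kn _ _ _ n0 Pu) big1 ?subr0 // => i _.
  by have [_ h _ _] := lftP i; rewrite (h _ _ _ n0 Pu) mul0r.
- move=> l u Pu; apply: intgrB => //; first exact: kdeg.
  apply: intgr_sum => // i _ _; have [_ _ h _] := lftP i.
  by have := intgrM hA (h _ _ Pu) (bA i : intgr Ag N.+1%:Z (b i)); rewrite subrK.
- by move=> u Pu; rewrite (kap'E 0) // keta.
move=> l u lN Pu.
have -> : \sum_(n < N.+2) \sum_(p <- words L n) kap' (Gf p.1 u) * p.2 =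
    \sum_(n < N.+2) \sum_(p <- words L n) kap (Gf p.1 u) * p.2.
  apply: eq_bigr => n _; rewrite big_seq [RHS]big_seq.
  apply: eq_bigr => p /(words_good hA hL)[sp wp _].
  have [n0|n0] := posnP n.
    have -> : p.1 = [::] by apply: size0nil; rewrite sp n0.
    by rewrite (kap'E 0) // /Gf /=; apply: (grading0 gP).
  by rewrite (kap'E _ _ _ (Gf_degree wp Pu)) // sp; move: (nat_of_ord n) n0 => q q0; lia.
rewrite big_ord_recr /=.
have Pdu : Pg (0, l) (dP u) by rewrite -(subrr 1); apply: (res_d_in rP Pu).
have [lN1|lN1] := boolP (l <= N%:Z).
  rewrite (kap'E l _ _ Pdu); last by lia.
  rewrite (ktw _ _ lN1 Pu) [X in _ + X]big_seq [X in _ + X]big1 ?addr0 //.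
  move=> p /(words_good hA hL)[sp wp _].
  by rewrite (klt0 _ _ _ (Gf_degree wp Pu)) ?mul0r // sp; lia.
have lE : l = N.+1%:Z by lia.
rewrite lE in Pu Pdu.
have -> : kap' (dP u) = kap (dP u) - \sum_i (gam i u - th i u) *: b i.
  congr (_ - _); apply: eq_bigr => i _; have [_ _ _ h] := lftP i.
  by rewrite h // mulr_algl (psiP i).2.
have -> : \sum_i (gam i u - th i u) *: b i = Gam u - \sum_i th i u *: b i.
  rewrite (cE _ (Gamdeg _ _ Pu)) -sumrB; apply: eq_bigr => i _.
  by rewrite scalerBl.
have -> : \sum_i th i u *: b i = \sum_(p <- words L N.+1) kap (Gf p.1 u) * p.2.
  under eq_bigr do rewrite scaler_suml.
  rewrite exchange_big big_seq [RHS]big_seq; apply: eq_bigr => p /(words_good hA hL)[sp wp ap].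
  have := Gf_degree wp Pu; rewrite sp !subrr => Pp.
  rewrite (keta _ Pp) mulr_algl {2}(cE _ ap) scaler_sumr.
  by apply: eq_bigr => i _; rewrite scalerA mulrC.
by rewrite opprB addrCA opprB (addrC (kap _)) subrK addrC.
Qed.

(** * The map from twisted E to A-linear maps P -> A *)

Section Omega.
Variables (K : nat) (kap : P -> A).
Hypotheses (htw : twisted kap K) (hMC : forall t, (0 < t <= K)%N -> MC t).

Let kD : {morph kap : u v / u + v}.
Proof. by case: htw => -[]. Qed.

Let k_lt0 l u : l < 0 -> Pg (0, l) u -> kap u = 0.
Proof. by case: htw => _ _ h _ _ l0 /h /(intgr_lt0 l0). Qed.

Definition tailf (w : seq V) (z : V) (u : P) : P := f (w ++ [:: z]) u *~ ss (size w).

Lemma tailf_degree w q j z k l u : (forall e, e \in w -> E (1, 1) e) ->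
  E (q, j) z -> Pg (k, l) u -> Pg (k - q, l - (size w)%:Z - j) (tailf w z u).
Proof.
by move=> hw Ez Pu; apply: (gradingMz gP); apply: f_tail_degree Ez Pu.
Qed.

(** The twisted map at z (x) 1, cut off at words of length K. *)
Definition Omega (z : V) (u : P) : A :=
  \sum_(n < K.+1) \sum_(p <- words L n) kap (tailf p.1 z u) * p.2.

Lemma Omega_Amorph z : Amorph (Omega z).
Proof.
have [hk _ _ _ _] := htw.
apply: Amorph_sum => n; apply: Amorph_sum => p; apply: Amorph_mulr.
split=> [u v|a u]; rewrite /tailf ?linearD ?linearZ /= ?mulrzDl ?kD //.
by rewrite scalerMzr hk.2.
Qed.

Lemma Omega_linear (c : F) x y u : Omega (c *: x + y) u = c *: Omega x u + Omega y u.
Proof.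
have [hk _ _ _ _] := htw.
rewrite /Omega scaler_sumr -big_split; apply: eq_bigr => n _ /=.
rewrite scaler_sumr -big_split; apply: eq_bigr => p _ /=.
rewrite /tailf (f_multilinear hf) mulrzDl kD mulrDl scalerMzr AmorphZ //.
by rewrite scalerAl.
Qed.

Lemma Omega_degree q j z l u : E (q, j) z -> Pg (q, l) u ->
  intgr Ag (l - j) (Omega z u).
Proof.
move=> Ez Pu; apply: intgr_sum => // n _ _; apply: intgr_sum => // p.
move=> /(words_good hA hL)[sp wp ap] _; have [_ _ kdeg _ _] := htw.
have := tailf_degree wp Ez Pu; rewrite subrr => /kdeg Ak.
have := intgrM hA Ak (ap : intgr Ag n%:Z p.2).
by rewrite sp (addrAC l) subrK.
Qed.

Lemma Omega_off q j z n l u : E (q, j) z -> Pg (n, l) u -> n <> q -> Omega z u = 0.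
Proof.
move=> Ez Pu nq; rewrite /Omega big1 // => i _; rewrite big_seq big1 // => p.
move=> /(words_good hA hL)[sp wp ap]; have [_ kn _ _ _] := htw.
rewrite (kn _ _ _ _ (tailf_degree wp Ez Pu)) ?mul0r // => e.
by apply: nq; apply/eqP; rewrite -subr_eq0; apply/eqP.
Qed.

(** Nonempty words lead to negative internal degree, where [kap] vanishes; for the empty word [kap]
    is evaluated in degree 0 and equals [eta]. *)
Lemma Omega_lead q j z u : E (q, j) z -> Pg (q, j) u ->
  Omega z u = (eta (f [:: z] u))%:A.
Proof.
move=> Ez Pu; rewrite /Omega big_ord_recl big_seq1 [X in _ + X]big1 ?addr0; last first.
  move=> i _; rewrite big_seq big1 // => p /(words_good hA hL)[sp wp _].
  have := tailf_degree wp Ez Pu; rewrite subrr sp addrAC subrr add0r => /k_lt0 -> //.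
  by rewrite mul0r.
have [_ _ _ keta _] := htw.
have := @tailf_degree [::] _ _ _ _ _ u _ Ez Pu.
rewrite /tailf /= mulr1 mulr1z !subr0 !subrr => Pz.
by rewrite keta //; apply: Pz.
Qed.

Definition double_tail z u a b : A :=
  \sum_(p <- words L a) \sum_(r <- words L b)
     kap (Gf p.1 (tailf r.1 z u)) * (p.2 * r.2).

Definition double_m z u a b : A :=
  \sum_(p <- words L a) \sum_(r <- words L b)
     kap (tailf p.1 (m (r.1 ++ [:: z]) *~ ss b) u) * (p.2 * r.2).

Lemma tailf_mulz w z s u : tailf w (z *~ s) u = tailf w z u *~ s.
Proof.
have tD : {morph (fun x => tailf w x u) : x y / x + y}.
  move=> x y; rewrite /tailf -mulrzDl; congr (_ *~ _).
  by have := f_multilinear hf w [::] 1 x y u; rewrite !scale1r.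
exact: (morph_mulrz _ _ tD).
Qed.

Lemma omega_rel q j z u n : E (q, j) z -> (n <= K)%N ->
  (\sum_(p <- words L n) kap (tailf p.1 z (dP u)) * p.2) *~ sgn q
  = \sum_(p <- words L n) kap (dP (tailf p.1 z u)) * p.2
    - \sum_(a < n.+1) double_tail z u a (n - a)
    - \sum_(a < n.+1) double_m z u a (n - a).
Proof.
move=> Ez nK; have [hk _ _ _ _] := htw.
have -> : \sum_(a < n.+1) double_m z u a (n - a) = (\sum_(p <- words L n)
    insertion_sum m (fun ys => kap (f ys u)) (pos1 p.1 ++ [:: (q, z)]) * p.2) *~ ss n.
  rewrite (insertion_words_tail hA hL (kap_f_multilinear u hk)); last first.
    by move=> t /andP[t0 tn]; apply: hMC; rewrite t0 (leq_trans tn).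
  rewrite mulrz_suml; apply: eq_bigr => a _; have an : (a <= n)%N by rewrite -ltnS.
  rewrite -mulrzA /double_m mulrz_suml big_seq [RHS]big_seq.
  apply: eq_bigr => p /(words_good hA hL)[sp _ _].
  rewrite mulrz_suml; apply: eq_bigr => r _.
  rewrite tailf_mulz /tailf sp !(morph_mulrz _ _ kD) -mulrzA mulrzAl; congr (_ *~ _).
  by have := ssD a (n - a); rewrite subnKC // => ->; rewrite mulrCA sgn_sq mulr1.
have -> : \sum_(a < n.+1) double_tail z u a (n - a) =
   \sum_(p <- words L n) (\sum_(a < n.+1)
      kap (Gf (take a p.1) (tailf (drop a p.1) z u))) * p.2.
  under [RHS]eq_bigr do rewrite mulr_suml.
  rewrite [RHS]exchange_big; apply: eq_bigr => a _.
  have an : (a <= n)%N by rewrite -ltnS.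
  have -> : words L n = words L (a + (n - a)) by rewrite subnKC.
  rewrite big_words_cat /double_tail big_seq [RHS]big_seq.
  apply: eq_bigr => p /(words_good hA hL)[sp _ _]; apply: eq_bigr => r _ /=.
  by rewrite -sp take_size_cat // drop_size_cat.
rewrite !mulrz_suml -!sumrB big_seq [RHS]big_seq.
apply: eq_bigr => p /(words_good hA hL)[sp wp _].
rewrite -mulrzl mulrA -[X in _ - X]mulrzl mulrA -!mulrBl !mulrzl; congr (_ * _).
rewrite insertion_sum_morph // (rel_tail _ wp Ez) sp.
have -> : \sum_(a < n.+1) kap (Gf (take a p.1) (tailf (drop a p.1) z u)) =
    (\sum_(1 <= a < n.+1) kap (f (take a p.1) (f (drop a p.1 ++ [:: z]) u) *~
       (sgn a * sgn (a * (n - a))%N))) *~ ss n.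
  rewrite -(big_mkord xpredT (fun a => kap (Gf (take a p.1) (tailf (drop a p.1) z u)))).
  rewrite big_ltn // take0 [X in kap X]/Gf /= (morph_add0 kD) add0r.
  rewrite mulrz_suml; rewrite big_nat [RHS]big_nat; apply: eq_bigr => a /andP[a0 an].
  have st : size (take a p.1) = a by rewrite size_takel // sp.
  have sd : size (drop a p.1) = (n - a)%N by rewrite size_drop sp.
  rewrite -(morph_mulrz _ _ kD) -mulrzA /Gf /nilp /tailf st sd.
  rewrite (negbTE (lt0n_neq0 a0)) raddfMz /= -mulrzA; congr (kap (_ *~ _)).
  by rewrite -ss_sgn subnKC.
rewrite /tailf sp raddfMz /= !(morph_mulrz _ _ kD) !kD (morph_opp _ kD).
rewrite [kap (- \sum_(_ <= _ < _) _)](morph_opp _ kD) (morph_sum _ _ _ kD).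
rewrite (morph_mulrz _ _ kD) !mulrzDl !mulNrz -!mulrzA [ss n * _]mulrC.
set X := kap _ *~ _; set Y := kap _ *~ _; set T := (\sum_(_ <= _ < _) _) *~ _.
by rewrite !opprD !opprK addrACA addNr addr0 addrA subrr add0r.
Qed.

(** The chain map property for the twisted differential. The degree bound puts every argument of
    [kap] within the range of its twisted equation, which turns the terms kap(dP ...) into double
    sums cancelling the composition terms of the relation. *)
Lemma Omega_d q j z l u : E (q, j) z -> Pg (q + 1, l) u -> l - j <= K%:Z ->
  Omega z (dP u) *~ sgn q
  = - \sum_(b < K.+1) \sum_(r <- words L b) Omega (m (r.1 ++ [:: z]) *~ ss b) u * r.2.
Proof.
move=> Ez Pu lK; have [hk _ _ _ ktw] := htw.
rewrite /Omega mulrz_suml.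
rewrite (eq_bigr (fun n : 'I_K.+1 =>
  \sum_(p <- words L n) kap (dP (tailf p.1 z u)) * p.2
    - \sum_(a < n.+1) double_tail z u a (n - a)
    - \sum_(a < n.+1) double_m z u a (n - a))); last first.
  by move=> n _; apply: omega_rel Ez _; rewrite -ltnS.
rewrite !sumrB !triangle_sum.
(* Total word length above K forces negative internal degree, so triangles can be completed to
   squares. *)
have full (h : nat -> nat -> A) : (forall a b, (K < a + b)%N -> h a b = 0) ->
    \sum_(a < K.+1) \sum_(b < K.+1 | (a + b < K.+1)%N) h a b
    = \sum_(b < K.+1) \sum_(a < K.+1) h a b.
  move=> h0; rewrite (exchange_big_dep xpredT) //=; apply: eq_bigr => b _.
  rewrite big_mkcond; apply: eq_bigr => a _.
  by case: ifP => // /negbT; rewrite -leqNgt => /h0.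
rewrite full; last first.
  move=> a b ab; rewrite /double_tail big_seq big1 // => p /(words_good hA hL)[sp wp _].
  rewrite big_seq big1 // => r /(words_good hA hL)[sr wr _].
  have := Gf_degree wp (tailf_degree wr Ez Pu).
  rewrite sp sr (_ : q + 1 - q - 1 = 0) => [P0|]; last by ring.
  by rewrite (k_lt0 _ P0) ?mul0r //; lia.
rewrite full; last first.
  move=> a b ab; rewrite /double_m big_seq big1 // => p /(words_good hA hL)[sp wp _].
  rewrite big_seq big1 // => r /(words_good hA hL)[sr wr _].
  have := tailf_degree wp (m_tail_degree wr Ez) Pu; rewrite sp sr subrr => P0.
  by rewrite tailf_mulz (morph_mulrz _ _ kD) (k_lt0 _ P0) ?mul0rz ?mul0r //; lia.
rewrite [X in X - _ - _](_ : _ = \sum_(b < K.+1) \sum_(a < K.+1) double_tail z u a b).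
  rewrite subrr sub0r; congr (- _); apply: eq_bigr => b _; rewrite /double_m.
  under eq_bigr do rewrite exchange_big.
  rewrite exchange_big; apply: eq_bigr => r _; rewrite mulr_suml.
  apply: eq_bigr => a _; rewrite mulr_suml; apply: eq_bigr => p _ /=.
  by rewrite mulrA.
apply: eq_bigr => n _; rewrite /double_tail.
under [RHS]eq_bigr do rewrite exchange_big.
rewrite [RHS]exchange_big big_seq [RHS]big_seq /=.
apply: eq_bigr => r /(words_good hA hL)[sr wr _].
have := tailf_degree wr Ez Pu.
rewrite (_ : q + 1 - q = 1) => [/ktw ->|]; [|by lia|by ring].
rewrite mulr_suml; apply: eq_bigr => a _; rewrite mulr_suml.
by apply: eq_bigr => p _; rewrite mulrA.
Qed.

End Omega.
End Letters.

Lemma big_words1 (X : nmodType) (L : seq (V * A)) (h : seq V * A -> X) :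
  \sum_(p <- words L 1) h p = \sum_(x <- L) h ([:: x.1], x.2).
Proof.
rewrite /words big_allpairs_dep; apply: eq_bigr => x _.
by rewrite big_seq1 mulr1.
Qed.

(** The letters are produced by the differential: the coordinates in A_1 of kap dP are cocycles, and
    their Ext classes give the e_i. Subtracting lifts of the remaining coboundaries makes the
    equation hold exactly in degree 1. *)
Lemma twisted_base : exists L : seq (V * A),
  [/\ forall x, x \in L -> E (1, 1) x.1 /\ Ag 1%N x.2, word_MC m L 1
    & exists kap, twisted L kap 1].
Proof.
have [te deta] := res_eta rP; have [etD etZ _] := te; have et0 := morph_add0 etD.
have [kap [hk kn kdeg0 keta]] := lift_functional (res_eta rP).
have kdeg l u : Pg (0, l) u -> intgr Ag l (kap u).
  by move=> /kdeg0; rewrite subr0.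
have [kD kZ] := hk; have k0 := morph_add0 kD.
have klt0 l u : l < 0 -> Pg (0, l) u -> kap u = 0.
  by move=> l0 /kdeg /(intgr_lt0 l0).
have d0 l u : Pg (1, l) u -> Pg (0, l) (dP u).
  by move=> Pu; rewrite -(subrr 1); apply: (res_d_in rP Pu).
have [k [b [c [bA cdeg cE]]]] := galg_coordinates hA 1.
have kd0 l u : l <= 0 -> Pg (1, l) u -> kap (dP u) = 0.
  move=> l0 Pu; have [l1|l1] := boolP (l < 0); first exact: klt0 l1 (d0 _ _ Pu).
  have lE : l = 0 by lia.
  by rewrite lE in Pu; rewrite (keta _ (d0 _ _ Pu)) (res_eta_d rP) scale0r.
pose gam i u := c i (kap (dP u)).
have hgam i : Hom_trivial_degree Ag Pg (1, 1) (gam i).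
  split; first split.
  - by move=> u v; rewrite /gam linearD kD linearD.
  - by move=> e u; rewrite /gam linearZ /= (AmorphZ hk) linearZ.
  - move=> q a u q0 qa; rewrite /gam linearZ /= kZ.
    suff: c i \o (fun u => a * kap (dP u)) =1 fun=> 0 by move=> /(_ u).
    apply: (graded_ext gP) => [x y|x y|[n l] x Px] /=.
    + by rewrite linearD kD mulrDr linearD.
    + by rewrite addr0.
    + have [n1|/eqP n1] := eqVneq n 1; last first.
        by rewrite (kn _ _ _ _ (res_d_in rP Px)) ?mulr0 ?linear0 //; lia.
      rewrite n1 in Px; have [l0|l0] := boolP (l <= 0).
        by rewrite (kd0 _ _ l0 Px) mulr0 linear0.
      have := kdeg _ _ (d0 _ _ Px); case: l l0 {Px} => [l|l] l0 /= Gl; last by rewrite Gl mulr0 linear0.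
      by apply: (cdeg _ (q + l)%N); [exact: (galg_mul hA)|lia].
  - move=> [n l] u Pu ne; rewrite /gam; have [n1|/eqP n1] := eqVneq n 1; last first.
      by rewrite (kn _ _ _ _ (res_d_in rP Pu)) ?linear0 //; lia.
    rewrite n1 in Pu ne; have := kdeg _ _ (d0 _ _ Pu).
    case: l ne {Pu} => [l|l] ne /= Gl; last by rewrite Gl linear0.
    by apply: (cdeg _ l) => //; apply/eqP => e; apply: ne; rewrite e.
have /choice[x xP] : forall i, exists x, exists psi,
    [/\ E (1, 1) x, Hom_trivial_degree Ag Pg (0, 1) psi &
     forall u, gam i u = eta (f [:: x] u) + psi (dP u)].
  move=> i; have [u|x [psi [Ex hpsi psiE]]] := Ext_surj hE (hgam i).
    by rewrite /gam (res_d_d rP) k0 linear0.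
  by exists x, psi; split=> //; move: hpsi; rewrite pairB subr0.
have /choice[psi psiP] := xP.
have /choice[lft lftP] : forall i, exists kap, [/\ Amorph kap,
    forall n l u, n <> 0 -> Pg (n, l) u -> kap u = 0,
    forall l u, Pg (0, l) u -> intgr Ag (l - 1) (kap u)
    & forall u, Pg (0, 1) u -> kap u = (psi i u)%:A].
  by move=> i; have [_ h _] := psiP i; apply: lift_functional.
pose kap' u := kap u - \sum_i lft i u * b i.
have kap'E l u : l < 1 -> Pg (0, l) u -> kap' u = kap u.
  move=> l1 Pu; rewrite /kap' big1 ?subr0 // => i _.
  have [_ _ h _] := lftP i; have l10 : l - 1 < 0 by lia.
  by rewrite (intgr_lt0 l10 (h _ _ Pu)) mul0r.
pose L := [seq (- x i, b i) | i <- enum 'I_k].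
exists L; split.
- move=> _ /mapP[i _ ->] /=; split=> //.
  by apply: (gradingN gE); have [] := psiP i.
- by move=> e; rewrite big_words1 big1 // => p _; rewrite m1 scaler0.
exists kap'; split.
- apply: Amorph_sub => //; apply: Amorph_sum => i; apply: Amorph_mulr.
  by have [] := lftP i.
- move=> n l u n0 Pu; rewrite /kap' (kn _ _ _ n0 Pu) big1 ?subr0 // => i _.
  by have [_ h _ _] := lftP i; rewrite (h _ _ _ n0 Pu) mul0r.
- move=> l u Pu; apply: intgrB => //; first exact: kdeg.
  apply: intgr_sum => // i _ _; have [_ _ h _] := lftP i.
  by have := intgrM hA (h _ _ Pu) (bA i : intgr Ag 1%:Z (b i)); rewrite subrK.
- by move=> u Pu; rewrite (kap'E 0) // keta.
move=> l u l1 Pu.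
have kap'0 : kap' 0 = 0.
  rewrite /kap' k0 big1 ?subr0 // => i _.
  by have [[lD _] _ _ _] := lftP i; rewrite (morph_add0 lD) mul0r.
rewrite !big_ord_recl big_ord0 addr0 big_seq1 [Gf [::] u]/Gf /= kap'0 mul0r add0r.
rewrite big_words1 big_map big_enum /=.
have GfE i : Gf [:: - x i] u = f [:: x i] u.
  rewrite /Gf /= -[gs 1]/(-1 : int) mulrN1z.
  have := f_scale1 (-1) (x i) 0 u; rewrite addr0 scaleN1r => ->.
  have := f_scale1 (-1) 0 0 u; rewrite scaler0 addr0 scaleN1r scaleN1r addNr => ->.
  by rewrite addr0 scaleN1r opprK.
have Pf i : Pg (0, l - 1) (f [:: x i] u).
  by have [Ex _ _] := psiP i; have := @f_tail_degree [::] _ _ _ _ _ u _ Ex Pu;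
    rewrite /= subr0 subrr; apply.
rewrite (eq_bigr (fun i => kap (f [:: x i] u) * b i)); last first.
  by move=> i _; rewrite GfE (kap'E _ _ _ (Pf i)) //; lia.
have [l0|l0] := boolP (l <= 0).
  have l1' : l < 1 by lia.
  have l10 : l - 1 < 0 by lia.
  rewrite (kap'E _ _ l1' (d0 _ _ Pu)) (kd0 _ _ l0 Pu) big1 // => i _.
  by rewrite (klt0 _ _ l10 (Pf i)) mul0r.
have lE : l = 1 by lia.
rewrite lE subrr in Pf; rewrite lE in Pu.
under eq_bigr do rewrite (keta _ (Pf _)) mulr_algl.
rewrite /kap' (cE _ (kdeg _ _ (d0 _ _ Pu))) -sumrB; apply: eq_bigr => i _.
have [_ _ _ h] := lftP i; rewrite h ?mulr_algl -?scalerBl; last exact: d0.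
have [_ _ psiE] := psiP i; have := psiE u; rewrite /gam => ->.
by rewrite addrK.
Qed.

(** The letters are common to all stages; only the map [kap] depends on K. *)
Lemma twisted_exists : exists L : seq (V * A),
  (forall x, x \in L -> E (1, 1) x.1 /\ Ag 1%N x.2) /\
  forall K, (0 < K)%N ->
    (forall t, (0 < t <= K)%N -> word_MC m L t) /\ exists kap, twisted L kap K.
Proof.
have [L [hL MC1 tw1]] := twisted_base; exists L; split=> // K.
elim: K => [//|[|K] IH] _.
  by split=> // t /andP[t0 t1]; have -> : t = 1%N by lia.
have [hMC [kap htw]] := IH isT.
have [MCK tw] := twisted_step hL (ltn0Sn K) htw hMC; split=> // t /andP[t0 tK].
by have [->//|tK'] := eqVneq t K.+2; apply: hMC; rewrite t0; lia.
Qed.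

End Twisting.

(** * Generation of Ext by words *)

Section Generation.
Variables (F : fieldType) (A : algType F) (Ag : nat -> A -> Prop).
Hypothesis hA : graded_algebra Ag.

Lemma galg_coordinates_le J : exists (I : finType) (b : I -> A)
    (c : I -> {scalar A}) (dg : I -> nat),
  [/\ forall i, Ag (dg i) (b i), forall i, (dg i <= J)%N,
      forall i k a, Ag k a -> k != dg i -> c i a = 0
    & forall k a, (k <= J)%N -> Ag k a -> a = \sum_i c i a *: b i].
Proof.
have /choice[T hT] : forall k, exists T : {n & (('I_n -> A) * ('I_n -> {scalar A}))%type},
    [/\ forall i, Ag k ((projT2 T).1 i),
        forall i j a, Ag j a -> j != k -> (projT2 T).2 i a = 0
      & forall a, Ag k a -> a = \sum_i (projT2 T).2 i a *: (projT2 T).1 i].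
  move=> k; have [n [b [c h]]] := galg_coordinates hA k.
  by exists (existT _ n (b, c)).
pose I : finType := {k : 'I_J.+1 & 'I_(projT1 (T k))}.
exists I, (fun i : I => (projT2 (T (tag i))).1 (tagged i)),
  (fun i : I => (projT2 (T (tag i))).2 (tagged i)), (fun i : I => tag i : nat).
split.
- by move=> i; have [h _ _] := hT (tag i); apply: h.
- by move=> i; rewrite -ltnS.
- by move=> i k a ka ne; have [_ h _] := hT (tag i); apply: h ka ne.
- move=> k a kJ ka; have kJ' : (k < J.+1)%N by [].
  transitivity (\sum_(k' < J.+1) \sum_(i < projT1 (T k'))
     (projT2 (T k')).2 i a *: (projT2 (T k')).1 i); last by rewrite sig_big_dep.
  rewrite (bigD1 (Ordinal kJ')) //= [X in _ = _ + X]big1 ?addr0; last first.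
    move=> k' ne; rewrite big1 // => i _; have [_ h _] := hT k'.
    by rewrite (h _ k) ?scale0r //; move: ne; rewrite eq_sym -val_eqE.
  by have [_ _ h] := hT k; apply: h.
Qed.

Lemma augmentation : exists aug : A -> F,
  [/\ forall (c : F) a a', aug (c *: a + a') = c * aug a + aug a',
      aug 1 = 1, forall a, Ag 0%N a -> a = (aug a)%:A
    & forall k a, Ag k a -> k != 0%N -> aug a = 0].
Proof.
have [n [b [c [bA cdeg cE]]]] := galg_coordinates hA 0.
have /choice[be beE] := fun i => galg_connected hA (bA i).
have augE a : Ag 0%N a -> a = (\sum_i c i a * be i)%:A.
  move=> a0; rewrite {1}(cE _ a0) scaler_suml; apply: eq_bigr => i _.
  by rewrite beE scalerA.
exists (fun a => \sum_i c i a * be i); split=> //.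
- move=> e a a'; rewrite mulr_sumr -big_split; apply: eq_bigr => i _.
  by rewrite linearP mulrDl mulrA.
- apply/eqP; rewrite -GRing.subr_eq0; have := augE _ (galg_one hA).
  rewrite -{1}[1]scale1r => /eqP; rewrite eq_sym -GRing.subr_eq0 -scalerBl scaler_eq0.
  by rewrite oner_eq0 orbF.
- by move=> k a ka k0; rewrite big1 // => i _; rewrite (cdeg _ _ _ ka k0) mul0r.
Qed.

Variables (P : lmodType A) (Pg : int * int -> P -> Prop).
Variables (dP : {linear P -> P}) (eta : P -> F).
Hypothesis rP : free_resolution Ag Pg dP eta.
Variables (Q : lmodType A) (Qg : int * int -> Q -> Prop).
Variables (dQ : {linear Q -> Q}) (etaQ : Q -> F).
Hypotheses (rQ : free_resolution Ag Qg dQ etaQ) (mQ : minimal Ag dQ)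
  (Q_ge0 : forall n l u, l < 0 -> Qg (n, l) u -> u = 0)
  (Q1 : forall j phi, j <> 1 -> Hom_trivial_degree Ag Qg (1, j) phi ->
      forall u, phi u = 0).
Let gQ : is_grading Qg := (res_module rQ).1.
Variables (V : lmodType F) (E : int * int -> V -> Prop).
Hypothesis (gE : is_grading E) (sE : forall pj (c : F) x, E pj x -> E pj (c *: x)).
Variables (m : seq V -> V) (f : seq V -> {linear P -> P}).
Hypotheses (mlin : multilinear m)
  (mdeg : forall s, s <> [::] -> homog E s ->
     E (total_degree s + (2 - (size s)%:Z, 0)) (m (unzip2 s)))
  (m1 : forall x, m [:: x] = 0)
  (hf : Ainf_morphism_to_End Pg dP E m f)
  (hE : is_Ext Ag Pg dP E (fun x u => eta (f [:: x] u))).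

(* psi is only F-linear: phi need not be a coboundary in Hom_A(Q, F). *)
Lemma coboundary_functional p j phi : 0 < p ->
  Hom_trivial_degree Ag Qg (p, j) phi ->
  exists psi : Q -> F, [/\ {morph psi : u v / u + v},
    forall (c : F) u, psi (c%:A *: u) = c * psi u,
    forall nk u, Qg nk u -> nk <> (p - 1, j) -> psi u = 0
    & forall u, phi u = psi (dQ u)].
Proof.
move=> p0 [tphi dphi]; have [phD phZ _] := tphi.
have dlin : linear (dQ : restr_scal Q -> restr_scal Q).
  by move=> c u v; rewrite rscaleE linearP.
have plin : scalar (phi : restr_scal Q -> F).
  by move=> c u v; rewrite rscaleE phD phZ.
pose D : {linear restr_scal Q -> restr_scal Q} :=
  HB.pack (dQ : restr_scal Q -> restr_scal Q)
    (GRing.isLinear.Build F (restr_scal Q) (restr_scal Q) *:%R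
        (dQ : restr_scal Q -> restr_scal Q) dlin).
pose Phi : {scalar (restr_scal Q)} := HB.pack (phi : restr_scal Q -> F)
    (GRing.isLinear.Build F (restr_scal Q) F *%R (phi : restr_scal Q -> F) plin).
have phi_proj u : phi (gproj gQ (p, j) u) = phi u.
  move: u; suff: phi \o gproj gQ (p, j) =1 phi by [].
  apply: (graded_ext gQ) => [x y|x y|nk x Qx] /=.
  - by rewrite gprojD phD.
  - exact: phD.
  - rewrite (gproj_id gQ _ Qx); case: eqP => // ne.
    by rewrite (morph_add0 phD) (dphi _ _ Qx).
(* phi kills the kernel of dQ: for p > 0 the component of a cycle that phi sees is a boundary by
   exactness, and boundaries are killed by minimality. *)
have [u du|psi psiE] := @functional_factor F _ _ D Phi.
  have d0 : dQ (gproj gQ (p, j) u) = 0.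
    rewrite (res_d_gproj rQ); have /= -> : dQ u = 0 by exact: du.
    exact: (morph_add0 (gprojD gQ _)).
  have pn0 : p <> 0 by lia.
  have [v vE] := res_exact rQ pn0 (gproj_in gQ (p, j) u) d0.
  by rewrite -[Phi u]phi_proj vE (minimal_triv mQ tphi).
exists (fun u => psi (gproj gQ (p - 1, j) u)); split.
- by move=> u v; rewrite gprojD; apply: (raddfD psi).
- move=> c u; rewrite (gproj_morph gQ _ (h := fun u => c%:A *: u)).
  + exact: (linearZ_LR psi).
  + by move=> x y; rewrite scalerDr.
  + by move=> nk x; apply: (gmod_scale hA (res_module rQ)).
- move=> nk u Qu ne; rewrite (gproj_id gQ _ Qu); case: eqP => // _.
  exact: (raddf0 psi).
- by move=> u; rewrite -phi_proj -(res_d_gproj rQ); apply: psiE.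
Qed.

Let iota x u := eta (f [:: x] u).

Let iotaP (c : F) x y u : iota (c *: x + y) u = c * iota x u + iota y u.
Proof. exact: (Ext_linear hE). Qed.

Let iotaD u : {morph iota^~ u : x y / x + y}.
Proof. by move=> x y /=; have := iotaP 1 x y u; rewrite scale1r mul1r. Qed.

Let iotaZ (c : F) x u : iota (c *: x) u = c * iota x u.
Proof. by have := iotaP c x 0 u; rewrite addr0 (morph_add0 (iotaD u)) addr0. Qed.

(** * Functionals on Q and relations in Ext expressed through Omega *)

Section Representation.
Variable i0 : {linear Q -> P}.
Hypotheses (ideg : Hom_degree Qg Pg (0, 0) i0)
  (id : forall u, dP (i0 u) = i0 (dQ u))
  (iinj : forall pj x, E pj x -> (forall u, iota x (i0 u) = 0) -> x = 0)
  (isurj : forall pj psi, Hom_trivial_degree Ag Qg pj psi ->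
     exists x, E pj x /\ forall u, psi u = iota x (i0 u)).

Let i0_in nk u : Qg nk u -> Pg nk (i0 u).
Proof. by move=> /ideg; rewrite subr0. Qed.

Lemma Ext1_degree j x : j <> 1 -> E (1, j) x -> x = 0.
Proof.
move=> j1 Ex; apply: (iinj Ex).
have [hx _] := Ext_cocycle hE Ex.
have hh := triv_degree_comp ideg hx; rewrite addr0 in hh.
exact: (Q1 j1 hh).
Qed.

Variables (L : seq (V * A)) (K : nat) (kap : P -> A).
Hypothesis hL : forall x, x \in L -> E (1, 1) x.1 /\ Ag 1%N x.2.
Hypotheses (htw : twisted Ag Pg dP eta f L kap K)
  (hMC : forall t, (0 < t <= K)%N -> word_MC m L t).
Local Notation Om := (Omega f L K kap).

Let OmD z : {morph (fun u => Om z (i0 u)) : u v / u + v}.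
Proof.
by move=> u v; rewrite linearD (Omega_Amorph htw z).1.
Qed.

Let OmZ z a u : Om z (i0 (a *: u)) = a * Om z (i0 u).
Proof. by rewrite linearZ /= (Omega_Amorph htw z).2. Qed.

Let OmzP (c : F) x y u : Om (c *: x + y) u = c *: Om x u + Om y u.
Proof. exact: (Omega_linear hf htw). Qed.

Let OmzD u : {morph Om^~ u : x y / x + y}.
Proof. by move=> x y /=; have := OmzP 1 x y u; rewrite !scale1r. Qed.

Let Omz0 u : Om 0 u = 0.
Proof. exact: (morph_add0 (OmzD u)). Qed.

Let OmzZ (c : F) x u : Om (c *: x) u = c *: Om x u.
Proof. by have := OmzP c x 0 u; rewrite addr0 Omz0 addr0. Qed.

Let Om_degree q j z l u : E (q, j) z -> Qg (q, l) u -> intgr Ag (l - j) (Om z (i0 u)).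
Proof. by move=> Ez /i0_in; apply: (Omega_degree hA rP hf hL htw Ez). Qed.

Let Om_off q j z n l u : E (q, j) z -> Qg (n, l) u -> n <> q -> Om z (i0 u) = 0.
Proof. by move=> Ez /i0_in; apply: (Omega_off hA rP hf hL htw Ez). Qed.

Let Om_lead q j z u : E (q, j) z -> Qg (q, j) u -> Om z (i0 u) = (iota z (i0 u))%:A.
Proof. by move=> Ez /i0_in; apply: (Omega_lead hA rP hf hL htw Ez). Qed.

Variables (J : nat) (I : finType) (b : I -> A) (c : I -> {scalar A}) (dg : I -> nat).
Hypotheses (bA : forall i, Ag (dg i) (b i)) (dgJ : forall i, (dg i <= J)%N)
  (cdeg : forall i k a, Ag k a -> k != dg i -> c i a = 0)
  (cE : forall k a, (k <= J)%N -> Ag k a -> a = \sum_i c i a *: b i).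

Let czdeg i l a : intgr Ag l a -> l <> (dg i)%:Z -> c i a = 0.
Proof.
case: l => l /= la ne; last by rewrite la linear0.
by apply: (cdeg la); apply/eqP => e; apply: ne; rewrite e.
Qed.

Let combo (z : I -> V) (u : Q) : F := \sum_i c i (Om (z i) (i0 u)).

Let comboD z : {morph combo z : u v / u + v}.
Proof.
move=> u v; rewrite /combo -big_split; apply: eq_bigr => i _.
by rewrite OmD linearD.
Qed.

Let comboZ z (e : F) u : combo z (e%:A *: u) = e * combo z u.
Proof.
rewrite /combo mulr_sumr; apply: eq_bigr => i _.
by rewrite OmZ mulr_algl linearZ.
Qed.

(** In internal degree l, [Om (z i)] has values in degree l - J + [dg i], and [c i] only sees degree
    [dg i]; this forces l = J. *)
Let combo_support q z nk u : (forall i, E (q, J%:Z - (dg i)%:Z) (z i)) ->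
  Qg nk u -> nk <> (q, J%:Z) -> combo z u = 0.
Proof.
case: nk => n l Ez Qu ne; rewrite /combo big1 // => i _.
have [nq|/eqP nq] := eqVneq n q; last by rewrite (Om_off (Ez i) Qu nq) linear0.
rewrite nq in Qu ne; apply: (czdeg (Om_degree (Ez i) Qu)) => e.
by apply: ne; congr (_, _); lia.
Qed.

(* By downward induction on the degrees of A: once psi - combo z vanishes on
   A_(>k) Q, its restrictions along elements of A_k are functionals to the
   trivial module, hence represented by Ext classes. *)
Lemma functional_combo q psi : {morph psi : u v / u + v} ->
  (forall (e : F) u, psi (e%:A *: u) = e * psi u) ->
  (forall nk u, Qg nk u -> nk <> (q, J%:Z) -> psi u = 0) ->
  exists z, (forall i, E (q, J%:Z - (dg i)%:Z) (z i)) /\ psi =1 combo z.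
Proof.
move=> psD psZ psdeg.
suff claim s : (s <= J.+1)%N -> exists z, (forall i, E (q, J%:Z - (dg i)%:Z) (z i)) /\
    forall k a u, (J.+1 - s <= k)%N -> Ag k a -> psi (a *: u) - combo z (a *: u) = 0.
  have [z [Ez zE]] := claim J.+1 (leqnn _); exists z; split=> // u.
  have := zE 0%N 1 u; rewrite subnn scale1r => /(_ isT (galg_one hA)) /eqP.
  by rewrite GRing.subr_eq0 => /eqP.
have rsupp z : (forall i, E (q, J%:Z - (dg i)%:Z) (z i)) -> forall nk u,
    Qg nk u -> nk <> (q, J%:Z) -> psi u - combo z u = 0.
  by move=> Ez nk u Qu ne; rewrite (psdeg _ _ Qu ne) (combo_support Ez Qu ne) subrr.
have homog_suff z a : (forall i, E (q, J%:Z - (dg i)%:Z) (z i)) -> forall k, Ag k a ->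
    (forall u, Qg (q, J%:Z - k%:Z) u -> psi (a *: u) - combo z (a *: u) = 0) ->
    forall u, psi (a *: u) - combo z (a *: u) = 0.
  move=> Ez k ka h u.
  move: u; suff: (fun u => psi (a *: u) - combo z (a *: u)) =1 fun=> 0 by [].
  apply: (graded_ext gQ) => [x y|x y|[n l] u Qu].
  - by rewrite scalerDr psD comboD opprD addrACA.
  - by rewrite addr0.
  have [e|/eqP ne] := eqVneq (n, l) (q, J%:Z - k%:Z); first by apply: h; rewrite -e.
  apply: (rsupp z Ez _ _ ((res_module rQ).2 _ _ _ _ _ ka Qu)) => -[nq kl].
  by apply: ne; congr (_, _) => //; lia.
elim: s => [|s IH] sJ.
  exists (fun=> 0); split=> [i|k a u]; first exact: (grading0 gE).
  rewrite subn0 => Jk ka; apply: (homog_suff _ _ _ k ka) => [i|v Qv].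
    exact: (grading0 gE).
  by rewrite (Q_ge0 _ Qv) ?scaler0 ?(morph_add0 psD) ?(morph_add0 (comboD _)) ?subrr //; lia.
have [z [Ez zE]] := IH (ltnW sJ).
pose k0 := (J - s)%N.
have Jk0 : J%:Z - k0%:Z = s%:Z by rewrite /k0; lia.
have h0 i : exists y, E (q, J%:Z - (dg i)%:Z) y /\ (dg i = k0 -> forall u,
    psi (b i *: u) - combo z (b i *: u) = iota y (i0 u)).
  have [ik|/eqP ik] := eqVneq (dg i) k0; last first.
    by exists 0; split; [exact: (grading0 gE)|].
  have [|y [Ey yE]] := @isurj (q, J%:Z - (dg i)%:Z)
      (fun u => psi (b i *: u) - combo z (b i *: u)).
    split; first split.
    - by move=> u v; rewrite scalerDr psD comboD opprD addrACA.
    - move=> e u; rewrite scalerA mulr_algr -mulr_algl -scalerA psZ comboZ -mulrBr //.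
    - move=> k a u k_gt0 ka; rewrite scalerA.
      apply: (zE (dg i + k)%N); last exact: (galg_mul hA).
      by rewrite ik /k0; lia.
    - move=> [n l] u Qu ne.
      apply: (rsupp z Ez _ _ ((res_module rQ).2 _ _ _ _ _ (bA i) Qu)) => -[nq kl].
      by apply: ne; congr (_, _) => //; lia.
  by exists y; split.
have /choice[y yP] := h0.
(* The added classes repair the coefficients of degree [k0], by [Om_lead]. They do not disturb
   larger degrees, where [Om (y i)] would have to take values in negative degree. *)
pose z' i := z i + (if dg i == k0 then y i else 0).
have Ez' i : E (q, J%:Z - (dg i)%:Z) (z' i).
  apply: (gradingD gE) => //; case: ifP => _; last exact: (grading0 gE).
  by have [] := yP i.
exists z'; split=> // k a u kk ka; apply: (homog_suff _ _ _ k ka) => // v Qv.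
have combo' w : combo z' w = combo z w + \sum_(i | dg i == k0) c i (Om (y i) (i0 w)).
  rewrite /combo [X in _ = _ + X]big_mkcond -big_split; apply: eq_bigr => i _.
  by rewrite /z' OmzD linearD; case: ifP => //; rewrite Omz0 linear0.
rewrite combo' opprD addrA.
have [kk0|kk0] := eqVneq k k0; last first.
  rewrite (zE k) //; last by move: kk0 kk; rewrite /k0; lia.
  rewrite sub0r big1 ?oppr0 // => i /eqP ik; have [Ey _] := yP i.
  rewrite OmZ (intgr_lt0 _ (Om_degree Ey Qv)) ?mulr0 ?linear0 // ik.
  by move: kk0 kk; rewrite /k0; lia.
rewrite kk0 in ka Qv.
have kJ : (k0 <= J)%N by rewrite /k0 leq_subr.
pose rho w := psi w - combo z w.
have rhoD : {morph rho : u v / u + v}.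
  by move=> w w'; rewrite /rho psD comboD opprD addrACA.
have rhoZ e w : rho (e%:A *: w) = e * rho w by rewrite /rho psZ comboZ mulrBr.
apply/eqP; rewrite GRing.subr_eq0; apply/eqP.
rewrite -[LHS]/(rho (a *: v)) {1}(cE kJ ka) scaler_suml (morph_sum _ _ _ rhoD).
rewrite [RHS]big_mkcond; apply: eq_bigr => i _.
rewrite -mulr_algl -scalerA rhoZ.
case: eqP => [ik|ik]; last by rewrite (cdeg ka) ?mul0r // eq_sym; apply/eqP.
have [Ey yE] := yP i; rewrite OmZ (Om_lead Ey) ?ik // mulr_algr linearZ /= mulrC.
by congr (_ * _); apply: yE.
Qed.

(** Downward induction on the degree k of a: evaluated at a u with u in internal degree J - k, the
    basis elements of degree below k contribute nothing for degree reasons, those above k by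
    induction, and the rest is the representative of S(a) at u. Injectivity of restriction to Q
    concludes. *)
Lemma combo_inj q (S : A -> V) :
  (forall (e : F) a a', S (e *: a + a') = e *: S a + S a') ->
  (forall k a, Ag k a -> E (q, J%:Z - k%:Z) (S a)) ->
  (forall u, combo (S \o b) u = 0) -> S 1 = 0.
Proof.
move=> Slin Sdeg S0.
have SD : {morph S : a a' / a + a'}.
  by move=> a a'; have := Slin 1 a a'; rewrite !scale1r.
have SZ (e : F) a : S (e *: a) = e *: S a.
  by have := Slin e a 0; rewrite addr0 (morph_add0 SD) addr0.
suff claim s : (s <= J.+1)%N -> forall k a, (J.+1 - s <= k <= J)%N -> Ag k a -> S a = 0.
  by apply: (claim J.+1 (leqnn _) 0%N _ _ (galg_one hA)); rewrite subnn.
elim: s => [_ k a|s IH sJ k a /andP[kk kJ] ka]; first by rewrite subn0; lia.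
have [ks|ks] := boolP (J.+1 - s <= k)%N.
  by apply: (IH (ltnW sJ) k) => //; rewrite ks.
have kE : k = (J - s)%N by lia.
apply: (iinj (Sdeg _ _ ka)) => u.
move: u; suff: (fun u => iota (S a) (i0 u)) =1 fun=> 0 by [].
have [[tS dS] _] := Ext_cocycle hE (Sdeg _ _ ka); have [iD _ _] := tS.
apply: (graded_ext gQ) => [u v|u v|[n l] u Qu].
- by rewrite linearD; apply: iD.
- by rewrite addr0.
have [e|/eqP ne] := eqVneq (n, l) (q, J%:Z - k%:Z); last exact: (dS _ _ (i0_in Qu) ne).
rewrite e in Qu; rewrite -[RHS](S0 (a *: u)) /combo.
rewrite (cE kJ ka) (morph_sum _ _ _ SD) (morph_sum _ _ _ (iotaD _)) -(cE kJ ka).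
apply: eq_bigr => i _; rewrite OmZ SZ iotaZ /=.
have [ik|/eqP ik] := eqVneq (dg i) k.
  by rewrite (Om_lead (Sdeg _ _ (bA i))) ?ik // mulr_algr linearZ /= mulrC.
rewrite (cdeg ka) ?mul0r; last by rewrite eq_sym; apply/eqP.
have [ki|ki] := leqP (dg i) k.
  rewrite (intgr_lt0 _ (Om_degree (Sdeg _ _ (bA i)) Qu)) ?mulr0 ?linear0 //; lia.
rewrite (IH (ltnW sJ) (dg i) (b i)) ?Omz0 ?mulr0 ?linear0 //.
by rewrite dgJ andbT; lia.
Qed.

(** Moving g(b_i) past [c i] recovers g applied to the expansion of a in the basis. *)
Lemma contract_coordinates (g : {scalar A}) l a : intgr Ag l a -> l <= J%:Z ->
  \sum_i c i (g (b i) *: a) = g a.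
Proof.
case: l => l /= la lJ; last first.
  by rewrite la linear0 big1 // => i _; rewrite scaler0 linear0.
rewrite {2}(cE (k := l) _ la) ?linear_sum; last by lia.
by apply: eq_bigr => i _; rewrite !linearZ /= mulrC.
Qed.

Hypothesis JK : (J <= K)%N.

Lemma Ext_word_products q x : 0 < q + 1 -> E (q + 1, J%:Z) x ->
  addspan (fun y => exists w z j', [/\ w <> [::], forall e, e \in w -> E (1, 1) e,
     E (q, j') z & y = m (w ++ [:: z])]) x.
Proof.
move=> q0 Ex; have [hx _] := Ext_cocycle hE Ex.
have hphi := triv_degree_comp ideg hx; rewrite addr0 in hphi.
have [psi [psD psZ psdeg psE]] := coboundary_functional q0 hphi.
rewrite addrK in psdeg.
have [z [Ez zE]] := functional_combo psD psZ psdeg.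
have [aug [augP aug1 aug0 augdeg]] := augmentation.
have aug_scal : scalar aug by [].
pose Aug : {scalar A} := HB.pack aug (GRing.isLinear.Build F A F *%R aug aug_scal).
pose M i n (r : seq V * A) : V := m (r.1 ++ [:: z i]) *~ ss n.
pose T a := \sum_i \sum_(n < K.+1) \sum_(r <- words L n) c i (a * r.2) *: M i n r.
(* At a = 1 this is x plus a combination of word products. It is extended to all of A so that
   [combo_inj] can test it against Q. *)
pose S a := aug a *: x + T a *~ sgn q.
have EM i n r : r \in words L n -> E (q + 1, n%:Z + (J%:Z - (dg i)%:Z)) (M i n r).
  move=> /(words_good hA hL)[sr wr _]; apply: (gradingMz gE).
  by have := m_tail_degree mdeg wr (Ez i); rewrite sr.
have Slin (e : F) a a' : S (e *: a + a') = e *: S a + S a'.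
  have TP : T (e *: a + a') = e *: T a + T a'.
    rewrite /T scaler_sumr -big_split; apply: eq_bigr => i _ /=.
    rewrite scaler_sumr -big_split; apply: eq_bigr => n _ /=.
    rewrite scaler_sumr -big_split; apply: eq_bigr => r _ /=.
    by rewrite mulrDl -scalerAl linearP /= scalerDl scalerA.
  rewrite /S augP TP mulrzDl scalerDl scalerDr scalerA addrACA.
  by rewrite scalerMzr.
have Sdeg k a : Ag k a -> E (q + 1, J%:Z - k%:Z) (S a).
  move=> ka; apply: (gradingD gE).
    have [k0|k0] := eqVneq k 0%N; first by rewrite k0 subr0; apply: sE.
    by rewrite (augdeg _ _ ka k0) scale0r; apply: (grading0 gE).
  apply: (gradingMz gE); apply: (graded_sum gE) => i _ _.
  apply: (graded_sum gE) => n _ _; apply: (graded_sum gE) => r rw _.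
  have [_ _ rA] := words_good hA hL rw.
  have [e|/eqP e] := eqVneq (k + n)%N (dg i).
    apply: sE; rewrite (_ : J%:Z - k%:Z = n%:Z + (J%:Z - (dg i)%:Z)); first exact: EM.
    by rewrite -e; lia.
  rewrite (cdeg (galg_mul hA ka rA)) ?scale0r; first exact: (grading0 gE).
  exact/eqP.
(* Contracting the coordinates turns the part in x into phi(u); by [Omega_d] the part in [T] becomes
   -psi(dQ u). They cancel because phi = psi dQ. *)
have S0 u : combo (S \o b) u = 0.
  move: u; suff: combo (S \o b) =1 fun=> 0 by [].
  apply: (graded_ext gQ) => [u v|u v|nk u Qu]; [exact: comboD|by rewrite addr0|].
  have [e|/eqP ne] := eqVneq nk (q + 1, J%:Z); last first.
    by apply: (combo_support _ Qu ne) => i; apply: Sdeg.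
  rewrite e in Qu; have Pu := i0_in Qu.
  transitivity (aug (Om x (i0 u)) + (\sum_i \sum_(n < K.+1)
      \sum_(r <- words L n) c i (Om (M i n r) (i0 u) * r.2)) *~ sgn q).
    rewrite /combo /=.
    rewrite (eq_bigr (fun k => c k (aug (b k) *: Om x (i0 u)) + (\sum_i
       \sum_(n < K.+1) \sum_(r <- words L n)
          c k (c i (b k * r.2) *: Om (M i n r) (i0 u))) *~ sgn q)); last first.
      move=> k _; rewrite /S OmzP linearD; congr (_ + _).
      rewrite (morph_mulrz _ _ (OmzD _)) raddfMz /T /=; congr (_ *~ _).
      rewrite (morph_sum _ _ _ (OmzD _)) linear_sum /=; apply: eq_bigr => i _.
      rewrite (morph_sum _ _ _ (OmzD _)) linear_sum /=; apply: eq_bigr => n _.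
      rewrite (morph_sum _ _ _ (OmzD _)) linear_sum /=; apply: eq_bigr => r _.
      by rewrite OmzZ.
    rewrite big_split /= -mulrz_suml; congr (_ + _ *~ _).
      have := Om_degree Ex Qu; rewrite subrr => h.
      by apply: (contract_coordinates Aug h).
    rewrite exchange_big; apply: eq_bigr => i _.
    rewrite exchange_big; apply: eq_bigr => n _.
    rewrite exchange_big big_seq [RHS]big_seq; apply: eq_bigr => r rw.
    have gl : scalar (fun a => c i (a * r.2)).
      by move=> e0 a a'; rewrite mulrDl -scalerAl linearP.
    pose g : {scalar A} := HB.pack (fun a => c i (a * r.2))
      (GRing.isLinear.Build F A F *%R (fun a => c i (a * r.2)) gl).
    apply: (contract_coordinates g (Om_degree (EM i n r rw) Qu)).
    by have := dgJ i; lia.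
  rewrite (Om_lead Ex Qu) -[_%:A]addr0 augP aug1 mulr1.
  have -> : aug 0 = 0 by rewrite (augdeg 1%N) //; apply: (grading0 (galg_grading hA)).
  rewrite addr0.
  have -> : \sum_i \sum_(n < K.+1) \sum_(r <- words L n)
      c i (Om (M i n r) (i0 u) * r.2) = - psi (dQ u) *~ sgn q.
    rewrite zE /combo mulNrz mulrz_suml -sumrN; apply: eq_bigr => i _.
    rewrite -id -(raddfMz (c i)) (Omega_d hA rP mdeg hf hL htw hMC (Ez i) Pu); last first.
      by have := dgJ i; lia.
    rewrite raddfN opprK raddf_sum; apply: eq_bigr => n _.
    by rewrite raddf_sum.
  rewrite -mulrzA sgn_sq mulr1z -psE /=.
  exact: subrr.
have mD w : {morph (fun y => m (w ++ [:: y])) : y y' / y + y'}.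
  by move=> y y'; have := mlin w [::] 1 y y'; rewrite !scale1r.
have mZ w (e : F) y : m (w ++ [:: e *: y]) = e *: m (w ++ [:: y]).
  by have := mlin w [::] e y 0; rewrite addr0 (morph_add0 (mD w)) addr0.
have := combo_inj Slin Sdeg S0; rewrite /S aug1 scale1r => /eqP.
rewrite addr_eq0 -mulrNz => /eqP ->; rewrite mulrz_suml.
apply: addspan_sum => i _ _; rewrite mulrz_suml.
apply: addspan_sum => n _ _; rewrite mulrz_suml.
apply: addspan_sum => r rw _; have [sr wr _] := words_good hA hL rw.
(* The empty word contributes m_1, which is zero on the minimal model. *)
have [w0|w0] := eqVneq r.1 [::].
  by rewrite /M w0 m1 mul0rz scaler0 mul0rz; apply: addspan0.
apply: addspan_in.
exists r.1, ((c i (1 * r.2) *: (z i *~ ss n)) *~ - sgn q), (J%:Z - (dg i)%:Z).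
split=> //; first exact/eqP.
  by apply: (gradingMz gE); apply: sE; apply: (gradingMz gE).
by rewrite (morph_mulrz _ _ (mD _)) mZ (morph_mulrz _ _ (mD _)).
Qed.

End Representation.

Theorem Ext_generated p j x : 0 < p -> E (p, j) x ->
  addspan (fun y => exists w z j', [/\ w <> [::], forall e, e \in w -> E (1, 1) e,
     E (p - 1, j') z & y = m (w ++ [:: z])]) x.
Proof.
move=> p0 Ex.
have [i0 [ideg id iinj isurj]] := Ext_minimal hA rP rQ mQ hE.
have [j0|j0] := boolP (j < 0).
  have -> : x = 0; last exact: addspan0.
  apply: (iinj _ _ Ex); have [[tx dx] _] := Ext_cocycle hE Ex; have [xD _ _] := tx.
  suff: (fun u => eta (f [:: x] (i0 u))) =1 fun=> 0 by [].
  apply: (graded_ext gQ) => [u v|u v|nk u Qu].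
  - by rewrite linearD xD.
  - by rewrite addr0.
  have [e|/eqP ne] := eqVneq nk (p, j).
    by rewrite e in Qu; rewrite (Q_ge0 j0 Qu) linear0 (morph_add0 xD).
  by apply: (dx nk) ne; have := ideg _ _ Qu; rewrite subr0.
case: j j0 Ex => J // _ Ex.
have E1 := Ext1_degree ideg iinj.
have [L [hL tw]] := twisted_exists hA rP gE sE mdeg m1 hf hE E1.
(* Stages start at 1, and J may be 0. *)
have [hMC [kap htw]] := tw J.+1 isT.
have [I [b [c [dg [bA dgJ cdeg cE]]]]] := galg_coordinates_le J.
have := @Ext_word_products i0 ideg id iinj isurj L J.+1 kap hL htw hMC
  J I b c dg bA dgJ cdeg cE (leqnSn J) (p - 1) x.
by rewrite subrK; apply.
Qed.

End Generation.

(** * Truncated bi-Koszul algebras *)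

Section GeneratedInDegrees.
Variables (F : fieldType) (A : algType F) (Ag : nat -> A -> Prop).
Hypothesis hA : graded_algebra Ag.
Variables (Q : lmodType A) (Qg : int * int -> Q -> Prop).
Hypothesis hQ : graded_module Ag Qg.
Variables (n : nat) (D : pred int).
Hypothesis gen : generated_in_degrees Qg n D.

(** A functional to the trivial module is determined by its values on generators, and none of these
    has degree j. *)
Lemma generated_triv_eq0 j phi : ~~ D j ->
  Hom_trivial_degree Ag Qg (n%:Z, j) phi -> forall u, phi u = 0.
Proof.
move=> Dj [tphi dphi]; have [phD _ _] := tphi.
apply: (graded_ext hQ.1) => [u v|u v|nk u Qu]; first exact: phD.
  by rewrite addr0.
have [e|/eqP ne] := eqVneq nk (n%:Z, j); last exact: dphi Qu ne.
rewrite e in Qu; move/gen: Qu => Hu.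
elim/addspan_ind: u / Hu => [|x y ex ey|_ [a [l [w [Dl Qw ->]]]]].
- exact: morph_add0 phD.
- by rewrite phD ex ey addr0.
- apply: (triv_scale hA tphi); apply: (dphi _ _ Qw) => -[lj].
  by rewrite lj (negbTE Dj) in Dl.
Qed.

Lemma generated_ge0 : (forall l, D l -> 0 <= l) ->
  forall l u, l < 0 -> Qg (n%:Z, l) u -> u = 0.
Proof.
move=> D0 l u l0 Qu; pose R w := exists2 k, D k & Qg (n%:Z, k) w.
have Rh w : R w -> exists nk, Qg nk w by move=> [k _ Qw]; exists (n%:Z, k).
have Ru : addspan (fun v => exists (a : A) w, R w /\ v = a *: w) u.
  apply: addspan_sub (gen Qu) => _ [a [k [w [Dk Qw ->]]]].
  by apply: addspan_in; exists a, w; split=> //; exists k.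
have Hu := gmod_homog_gen hA hQ Rh Qu Ru; move: {Qu Ru} Hu => Hu.
elim/addspan_ind: u / Hu => [//|x y -> ->|].
  by rewrite addr0.
move=> _ [i [a [k [w [[k' Dk' Qw'] _ Qw ik ->]]]]].
rewrite (grading_disjoint hQ.1 Qw Qw') ?scaler0 //.
by apply/eqP => -[kk]; have := D0 _ Dk'; rewrite -kk; lia.
Qed.

End GeneratedInDegrees.

Lemma size_inner (T : Type) (xs : seq T) N i t : size xs = N -> (i + t <= N)%N ->
  size (take t (drop i xs)) = t.
Proof. by move=> <- it; rewrite size_takel // size_drop; lia. Qed.

Lemma size_outer (T : Type) (xs : seq T) N i t x : size xs = N -> (i + t <= N)%N ->
  size (take i xs ++ x :: drop (i + t) xs) = (N - t).+1.
Proof. by move=> <- it; rewrite size_cat /= size_takel ?size_drop; lia. Qed.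

Lemma multilinear0 (F : fieldType) (V : lmodType F) (m : seq V -> V) s1 s2 :
  multilinear m -> m (s1 ++ 0 :: s2) = 0.
Proof.
move=> mlin; have := mlin s1 s2 1 0 0; rewrite scaler0 addr0 scale1r => /eqP.
by rewrite -subr_eq0 opprD addNKr oppr_eq0 => /eqP.
Qed.

(** * Stasheff relations with a single higher operation *)

Section RestrictOps.
Variables (F : fieldType) (V : lmodType F) (m : seq V -> V).
Hypothesis mlin : multilinear m.

Lemma restrict_multilinear ns : multilinear (restrict_ops ns m).
Proof.
move=> s1 s2 c x y; rewrite /restrict_ops !size_cat /=.
by case: ifP => _; [apply: mlin|rewrite scaler0 addr0].
Qed.

Variables (G : int -> V -> Prop) (one : V) (d : nat).
Hypotheses (hm : Ainf_algebra G m one) (d4 : (4 <= d)%N)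
  (msize : forall s, s <> [::] -> size s \notin [:: 2; d; d.+1]%N -> m s = 0).

Lemma restrict_Ainf q : q \in [:: d; d.+1] ->
  Ainf_algebra G (restrict_ops [:: 2%N; q] m) one.
Proof.
move=> qd; set m' := restrict_ops _ m.
have m'lin : multilinear m' by apply: restrict_multilinear.
have qE : q = d \/ q = d.+1 by move: qd; rewrite !inE => /orP[/eqP->|/eqP->]; [left|right].
split=> //.
- exact: Ainf_grading hm.
- exact: Ainf_scale hm.
- move=> s s0 hs; rewrite /m' /restrict_ops; case: ifP => _.
    exact: (Ainf_degree hm).
  exact: (grading0 (Ainf_grading hm)).
- move=> s s0 hs; have msz t i : (i + t <= size s)%N ->
      size (take t (drop i (unzip2 s))) = t.
    by apply: size_inner; rewrite size_map.
  have osz t i x : (i + t <= size s)%N -> size (take i (unzip2 s) ++ x :: drop (i + t) (unzip2 s))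
      = (size s - t).+1.
    by apply: size_outer; rewrite size_map.
  have zero0 (g : seq V -> V) (e : int) i t y : multilinear g -> y = 0 ->
      g (take i (unzip2 s) ++ y :: drop (i + t) (unzip2 s)) *~ e = 0.
    by move=> glin ->; rewrite multilinear0 ?mul0rz.
  have inner0 t i : (0 < t)%N -> (i + t <= size s)%N -> t \notin [:: 2; d; d.+1]%N ->
      m (take t (drop i (unzip2 s))) = 0.
    move=> t0 it tn; apply: msize; last by rewrite msz.
    by move=> e; have := msz t i it; rewrite e /= => te; rewrite -te in t0.
  have outer0 t i x : (i + t <= size s)%N -> (size s - t).+1 \notin [:: 2; d; d.+1]%N ->
      m (take i (unzip2 s) ++ x :: drop (i + t) (unzip2 s)) = 0.
    move=> it tn; apply: msize; last by rewrite osz.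
    by case: (take _ _).
  (* These are the sizes reached by composing two operations of arity 2 or q. For them the
     restricted sum equals the full one, as any other pair of arities has a different total; for the
     remaining sizes each term contains an operation that was cut off. *)
  have [good|bad] := boolP (size s \in [:: 3; q.+1; q.*2.-1]%N).
    rewrite -(Ainf_relation hm s0 hs); apply: eq_bigr => i _; apply: eq_bigr => t /andP[t0 it].
    have [tq|tq] := boolP (nat_of_ord t \in [:: 2%N; q]); last first.
      rewrite zero0 //; last by rewrite /m' /restrict_ops msz // (negbTE tq).
      have [tn|tn] := boolP (nat_of_ord t \in [:: 2; d; d.+1]%N); last first.
        by rewrite zero0 //; apply: inner0.
      rewrite outer0 ?mul0rz //.
      by move: good tq tn t0 it; rewrite !inE; case: qE => ->; lia.
    rewrite {2}/m' {1}/restrict_ops msz // tq /m' /restrict_ops osz //.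
    case: ifP => // /negbT oq; rewrite outer0 //.
    by move: good tq oq t0 it; rewrite !inE; case: qE => ->; lia.
  apply: big1 => i _; apply: big1 => t /andP[t0 it].
  have [tq|tq] := boolP (nat_of_ord t \in [:: 2%N; q]); last first.
    by rewrite zero0 // /m' /restrict_ops msz // (negbTE tq).
  rewrite /m' /restrict_ops osz // ifF ?mul0rz //.
  by apply/negbTE; move: bad tq t0 it; rewrite !inE; lia.
- exact: Ainf_one_degree hm.
- by move=> x; rewrite /m' /restrict_ops /= (Ainf_mul1 hm).
- by move=> x; rewrite /m' /restrict_ops /= (Ainf_mulr1 hm).
- move=> s s2 os; rewrite /m' /restrict_ops; case: ifP => // _.
  exact: (Ainf_strict_unit hm).
Qed.

End RestrictOps.

(** Equality on [piece] rests on an opaque decision procedure and does not compute, so the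
    comparisons are tabulated for rewriting. *)
Lemma piece_eqE :
  (((E0 == E0) = true) *
   ((E0 == E1) = false) *
   ((E0 == E2d) = false) *
   ((E0 == E2d1) = false) *
   ((E1 == E0) = false) *
   ((E1 == E1) = true) *
   ((E1 == E2d) = false) *
   ((E1 == E2d1) = false) *
   ((E2d == E0) = false) *
   ((E2d == E1) = false) *
   ((E2d == E2d) = true) *
   ((E2d == E2d1) = false) *
   ((E2d1 == E0) = false) *
   ((E2d1 == E1) = false) *
   ((E2d1 == E2d) = false) *
   ((E2d1 == E2d1) = true))%type.
Proof. by do !split; apply/eqP. Qed.

(** * Products in the truncated case *)

Section Truncated.
Variables (F : fieldType) (V : lmodType F) (E : int * int -> V -> Prop).
Variables (m : seq V -> V) (one : V) (d : nat).
Hypotheses (gE : is_grading E) (sE : forall pj (c : F) x, E pj x -> E pj (c *: x))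
  (hm : Ainf_algebra (cohom E) m one)
  (mdeg : forall s, s <> [::] -> homog E s ->
     E (total_degree s + (2 - (size s)%:Z, 0)) (m (unzip2 s)))
  (d4 : (4 <= d)%N) (trunc : truncated_ops E d m)
  (hD : forall n j x, j <> (Delta d n).1%:Z -> j <> (Delta d n).2%:Z ->
     E (n%:Z, j) x -> x = 0)
  (hG : forall p j x, 0 < p -> E (p, j) x ->
     addspan (fun y => exists w z j', [/\ w <> [::], forall e, e \in w -> E (1, 1) e,
       E (p - 1, j') z & y = m (w ++ [:: z])]) x).

Let mlin : multilinear m := Ainf_multilinear hm.

Let msize s : s <> [::] -> size s \notin [:: 2; d; d.+1]%N -> m s = 0 := trunc.1 s.

Lemma m_tailD w : {morph (fun y => m (w ++ [:: y])) : y y' / y + y'}.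
Proof. by move=> y y'; have := mlin w [::] 1 y y'; rewrite !scale1r. Qed.

Lemma piece0 k j x : E ((3 * k)%N%:Z, j) x -> piece_space E d E0 x.
Proof. by move=> Ex; apply: addspan_in; exists k, j; rewrite addn0. Qed.

Lemma piece1 k j x : E ((3 * k + 1)%N%:Z, j) x -> piece_space E d E1 x.
Proof. by move=> Ex; apply: addspan_in; exists k, j. Qed.

(** The table speaks of labelled pieces, so a homogeneous element must be placed in one; [hD] leaves
    only the two degrees prescribed by [Delta]. *)
Lemma piece2 k j x : E ((3 * k + 2)%N%:Z, j) x ->
  x = 0 \/ exists2 q, q \in [:: E2d; E2d1] & piece_space E d q x.
Proof.
move=> Ex.
have DE : Delta d (3 * k + 2) = (2 * d * k + d, 2 * d * k + d + 1)%N.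
  have e3 : (3 * k + 2 = k * 3 + 2)%N by rewrite mulnC.
  by rewrite /Delta e3 modnMDl divnMDl // divn_small // addn0.
have [jd|/eqP jd] := eqVneq j (2 * d * k + d)%N%:Z.
  by right; exists E2d; rewrite ?inE ?piece_eqE //=; apply: addspan_in; exists k; rewrite -jd.
have [jd1|/eqP jd1] := eqVneq j (2 * d * k + d + 1)%N%:Z.
  by right; exists E2d1; rewrite ?inE ?piece_eqE //=; apply: addspan_in; exists k; rewrite -jd1.
by left; apply: (hD _ _ Ex); rewrite DE.
Qed.

Lemma piece_word (w : seq V) e : (forall x, x \in w -> E (1, 1) x) -> e \in w ->
  piece_space E d E1 e.
Proof. by move=> hw /hw Ee; apply: (@piece1 0 1). Qed.

(** In the table [E0] occurs in rows of length two only. *)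
Lemma m_E0_eq0 (s : seq (piece * V)) : homog (piece_space E d) s ->
  (2 < size s)%N -> E0 \in unzip1 s -> m (unzip2 s) = 0.
Proof.
move=> hs s2 s0; apply: (trunc.2 s _ hs).2; first by case: s s2 {hs s0}.
move=> w r wr; apply/negP => pw.
have sw : (2 < size w)%N by rewrite -(perm_size pw) size_map.
have w0 : E0 \in w by rewrite -(perm_mem pw).
move: wr sw w0; rewrite !inE.
have table (v : seq piece) : (size v == 2%N) || (E0 \notin v) -> (2 < size v)%N ->
    E0 \in v -> False by case/orP => [/eqP->|/negP].
by do 8?[case/orP]; move=> /eqP[-> _] sw w0; apply: table sw w0;
  rewrite ?inE ?mem_nseq ?piece_eqE ?andbF ?orbT.
Qed.

Lemma m_E1_pair_eq0 q x y : piece_space E d E1 x -> piece_space E d q y ->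
  q != E0 -> m [:: x; y] = 0.
Proof.
move=> hx hy q0; apply: (trunc.2 [:: (E1, x); (q, y)] _ _).2 => //.
  by move=> z; rewrite !inE => /orP[] /eqP->.
move=> w r wr; apply/negP => pw; have := perm_size pw => /= sw.
have w1 : E1 \in w by rewrite -(perm_mem pw) !inE piece_eqE.
have w0 : E0 \notin w by rewrite -(perm_mem pw) !inE piece_eqE /= eq_sym.
move: wr sw w1 w0 {pw}; rewrite !inE.
have table (v : seq piece) : [|| (2 < size v)%N, E1 \notin v | E0 \in v] ->
    2%N = size v -> E1 \in v -> E0 \notin v -> False.
  by case/or3P => [h sv|/negP //|-> //]; rewrite -sv in h.
by do 8?[case/orP]; move=> /eqP[-> _] sw w1 w0; apply: table sw w1 w0;
  rewrite ?inE ?mem_nseq ?piece_eqE ?orbT //= size_nseq; lia.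
Qed.

(* The Stasheff relation on (w, z, a) moves a degree 3k factor out of the last
   argument; d >= 4 makes all other terms vanish. *)
Lemma pull_out (w : seq V) z a q jz k ja : (forall e, e \in w -> E (1, 1) e) ->
  (size w).+1 \in [:: d; d.+1] -> E (q, jz) z -> E ((3 * k)%N%:Z, ja) a ->
  (exists2 p, p != E0 & piece_space E d p z) ->
  exists e : int, m (w ++ [:: m [:: z; a]]) = m [:: m (w ++ [:: z]); a] *~ e.
Proof.
move=> hw sw Ez Ea [pz pz0 hz]; pose n := (size w).+1.
pose ps := [seq (E1, e) | e <- w] ++ [:: (pz, z); (E0, a)].
pose s := pos1 w ++ [:: (q, z); ((3 * k)%N%:Z, a)].
pose xs := w ++ [:: z; a].
have usp : unzip2 ps = xs by rewrite /ps /unzip2 map_cat -map_comp map_id.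
have us : unzip2 s = xs.
  by rewrite /s /unzip2 map_cat -[map _ _]/(unzip2 _) unzip2_pos1.
have hps : homog (piece_space E d) ps.
  move=> y; rewrite mem_cat => /orP[/mapP[e ew ->]|]; first exact: piece_word ew.
  by rewrite !inE => /orP[] /eqP-> //=; apply: (piece0 Ea).
have hs : homog (cohom E) s.
  move=> y; rewrite mem_cat => /orP[/mapP[e /hw Ee ->]|]; first exact: cohom1 Ee.
  by rewrite !inE => /orP[] /eqP-> /=; [apply: cohom1 Ez|apply: cohom1 Ea].
have nE : n = d \/ n = d.+1 by move: sw; rewrite !inE => /orP[/eqP|/eqP]; [left|right].
have sxs : size xs = n.+1 by rewrite size_cat addn2.
have ss : size s = n.+1 by rewrite size_cat size_map addn2.
have s0 : s <> [::] by rewrite /s; case: (pos1 w).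
pose T i t : V := m (take i xs ++ m (take t (drop i xs)) :: drop (i + t) xs).
have inner0 i t : m (take t (drop i xs)) = 0 -> T i t = 0.
  by move=> e; rewrite /T e multilinear0.
(* The two exceptions are the product z a inserted at the end and the long operation on (w, z)
   inserted at the front. *)
have T0 i t : (0 < t)%N -> (i + t <= n.+1)%N -> (i, t) <> (0%N, n) ->
    (i, t) <> (n.-1, 2%N) -> T i t = 0.
  move=> t0 it ne0 ne1; have st := size_inner sxs it.
  have so := size_outer (m (take t (drop i xs))) sxs it.
  have [tn|tn] := boolP (t \in [:: 2; d; d.+1]%N); last first.
    apply: inner0; apply: msize; last by rewrite st.
    by move=> e; rewrite e /= in st; rewrite -st in t0.
  have [on|on] := boolP ((n.+1 - t).+1 \in [:: 2; d; d.+1]%N); last first.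
    by apply: msize; [case: (take _ _)|rewrite so].
  have [t2|t2] := eqVneq t 2%N.
    apply: inner0; rewrite t2 in it ne1 *.
    have iw : (i < size w)%N.
      have : i <> n.-1 by move=> e; apply: ne1; rewrite e.
      by rewrite /n in it *; lia.
    have -> : take 2 (drop i xs) = [:: nth 0 w i; nth 0 (w ++ [:: z]) i.+1].
      rewrite /xs -cat_rcons -cats1 drop_cat size_cat addn1 ltnS ltnW //.
      rewrite (drop_nth 0) ?size_cat ?addn1 ?ltnS 1?ltnW // (drop_nth 0) ?size_cat ?addn1 //.
      by rewrite /= take0 [X in [:: X; _] = _]nth_cat iw.
    have Ei : piece_space E d E1 (nth 0 w i) by apply: (piece_word hw); apply: mem_nth.
    rewrite nth_cat; case: ltnP => iw'.
      by apply: (m_E1_pair_eq0 Ei (q := E1)); rewrite ?piece_eqE //; apply: (piece_word hw); apply: mem_nth.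
    have -> : (i.+1 - size w = 0)%N by lia.
    exact: (m_E1_pair_eq0 Ei hz pz0).
  (* With n and t both in {d, d+1}, the outer arity is 2 if t = n and otherwise 1 or 3, neither of
     which is available. So t = n and i = 1: the inner operation ends in a, and a long operation
     kills E^[0]. *)
  have it' : (i + t = n.+1)%N.
    move: tn on t2 ne0; rewrite !inE => tn on t2 ne0.
    have : ~ (i = 0%N /\ t = n) by move=> [e1 e2]; apply: ne0; rewrite e1 e2.
    by case: nE => nE; rewrite nE in on it *; lia.
  apply: inner0; rewrite -usp -map_drop -map_take; apply: m_E0_eq0.
  - by move=> y /mem_take /mem_drop; apply: hps.
  - rewrite (@size_inner _ _ n.+1) //; first by move: tn t2; rewrite !inE; lia.
    by rewrite -(size_map snd) -[map _ _]/(unzip2 ps) usp.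
  - have sps : size ps = n.+1 by rewrite -(size_map snd) -[map _ _]/(unzip2 ps) usp.
    rewrite take_oversize; last by rewrite size_drop sps; lia.
    rewrite /unzip1 map_drop /ps map_cat /= -cat_rcons drop_cat.
    case: ltnP => h1; first by rewrite mem_cat inE eqxx orbT.
    have -> : (i - size (rcons [seq x.1 | x <- [seq (E1, e) | e <- w]] pz) = 0)%N.
      move: h1; rewrite size_rcons !size_map -/n => h1.
      by move: t2 tn; rewrite !inE; lia.
    by rewrite drop0 inE eqxx.
have n4 : (3 < n)%N by case: nE => ->; lia.
have TA : T n.-1 2 = m (w ++ [:: m [:: z; a]]).
  rewrite /T /= /xs take_size_cat // drop_size_cat //= drop_oversize //.
  by rewrite size_cat addn2.
have TB : T 0%N n = m [:: m (w ++ [:: z]); a].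
  rewrite /T take0 drop0 add0n (_ : xs = rcons w z ++ [:: a]); last by rewrite cat_rcons.
  by rewrite take_size_cat ?drop_size_cat ?size_rcons // cats1.
have rel := Ainf_relation hm s0 hs.
pose sg i t : int := sgn (i + (n.+1 - (i + t)) * t)%N * sgn ((2 - t%:Z) * total_degree (take i s)).
have relT : \sum_(i < n.+2) \sum_(t < n.+2 | (0 < t)%N && (i + t <= n.+1)%N)
    T i t *~ sg i t = 0.
  by rewrite -[RHS]rel /insertion_sum us ss.
have n1 : (n.-1 < n.+2)%N by lia.
have two : (2 < n.+2)%N by lia.
have n2 : (n < n.+2)%N by lia.
rewrite (bigD1 (Ordinal n1)) //= (bigD1 (Ordinal two)) /= in relT; last by lia.
rewrite [X in _ + X + _]big1 ?addr0 in relT; last first.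
  move=> t /andP[/andP[t0 it] ne]; rewrite T0 ?mul0rz //.
    by move=> -[]; lia.
  by move=> -[e]; move: ne; rewrite -val_eqE /= e eqxx.
rewrite (bigD1 ord0) /= in relT; last by rewrite -val_eqE /=; lia.
rewrite (bigD1 (Ordinal n2)) /= in relT; last by lia.
rewrite [X in _ + (_ + X + _)]big1 ?addr0 in relT; last first.
  move=> t /andP[/andP[t0 it] ne]; rewrite T0 ?mul0rz //.
    by move=> -[e]; move: ne; rewrite -val_eqE /= e eqxx.
  by move=> -[]; lia.
rewrite [X in _ + (_ + X)]big1 ?addr0 in relT; last first.
  move=> i /andP[i1 i0]; rewrite big1 // => t /andP[t0 it].
  rewrite T0 ?mul0rz // => -[e _].
    by move: i0; rewrite -val_eqE /= e.
  by move: i1; rewrite -val_eqE /= e eqxx.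
have sgsq i t : sg i t * sg i t = 1.
  by rewrite /sg mulrACA !sgn_sq.
exists (- sg 0%N n * sg n.-1 2%N); rewrite -TA -TB mulrzA mulrNz.
move/eqP: relT; rewrite addr_eq0 => /eqP <-.
by rewrite -mulrzA sgsq mulr1z.
Qed.

(** Here the last argument z has degree 3k, so any operation with two or more letters before it
    vanishes and only m_2(e, z) remains. *)
Lemma product_3k1 k j x : E ((3 * k + 1)%N%:Z, j) x -> addspan (fun y =>
  exists e a ja, [/\ E (1, 1) e, E ((3 * k)%N%:Z, ja) a & y = m [:: e; a]]) x.
Proof.
move=> Ex; apply: addspan_sub (hG _ Ex); last by lia.
move=> _ [w [z [j' [w0 hw Ez ->]]]].
rewrite (_ : (3 * k + 1)%N%:Z - 1 = (3 * k)%N%:Z) in Ez; last by lia.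
case: w w0 hw => [//|e [|e' w]] _ hw.
  by apply: addspan_in; exists e, z, j'; split=> //; apply: hw; rewrite inE.
rewrite -[_ ++ _](_ : unzip2 ([seq (E1, x) | x <- [:: e, e' & w]] ++ [:: (E0, z)]) = _).
  rewrite m_E0_eq0; first exact: addspan0.
  - move=> y; rewrite mem_cat => /orP[/mapP[u uw ->]|]; first exact: piece_word uw.
    by rewrite inE => /eqP->; apply: (piece0 Ez).
  - by rewrite size_cat /=; lia.
  - by rewrite /unzip1 map_cat mem_cat; apply/orP; right; rewrite /= mem_seq1.
by rewrite /unzip2 map_cat -map_comp map_id.
Qed.

(** Arity 2 is excluded because E^[1] multiplies nontrivially only with E^[0]. *)
Lemma m_word_size w z : (forall e, e \in w -> E (1, 1) e) -> w <> [::] ->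
  (exists2 p, p != E0 & piece_space E d p z) ->
  m (w ++ [:: z]) <> 0 -> (size w).+1 \in [:: d; d.+1].
Proof.
move=> hw w0 [p p0 hz] nz; apply: contrapT => /negP sw; apply: nz.
case: w w0 hw sw => [//|e [|e' w]] _ hw sw.
  by apply: (m_E1_pair_eq0 _ hz p0); apply: (piece_word hw); rewrite inE.
by apply: msize => //; rewrite size_cat addn1 inE negb_or sw andbT /=; lia.
Qed.

Lemma pull_out_word w q jz z k ja a : (forall e, e \in w -> E (1, 1) e) ->
  (size w).+1 \in [:: d; d.+1] -> E (q, jz) z -> E ((3 * k)%N%:Z, ja) a ->
  (exists2 p, p != E0 & piece_space E d p z) ->
  exists c, E (q + 1, (size w)%:Z + jz) c /\ m (w ++ [:: m [:: z; a]]) = m [:: c; a].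
Proof.
move=> hw sw Ez Ea hz; have [e ->] := pull_out hw sw Ez Ea hz.
exists (m (w ++ [:: z]) *~ e); split.
  by apply: (gradingMz gE); exact: (m_tail_degree mdeg hw Ez).
have D : {morph (fun c => m [:: c; a]) : c c' / c + c'}.
  by move=> c c'; have := mlin [::] [:: a] 1 c c'; rewrite !scale1r.
by rewrite (morph_mulrz _ _ D).
Qed.

(** The last argument z in E^(3k+1) is a sum of products e a by [product_3k1]; pulling a out leaves
    the factor m(w, e) in E^2. *)
Lemma product_3k2 k j x : (0 < k)%N -> E ((3 * k + 2)%N%:Z, j) x -> addspan (fun y =>
  exists c a jc ja, [/\ E (2, jc) c, E ((3 * k)%N%:Z, ja) a & y = m [:: c; a]]) x.
Proof.
move=> k0 Ex; apply: addspan_sub (hG _ Ex); last by lia.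
move=> _ [w [z [j' [w0 hw Ez ->]]]].
rewrite (_ : (3 * k + 2)%N%:Z - 1 = (3 * k + 1)%N%:Z) in Ez; last by lia.
have [->|/eqP nz] := eqVneq (m (w ++ [:: z])) 0; first exact: addspan0.
have sw : (size w).+1 \in [:: d; d.+1].
  apply: (m_word_size hw w0 _ nz); exists E1; first by rewrite piece_eqE.
  exact: piece1 Ez.
move: z Ez {nz} => z /product_3k1; move: z.
apply: (addspan_hom (morph_add0 (m_tailD w)) (m_tailD w)).
move=> _ [e [a [ja [Ee Ea ->]]]].
have [|c [Ec ->]] := pull_out_word hw sw Ee Ea.
  by exists E1; [rewrite piece_eqE|apply: (@piece1 0 1)].
by apply: addspan_in; exists c, a, ((size w)%:Z + 1), ja.
Qed.

(** One step further: z in E^(3k+2) is a sum of products y a with y in E^2 by [product_3k2], and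
    pulling a out leaves m(w, y) in E^3. *)
Lemma product_3k3 k j x : (0 < k)%N -> E ((3 * k + 3)%N%:Z, j) x -> addspan (fun y =>
  exists c a jc ja, [/\ E (3, jc) c, E ((3 * k)%N%:Z, ja) a & y = m [:: c; a]]) x.
Proof.
move=> k0 Ex; apply: addspan_sub (hG _ Ex); last by lia.
move=> _ [w [z [j' [w0 hw Ez ->]]]].
rewrite (_ : (3 * k + 3)%N%:Z - 1 = (3 * k + 2)%N%:Z) in Ez; last by lia.
have [->|/eqP nz] := eqVneq (m (w ++ [:: z])) 0; first exact: addspan0.
have pieceN0 q : q \in [:: E2d; E2d1] -> q != E0.
  by rewrite !inE => /orP[] /eqP->; rewrite piece_eqE.
have sw : (size w).+1 \in [:: d; d.+1].
  apply: (m_word_size hw w0 _ nz); have [z0|[q /pieceN0 qN0 hz]] := piece2 Ez; last by exists q.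
  by case: nz; rewrite z0 (morph_add0 (m_tailD w)).
move: z Ez {nz} => z /(product_3k2 k0); move: z.
apply: (addspan_hom (morph_add0 (m_tailD w)) (m_tailD w)).
move=> _ [y [a [jy [ja [Ey Ea ->]]]]].
have [y0|[q /pieceN0 qN0 hy]] := @piece2 0 _ _ Ey.
  rewrite y0 (_ : m [:: 0; a] = 0) ?(morph_add0 (m_tailD w)); first exact: addspan0.
  exact: (multilinear0 [::]).
have [|c [Ec ->]] := pull_out_word hw sw Ey Ea; first by exists q.
by apply: addspan_in; exists c, a, ((size w)%:Z + jy), ja.
Qed.

(** The decompositions above use only m_2 in the final expression, so they survive the removal of
    either long operation. *)
Lemma truncated_generated q : generated_by_123 (cohom E) (restrict_ops [:: 2%N; q] m).
Proof.
have gC := Ainf_grading hm.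
move=> p p3 x; split; last first.
  elim/addspan_ind: x / => [|x y Ex Ey|_ [s [s0 hs _ <- ->]]].
  - exact: (grading0 gC).
  - exact: (gradingD gC).
  - rewrite /restrict_ops; case: ifP => _; last exact: (grading0 gC).
    exact: (Ainf_degree hm).
apply: addspan_sub => {}x [j Ex].
have product (r : nat) (k : nat) : (0 < r)%N -> (0 < k)%N -> p = (3 * k + r)%N%:Z ->
    addspan (fun y => exists c a jc ja,
      [/\ E (r%:Z, jc) c, E ((3 * k)%N%:Z, ja) a & y = m [:: c; a]]) x ->
    addspan (fun y => exists s : seq (int * V), [/\ s <> [::], homog (cohom E) s,
      forall z, z \in s -> 1 <= z.1, total_degree s + (2 - (size s)%:Z) = p &
      y = restrict_ops [:: 2%N; q] m (unzip2 s)]) x.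
  move=> r0 k0 pE; apply: addspan_sub => _ [c [a [jc [ja [Ec Ea ->]]]]].
  apply: addspan_in; exists [:: (r%:Z, c); ((3 * k)%N%:Z, a)]; split=> //.
  - by move=> z; rewrite !inE => /orP[] /eqP->; [apply: cohom1 Ec|apply: cohom1 Ea].
  - by move=> z; rewrite !inE => /orP[] /eqP-> /=; lia.
  - by rewrite /total_degree !big_cons big_nil /= pE; lia.
case: p p3 Ex product => // n p3 Ex product.
have nE := divn_eq n 3; have := ltn_pmod n (isT : 0 < 3)%N.
(* Remainder 0 is read as 3(k - 1) + 3, with left factor in E^3; n > 3 makes k - 1 positive. *)
set k := (n %/ 3)%N in nE *; case: (n %% 3)%N nE => [|[|[|//]]] nE _.
- apply: (product 3%N k.-1) => //; try lia.
  apply: (@product_3k3 k.-1 j); first by lia.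
  by rewrite (_ : (3 * k.-1 + 3)%N = n) //; lia.
- apply: (product 1%N k) => //; try lia.
  have Ex' : E ((3 * k + 1)%N%:Z, j) x by rewrite (_ : (3 * k + 1)%N = n) //; lia.
  apply: addspan_sub (product_3k1 Ex') => _ [e [a [ja [Ee Ea ->]]]].
  by apply: addspan_in; exists e, a, 1, ja.
- apply: (product 2%N k) => //; try lia.
  apply: (@product_3k2 k j); first by lia.
  by rewrite (_ : (3 * k + 2)%N = n) //; lia.
Qed.

Lemma truncated_single q : q \in [:: d; d.+1] ->
  single_Ainf q (cohom E) (restrict_ops [:: 2%N; q] m) one.
Proof.
move=> qd; split; first by move: qd; rewrite !inE; lia.
  exact: (restrict_Ainf mlin hm d4 msize qd).
by move=> s _ sq; rewrite /restrict_ops (negbTE sq).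
Qed.

End Truncated.

Theorem proposition2p12 (F : fieldType) (A : algType F) (Ag : nat -> A -> Prop)
    (d : nat) (V : lmodType F) (E : int * int -> V -> Prop)
    (m : seq V -> V) (one : V) :
  graded_algebra Ag ->
  (4 <= d)%N ->
  truncated_bi_Koszul Ag d E m one ->
  (single_Ainf d (cohom E) (restrict_ops [:: 2%N; d] m) one /\
   generated_by_123 (cohom E) (restrict_ops [:: 2%N; d] m)) /\
  (single_Ainf d.+1 (cohom E) (restrict_ops [:: 2%N; d.+1] m) one /\
   generated_by_123 (cohom E) (restrict_ops [:: 2%N; d.+1] m)).
Proof.
move=> hA d4 [[Q [Qg [dQ [etaQ [rQ mQ gen]]]]] hE trunc].
case: hE => gE sE hm mdeg m1 [P [Pg [dP [eta [f [rP hf _ hExt]]]]]].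
have mlin := Ainf_multilinear hm; have hQ := res_module rQ.
have Q_ge0 n l u : l < 0 -> Qg (n, l) u -> u = 0.
  case: n => n l0 Qu; last exact: (res_pos rQ _ Qu).
  by apply: (generated_ge0 hA hQ (gen n) _ l0 Qu) => k /orP[] /eqP->.
(* Both entries of [Delta d 1] equal 1. *)
have Q1 j phi : j <> 1 -> Hom_trivial_degree Ag Qg (1, j) phi -> forall u, phi u = 0.
  move=> j1; apply: (generated_triv_eq0 hA hQ (gen 1%N)).
  by rewrite /Delta /= muln0 orbb; apply/eqP.
have hG := Ext_generated hA rP rQ mQ Q_ge0 Q1 gE sE mlin mdeg m1 hf hExt.
have hD n j x : j <> (Delta d n).1%:Z -> j <> (Delta d n).2%:Z ->
    E (n%:Z, j) x -> x = 0.
  move=> j1 j2 Ex; have [i [ideg _ iinj _]] := Ext_minimal hA rP rQ mQ hExt.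
  apply: (iinj _ _ Ex); have [hx _] := Ext_cocycle hExt Ex.
  have hh := triv_degree_comp ideg hx; rewrite addr0 in hh.
  by apply: (generated_triv_eq0 hA hQ (gen n) _ hh); apply/norP; split; apply/eqP.
have S q := truncated_single hm d4 trunc (q := q).
have G q := truncated_generated gE hm mdeg d4 trunc hD hG q.
by split; split; [apply: S; rewrite !inE eqxx|exact: G|
  apply: S; rewrite !inE eqxx orbT|exact: G].
Qed.
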